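(* For every integer $n\geq 45$, $$\frac{p(n-1)}{p(n)}\left(1+\frac{\pi}{\sqrt{24}\,n^{3/2}}\right)>\frac{p(n)}{p(n+1)}.$$
   Context: $p(n)$ denotes the partition function, i.e. the number of partitions of the positive integer $n$ (nonincreasing sequences of positive integers with sum $n$), with $p(0)=1$. *)

(* Defs.v *)
(* Real numbers, sqrt, PI and Rpower are those of Stdlib; partitions are
   MathComp sequences of natural numbers. *)
From Stdlib Require Import Reals.
From mathcomp Require Import all_boot.

Set Implicit Arguments.
Unset Strict Implicit.
Unset Printing Implicit Defensive.

Definition is_partition (n : nat) (s : seq nat) : bool :=
  [&& sorted geq s, all (leq 1) s & sumn s == n].

(* A partition of n has at most n parts, each at most n, so counting inside the
   finite type of sequences of length at most n over {0, ..., n} loses nothing: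
   see [partition_number_unique]. *)
Definition partition_number (n : nat) : nat :=
  #|[set s : {bseq n of 'I_n.+1} | is_partition n (map val s)]|.

Lemma partition_bounds n s :
  is_partition n s -> size s <= n /\ all (fun x => x < n.+1) s.
Proof.
case/and3P=> _ s_pos /eqP <-; elim: s s_pos => [|x s IHs] //=.
case/andP=> x_pos /IHs[size_s all_s]; split.
  by rewrite -add1n leq_add.
rewrite ltnS leq_addr /=; apply: sub_all all_s => y.
by rewrite !ltnS => /leq_trans-> //; apply: leq_addl.
Qed.

Lemma partition_number_unique n (L : seq (seq nat)) :
  uniq L -> (forall s, (s \in L) = is_partition n s) ->
  size L = partition_number n.
Proof.
move=> uniqL memL; rewrite /partition_number cardE.
rewrite -(size_map (fun s : {bseq n of 'I_n.+1} => map val s)).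
apply: perm_size; apply: uniq_perm => //.
  rewrite map_inj_uniq ?enum_uniq // => s t /= /(inj_map val_inj) eq_st.
  exact: val_inj.
move=> s; rewrite memL; apply/idP/mapP=> [part_s | [t]]; last first.
  by rewrite mem_enum inE => part_t ->.
have [size_s /allP lt_s] := partition_bounds part_s.
pose u : seq 'I_n.+1 := map inord s.
have u_s : map val u = s.
  rewrite -map_comp -[RHS]map_id; apply/eq_in_map => x /lt_s lt_x.
  exact: inordK.
have size_u : size u <= n by rewrite -(size_map val) u_s.
by exists (Bseq size_u); rewrite ?mem_enum ?inE /= u_s.
Qed.

Lemma partition_number0 : partition_number 0 = 1.
Proof.
rewrite -(@partition_number_unique 0 [:: [::]]) // => s; rewrite inE.
apply/eqP/idP=> [-> // | /partition_bounds[]].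
by rewrite leqn0 => /nilP.
Qed.

(* Main.v *)
(* p(n) is the n-th coefficient of the product of the 1 / (1 - q^k), that is, the
   mean of exp(n tau) times this product at q = exp(-tau) over a vertical segment
   tau = t + i y, |y| <= pi, taken through the saddle point t = sqrt(zeta(2) / x),
   x = n - 1/24. For |y| <= 3 t the pentagonal number series is a Gaussian sum,
   and Poisson summation turns it into a single exponential up to a relative
   error exp(-(4/5) zeta(2) / t); for |y| >= 3 t the product is exponentially
   smaller. The integral of sqrt(tau) exp(zeta(2) / tau + x tau) is elementary up
   to the complex error function, which gives the leading term of Rademacher's
   expansion with a relative error of at most 1 / (10 x^2) for n >= 1999. In
   p(n)^2 / (p(n-1) p(n+1)) all constants cancel, and the leading terms contribute
   exp(pi / (sqrt 24 n^(3/2)) - 1 / n^2 + O(n^(-5/2))), where 1 / n^2 absorbs the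
   errors. The cases 45 <= n <= 2000 are computed with Euler's recurrence.

   All series and products are replaced by finite truncations with uniform bounds. *)
Require Import Defs.
From Stdlib Require Import Reals Lra Lia ZArith List Machin.
From Coquelicot Require Import Coquelicot.

Local Open Scope R_scope.

(** * Complex exponential and derivatives of complex-valued functions *)

(** The gain 1/n^2 comes from the algebraic factor 1/x of the leading term, since 1/x^2 = (1 -
    1/x^2) / ((x - 1)(x + 1)). The relative error of the asymptotic formula enters four times, twice
    through p(n) and once through each neighbour, so it has to stay below 1/(4 x^2); the constant
    1/10 uses less than half of the gain. This precision is what asks for explicit constants
    everywhere. For N >= n, p(n) is exactly the n-th coefficient of the product over k <= N, so N
    may grow with the estimates and no infinite product appears. Poisson summation is obtained by
    testing a truncated theta series against cos^(2N+1)(pi x), which is a finite sum of odd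
    harmonics and at the same time concentrates at 0. The cut |y| = 3 t balances three losses, all
    measured in u = 1/t: the dual theta terms lose (4/5) zeta(2) u, the ends of the main integral
    (9/10) zeta(2) u, and the outer range (17/20) u, which is the weakest and decides from which n
    on the asymptotic argument works. *)

Lemma Ceq (z w : C) : Re z = Re w -> Im z = Im w -> z = w.
Proof. destruct z, w; simpl; congruence. Qed.

Lemma exp_le x y : x <= y -> exp x <= exp y.
Proof.
intros [H|H]; [apply Rlt_le, exp_increasing, H | rewrite H; apply Rle_refl].
Qed.

Definition Cexp (z : C) : C := (exp (Re z) * cos (Im z), exp (Re z) * sin (Im z)).

Lemma Re_Cexp z : Re (Cexp z) = exp (Re z) * cos (Im z).
Proof. reflexivity. Qed.

Lemma Im_Cexp z : Im (Cexp z) = exp (Re z) * sin (Im z).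
Proof. reflexivity. Qed.

Lemma Cexp_plus (z w : C) : Cexp (z + w) = (Cexp z * Cexp w)%C.
Proof.
destruct z as [a b], w as [c d]; unfold Cexp, Cmult; simpl.
rewrite exp_plus, cos_plus, sin_plus; f_equal; ring.
Qed.

Lemma Cexp_0 : Cexp 0 = 1%C.
Proof. unfold Cexp; simpl; rewrite exp_0, cos_0, sin_0; unfold RtoC; f_equal; ring. Qed.

Lemma Cmod_Cexp (z : C) : Cmod (Cexp z) = exp (Re z).
Proof.
unfold Cmod, Cexp; simpl.
replace (_ + _) with (exp (Re z) * exp (Re z)).
  apply sqrt_square, Rlt_le, exp_pos.
generalize (sin2_cos2 (Im z)); unfold Rsqr; intros H.
replace (exp (Re z) * exp (Re z))
  with (exp (Re z) * exp (Re z) * (sin (Im z) * sin (Im z) + cos (Im z) * cos (Im z)));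
  [ring | rewrite H; ring].
Qed.

Lemma Cexp_neq_0 (z : C) : Cexp z <> 0.
Proof. apply Cmod_gt_0; rewrite Cmod_Cexp; apply exp_pos. Qed.

Lemma Cexp_opp (z : C) : Cexp (- z) = (/ Cexp z)%C.
Proof.
assert (H : (Cexp (- z) * Cexp z = 1)%C).
  rewrite <- Cexp_plus, <- Cexp_0; f_equal; ring.
assert (Hz := Cexp_neq_0 z).
replace (Cexp (- z)) with (Cexp (- z) * Cexp z / Cexp z)%C by (field; exact Hz).
rewrite H; field; exact Hz.
Qed.

Lemma Cexp_minus (z w : C) : Cexp (z - w) = (Cexp z / Cexp w)%C.
Proof. unfold Cminus, Cdiv; rewrite Cexp_plus, Cexp_opp; reflexivity. Qed.

Lemma Cexp_nat (n : nat) (z : C) : Cexp (INR n * z) = (Cexp z ^ n)%C.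
Proof.
induction n as [|n IH].
  simpl; replace (0 * z)%C with (RtoC 0) by ring; apply Cexp_0.
rewrite S_INR, RtoC_plus; simpl; rewrite <- IH, <- Cexp_plus; f_equal; ring.
Qed.

Lemma Cexp_RtoC (x : R) : Cexp (RtoC x) = RtoC (exp x).
Proof. unfold Cexp, RtoC; simpl; rewrite cos_0, sin_0; f_equal; ring. Qed.

Lemma Cexp_conj (z : C) : Cexp (Cconj z) = Cconj (Cexp z).
Proof. destruct z as [a b]; apply Ceq; simpl; rewrite ?cos_neg, ?sin_neg; ring. Qed.

Lemma im_le_Cmod (z : C) : Rabs (Im z) <= Cmod z.
Proof. eapply Rle_trans; [apply Rmax_r | apply Rmax_Cmod]. Qed.

Lemma Cmod_le_abs (z : C) : Cmod z <= Rabs (Re z) + Rabs (Im z).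
Proof.
replace z with (RtoC (Re z) + Ci * RtoC (Im z))%C at 1.
  eapply Rle_trans; [apply Cmod_triangle|].
  rewrite Cmod_mult, Cmod_Ci, !Cmod_R; lra.
apply Ceq; simpl; ring.
Qed.

Lemma Cmod_sqr (z : C) : Cmod z * Cmod z = Re z * Re z + Im z * Im z.
Proof. generalize (Cmod2_alt z); simpl; rewrite !Rmult_1_r; auto. Qed.

Lemma Cmod_triangle_rev (z w : C) : Cmod z - Cmod w <= Cmod (z - w).
Proof.
generalize (Cmod_triangle (z - w) w).
replace (z - w + w)%C with z by ring; lra.
Qed.

(** Only curves are ever differentiated. Analyticity enters through chain rules along a curve, for
    [Cexp], inversion, [Gauss] and [Csqrt], so that each contour integral becomes a real integral
    with a known primitive. *)
Definition is_Cderive (f : R -> C) (x : R) (l : C) : Prop :=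
  is_derive (fun y => Re (f y)) x (Re l) /\ is_derive (fun y => Im (f y)) x (Im l).

Lemma is_Cderive_eq (f : R -> C) x l l' : is_Cderive f x l -> l = l' -> is_Cderive f x l'.
Proof. intros H <-; exact H. Qed.

Lemma is_Cderive_ext (f g : R -> C) x l :
  (forall y, f y = g y) -> is_Cderive f x l -> is_Cderive g x l.
Proof.
intros Hfg [H1 H2]; split; [eapply is_derive_ext, H1 | eapply is_derive_ext, H2];
  intros y; simpl; rewrite Hfg; reflexivity.
Qed.

Lemma is_Cderive_const (z : C) x : is_Cderive (fun _ => z) x 0.
Proof. split; [exact (is_derive_const (V := R_NormedModule) (Re z) x) | exact (is_derive_const (V := R_NormedModule) (Im z) x)]. Qed.

Lemma is_Cderive_RtoC (f : R -> R) x l :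
  is_derive f x l -> is_Cderive (fun y => RtoC (f y)) x (RtoC l).
Proof. intros H; split; [exact H | exact (is_derive_const (V := R_NormedModule) 0 x)]. Qed.

Lemma is_Cderive_plus f g x l m :
  is_Cderive f x l -> is_Cderive g x m -> is_Cderive (fun y => f y + g y)%C x (l + m)%C.
Proof.
intros [H1 H2] [H3 H4]; split; [exact (is_derive_plus _ _ _ _ _ H1 H3) | exact (is_derive_plus _ _ _ _ _ H2 H4)].
Qed.

Lemma is_derive_Rmult (f g : R -> R) x l m : is_derive f x l -> is_derive g x m ->
  is_derive (fun y => f y * g y) x (l * g x + f x * m).
Proof. intros H1 H2; apply (is_derive_mult f g x l m H1 H2); intros; apply Rmult_comm. Qed.

Lemma ex_derive_Rmult (f g : R -> R) x : ex_derive f x -> ex_derive g x ->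
  ex_derive (fun y => f y * g y) x.
Proof. intros [l Hl] [m Hm]; eexists; apply is_derive_Rmult; eassumption. Qed.

Lemma is_Cderive_mult f g x l m :
  is_Cderive f x l -> is_Cderive g x m ->
  is_Cderive (fun y => f y * g y)%C x (l * g x + f x * m)%C.
Proof.
intros [H1 H2] [H3 H4]; split.
- replace (Re _) with ((Re l * Re (g x) + Re (f x) * Re m) - (Im l * Im (g x) + Im (f x) * Im m))
    by (rewrite re_plus, !re_mult; ring).
  exact (is_derive_minus _ _ _ _ _ (is_derive_Rmult _ _ _ _ _ H1 H3) (is_derive_Rmult _ _ _ _ _ H2 H4)).
- replace (Im _) with ((Re l * Im (g x) + Re (f x) * Im m) + (Im l * Re (g x) + Im (f x) * Re m))
    by (rewrite im_plus, !im_mult; ring).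
  exact (is_derive_plus _ _ _ _ _ (is_derive_Rmult _ _ _ _ _ H1 H4) (is_derive_Rmult _ _ _ _ _ H2 H3)).
Qed.

Lemma is_Cderive_scal (z : C) f x l :
  is_Cderive f x l -> is_Cderive (fun y => z * f y)%C x (z * l)%C.
Proof.
intros H; eapply is_Cderive_eq; [apply is_Cderive_mult; [apply is_Cderive_const | exact H]|]; cbv beta; ring.
Qed.

Lemma is_Cderive_opp f x l : is_Cderive f x l -> is_Cderive (fun y => - f y)%C x (- l)%C.
Proof.
intros [H1 H2]; split; [exact (is_derive_opp _ _ _ H1) | exact (is_derive_opp _ _ _ H2)].
Qed.

Lemma is_Cderive_minus f g x l m :
  is_Cderive f x l -> is_Cderive g x m -> is_Cderive (fun y => f y - g y)%C x (l - m)%C.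
Proof. intros H1 H2; apply is_Cderive_plus; [exact H1 | apply is_Cderive_opp, H2]. Qed.

Lemma is_derive_Rcomp (f g : R -> R) x l m : is_derive f (g x) l -> is_derive g x m ->
  is_derive (fun y => f (g y)) x (l * m).
Proof.
intros H1 H2; rewrite Rmult_comm; exact (is_derive_comp f g x l m H1 H2).
Qed.

Lemma is_derive_eq (f : R -> R) (x l l' : R) : is_derive f x l -> l = l' -> is_derive f x l'.
Proof. intros H <-; exact H. Qed.

Lemma is_Cderive_exp f x l :
  is_Cderive f x l -> is_Cderive (fun y => Cexp (f y)) x (Cexp (f x) * l)%C.
Proof.
intros [H1 H2].
assert (He := is_derive_Rcomp exp _ x _ _ (is_derive_exp _) H1).
assert (Hc := is_derive_Rcomp cos _ x _ _ (is_derive_cos _) H2).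
assert (Hs := is_derive_Rcomp sin _ x _ _ (is_derive_sin _) H2).
split.
- apply (is_derive_eq _ _ _ _ (is_derive_Rmult _ _ _ _ _ He Hc)); rewrite re_mult; simpl; ring.
- apply (is_derive_eq _ _ _ _ (is_derive_Rmult _ _ _ _ _ He Hs)); rewrite im_mult; simpl; ring.
Qed.

Lemma is_Cderive_inv f x l :
  is_Cderive f x l -> f x <> 0 -> is_Cderive (fun y => / f y)%C x (- l / (f x * f x))%C.
Proof.
intros [H1 H2] H0.
assert (Hn : (Re (f x)) ^ 2 + (Im (f x)) ^ 2 <> 0).
  intros H; apply H0, Ceq; simpl; nra.
assert (HN := is_derive_plus _ _ _ _ _ (is_derive_Rmult _ _ _ _ _ H1 H1) (is_derive_Rmult _ _ _ _ _ H2 H2)).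
assert (HN' : is_derive (fun y => (Re (f y)) ^ 2 + (Im (f y)) ^ 2) x
   (2 * (Re (f x) * Re l + Im (f x) * Im l))).
  replace (2 * _) with (plus (Re l * Re (f x) + Re (f x) * Re l) (Im l * Im (f x) + Im (f x) * Im l))
    by (unfold plus; simpl; ring).
  eapply is_derive_ext, HN; intros; unfold plus; simpl; ring.
assert (HI := is_derive_inv _ _ _ HN' Hn).
split.
- apply (is_derive_eq _ _ _ _ (is_derive_Rmult _ _ _ _ _ H1 HI)).
  destruct (f x) as [u v], l as [p q]; simpl in *; field; split; nra.
- apply (is_derive_eq _ _ _ _ (is_derive_Rmult _ _ _ _ _ (is_derive_opp _ _ _ H2) HI)).
  destruct (f x) as [u v], l as [p q]; simpl in *; unfold opp; simpl; field; split; nra.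
Qed.

(** * The complex Gaussian integral *)

(** Applied to [Gauss_re] and [Gauss_im], whose partial derivatives satisfy the Cauchy-Riemann
    equations, this chain rule makes [Gauss] a primitive of exp(-z^2) along every curve. *)
Lemma is_derive_comp_2d (f fx fy : R -> R -> R) (u v : R -> R) (s du dv : R) :
  (forall x y, is_derive (fun z => f z y) x (fx x y)) ->
  (forall x y, is_derive (fun z => f x z) y (fy x y)) ->
  (forall x y, continuity_2d_pt fx x y) ->
  is_derive u s du -> is_derive v s dv ->
  is_derive (fun r => f (u r) (v r)) s (du * fx (u s) (v s) + dv * fy (u s) (v s)).
Proof.
intros Hx Hy Hc Hu Hv.
assert (Hf := is_derive_filterdiff f (u s) (v s) fx (fy (u s) (v s))
  (filter_forall _ (fun z => Hx (fst z) (snd z))) (Hy _ _)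
  (proj1 (continuity_2d_pt_filterlim fx (u s) (v s)) (Hc _ _))).
assert (H := filterdiff_comp'_2 u v f s _ _
  (fun p q => plus (scal p (fx (u s) (v s))) (scal q (fy (u s) (v s)))) Hu Hv Hf).
eapply filterdiff_ext_lin; [exact H|].
intros r; unfold plus, scal; simpl; unfold mult; simpl; ring.
Qed.

Lemma ex_RInt_derivable (f : R -> R) a b : (forall x, ex_derive f x) -> ex_RInt f a b.
Proof.
intros H; apply (ex_RInt_continuous (V := R_CompleteNormedModule)).
intros z _; apply (ex_derive_continuous (K := R_AbsRing) (V := R_NormedModule)), H.
Qed.

Lemma RInt_eq (f g : R -> R) a b : (forall x, f x = g x) -> RInt f a b = RInt g a b.
Proof. intros H; apply RInt_ext; intros; apply H. Qed.

(* Restates at type [R] an equation between integrals, typed in a normed module. *)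
Ltac eqR := match goal with |- @eq _ ?a ?b => change (@eq R a b) end.

Lemma RInt_const_R (l a b : R) : RInt (fun _ => l) a b = (b - a) * l.
Proof. exact (RInt_const a b l). Qed.

Lemma RInt_scal_R (l : R) (f : R -> R) a b : ex_RInt f a b ->
  RInt (fun x => l * f x) a b = l * RInt f a b.
Proof. exact (RInt_scal (V := R_CompleteNormedModule) f a b l). Qed.

Lemma RInt_plus_R (f g : R -> R) a b : ex_RInt f a b -> ex_RInt g a b ->
  RInt (fun x => f x + g x) a b = RInt f a b + RInt g a b.
Proof. exact (RInt_plus (V := R_CompleteNormedModule) f g a b). Qed.

Lemma RInt_minus_R (f g : R -> R) a b : ex_RInt f a b -> ex_RInt g a b ->
  RInt (fun x => f x - g x) a b = RInt f a b - RInt g a b.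
Proof. exact (RInt_minus (V := R_CompleteNormedModule) f g a b). Qed.

Lemma RInt_Chasles_R (f : R -> R) a b c : ex_RInt f a b -> ex_RInt f b c ->
  RInt f a b + RInt f b c = RInt f a c.
Proof. exact (RInt_Chasles (V := R_CompleteNormedModule) f a b c). Qed.

Lemma continuous_derivable (f : R -> R) x : ex_derive f x -> continuous f x.
Proof. apply (ex_derive_continuous (K := R_AbsRing) (V := R_NormedModule)). Qed.

Lemma RInt_FTC (f df : R -> R) a b :
  (forall x, Rmin a b <= x <= Rmax a b -> is_derive f x (df x)) ->
  (forall x, Rmin a b <= x <= Rmax a b -> continuous df x) ->
  RInt df a b = f b - f a.
Proof.
intros H1 H2; apply is_RInt_unique.
exact (is_RInt_derive (V := R_CompleteNormedModule) f df a b H1 H2).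
Qed.

Lemma is_derive_RInt_upper (f : R -> R) a x :
  (forall x, ex_derive f x) -> is_derive (fun y => RInt f a y) x (f x).
Proof.
intros H; apply (is_derive_RInt (V := R_NormedModule) f _ a x).
- apply filter_forall; intros y.
  apply (RInt_correct (V := R_CompleteNormedModule)), ex_RInt_derivable, H.
- apply continuous_derivable, H.
Qed.

(* Gauss (x + iy) integrates exp(-z^2) from 0 to x along the real axis and then
   vertically up to x+iy. *)
Definition Gauss_re (x y : R) : R :=
  RInt (fun u => exp (- (u * u))) 0 x + RInt (fun v => exp (v * v - x * x) * sin (2 * x * v)) 0 y.
Definition Gauss_im (x y : R) : R :=
  RInt (fun v => exp (v * v - x * x) * cos (2 * x * v)) 0 y.
Definition Gauss (w : C) : C := (Gauss_re (Re w) (Im w), Gauss_im (Re w) (Im w)).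

Lemma continuity_2d_exp_sqr (x y : R) :
  continuity_2d_pt (fun x y => exp (y * y - x * x)) x y.
Proof.
apply (continuity_1d_2d_pt_comp exp (fun x y => y * y - x * x)).
- apply derivable_continuous_pt, derivable_exp.
- apply continuity_2d_pt_minus; apply continuity_2d_pt_mult;
    auto using continuity_2d_pt_id1, continuity_2d_pt_id2.
Qed.

Lemma continuity_2d_cos2 (x y : R) : continuity_2d_pt (fun x y => cos (2 * x * y)) x y.
Proof.
apply (continuity_1d_2d_pt_comp cos (fun x y => 2 * x * y)).
- apply derivable_continuous_pt, derivable_cos.
- repeat apply continuity_2d_pt_mult;
    auto using continuity_2d_pt_id1, continuity_2d_pt_id2, continuity_2d_pt_const.
Qed.

Lemma continuity_2d_sin2 (x y : R) : continuity_2d_pt (fun x y => sin (2 * x * y)) x y.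
Proof.
apply (continuity_1d_2d_pt_comp sin (fun x y => 2 * x * y)).
- apply derivable_continuous_pt, derivable_sin.
- repeat apply continuity_2d_pt_mult;
    auto using continuity_2d_pt_id1, continuity_2d_pt_id2, continuity_2d_pt_const.
Qed.

Lemma is_derive_param (f df : R -> R -> R) (y x : R) :
  (forall u v, is_derive (fun z => f z v) u (df u v)) ->
  (forall u v, continuity_2d_pt df u v) ->
  (forall u v, ex_derive (fun v => f u v) v) ->
  is_derive (fun u => RInt (fun v => f u v) 0 y) x (RInt (fun v => df x v) 0 y).
Proof.
intros Hd Hc He.
rewrite <- (RInt_ext (fun v => Derive (fun u => f u v) x)).
2: { intros v _; apply is_derive_unique, Hd. }
apply is_derive_RInt_param.
- apply filter_forall; intros u v _; eexists; apply Hd.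
- intros v _; eapply continuity_2d_pt_ext; [|apply (Hc x v)].
  intros; symmetry; apply is_derive_unique, Hd.
- apply filter_forall; intros u; apply ex_RInt_derivable; intros v; apply He.
Qed.

(** Path independence: differentiation under the integral sign produces the v-derivative of exp(v^2
    - x^2) cos(2 x v), and its boundary value at v = 0 cancels the exp(-x^2) of the horizontal
    segment. *)
Lemma Gauss_re_dx x y :
  is_derive (fun z => Gauss_re z y) x (exp (y * y - x * x) * cos (2 * x * y)).
Proof.
apply (is_derive_eq _ _ (exp (- (x * x)) +
  RInt (fun v => -2 * x * (exp (v * v - x * x) * sin (2 * x * v))
                 + 2 * v * (exp (v * v - x * x) * cos (2 * x * v))) 0 y)).
- apply (is_derive_plus (K := R_AbsRing) (V := R_NormedModule)
    (fun z => RInt (fun u => exp (- (u * u))) 0 z)).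
  + apply (is_derive_RInt_upper (fun u => exp (- (u * u)))); intros; auto_derive; auto.
  + apply (is_derive_param (fun x v => exp (v * v - x * x) * sin (2 * x * v))
      (fun x v => -2 * x * (exp (v * v - x * x) * sin (2 * x * v))
                 + 2 * v * (exp (v * v - x * x) * cos (2 * x * v)))).
    * intros u v; auto_derive; auto; unfold Rminus; ring.
    * intros u v; apply continuity_2d_pt_plus; apply continuity_2d_pt_mult;
      repeat apply continuity_2d_pt_mult; auto using continuity_2d_pt_id1, continuity_2d_pt_id2,
        continuity_2d_pt_const, continuity_2d_exp_sqr, continuity_2d_cos2, continuity_2d_sin2.
    * intros u v; auto_derive; auto.
- rewrite (RInt_FTC (fun v => exp (v * v - x * x) * cos (2 * x * v))).
  + replace (0 * 0 - x * x) with (- (x * x)) by ring.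
    replace (2 * x * 0) with 0 by ring; rewrite cos_0; ring.
  + intros v _; auto_derive; auto; unfold Rminus; ring.
  + intros v _; apply continuous_derivable; auto_derive; auto.
Qed.

Lemma Gauss_im_dx x y :
  is_derive (fun z => Gauss_im z y) x (- (exp (y * y - x * x) * sin (2 * x * y))).
Proof.
apply (is_derive_eq _ _ (
  RInt (fun v => -2 * x * (exp (v * v - x * x) * cos (2 * x * v))
                 - 2 * v * (exp (v * v - x * x) * sin (2 * x * v))) 0 y)).
- apply (is_derive_param (fun x v => exp (v * v - x * x) * cos (2 * x * v))
    (fun x v => -2 * x * (exp (v * v - x * x) * cos (2 * x * v))
                 - 2 * v * (exp (v * v - x * x) * sin (2 * x * v)))).
    * intros u v; auto_derive; auto; unfold Rminus; ring.
    * intros u v; apply continuity_2d_pt_minus; apply continuity_2d_pt_mult;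
      repeat apply continuity_2d_pt_mult; auto using continuity_2d_pt_id1, continuity_2d_pt_id2,
        continuity_2d_pt_const, continuity_2d_exp_sqr, continuity_2d_cos2, continuity_2d_sin2.
    * intros u v; auto_derive; auto.
- rewrite (RInt_FTC (fun v => - (exp (v * v - x * x) * sin (2 * x * v)))).
  + replace (2 * x * 0) with 0 by ring; rewrite sin_0; ring.
  + intros v _; auto_derive; auto; unfold Rminus; ring.
  + intros v _; apply continuous_derivable; auto_derive; auto.
Qed.

Lemma Gauss_re_dy x y :
  is_derive (fun z => Gauss_re x z) y (exp (y * y - x * x) * sin (2 * x * y)).
Proof.
apply (is_derive_eq _ _ (0 + exp (y * y - x * x) * sin (2 * x * y))); [|ring].
apply (is_derive_plus (K := R_AbsRing) (V := R_NormedModule) (fun _ => RInt (fun u => exp (- (u * u))) 0 x)).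
- apply (is_derive_const (V := R_NormedModule)).
- apply (is_derive_RInt_upper (fun v => exp (v * v - x * x) * sin (2 * x * v)));
    intros; auto_derive; auto.
Qed.

Lemma Gauss_im_dy x y :
  is_derive (fun z => Gauss_im x z) y (exp (y * y - x * x) * cos (2 * x * y)).
Proof.
apply (is_derive_RInt_upper (fun v => exp (v * v - x * x) * cos (2 * x * v)));
    intros; auto_derive; auto.
Qed.

Lemma is_Cderive_Gauss (w : R -> C) s l :
  is_Cderive w s l -> is_Cderive (fun r => Gauss (w r)) s (Cexp (- (w s * w s)) * l)%C.
Proof.
intros [H1 H2].
assert (E1 : Re (- (w s * w s)) = Im (w s) * Im (w s) - Re (w s) * Re (w s)) by (rewrite re_opp, re_mult; ring).
assert (E2 : Im (- (w s * w s)) = - (2 * Re (w s) * Im (w s))) by (rewrite im_opp, im_mult; ring).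
split.
- eapply is_derive_eq.
  + apply (is_derive_comp_2d Gauss_re _ _ (fun r => Re (w r)) (fun r => Im (w r)) s (Re l) (Im l) Gauss_re_dx Gauss_re_dy); [|exact H1|exact H2].
    intros x y; apply continuity_2d_pt_mult; auto using continuity_2d_exp_sqr, continuity_2d_cos2.
  + rewrite re_mult, Re_Cexp, Im_Cexp, E1, E2, cos_neg, sin_neg; ring.
- eapply is_derive_eq.
  + apply (is_derive_comp_2d Gauss_im _ _ (fun r => Re (w r)) (fun r => Im (w r)) s (Re l) (Im l) Gauss_im_dx Gauss_im_dy); [|exact H1|exact H2].
    intros x y; apply continuity_2d_pt_opp, continuity_2d_pt_mult; auto using continuity_2d_exp_sqr, continuity_2d_sin2.
  + rewrite im_mult, Re_Cexp, Im_Cexp, E1, E2, cos_neg, sin_neg; ring.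
Qed.

(** * The Gaussian integral on the half-line *)

Definition Gauss_real (x : R) : R := RInt (fun u => exp (- (u * u))) 0 x.

Lemma ex_RInt_gaussian a b : ex_RInt (fun u => exp (- (u * u))) a b.
Proof. apply ex_RInt_derivable; intros; auto_derive; auto. Qed.

Lemma Gauss_real_chasles x y :
  Gauss_real y - Gauss_real x = RInt (fun u => exp (- (u * u))) x y.
Proof.
unfold Gauss_real.
rewrite <- (RInt_Chasles (V := R_CompleteNormedModule) (fun u => exp (- (u * u))) 0 x y);
  try apply ex_RInt_gaussian.
unfold plus; simpl; ring.
Qed.

Lemma Gauss_real_incr x y : x <= y -> Gauss_real x <= Gauss_real y.
Proof.
intros H; cut (0 <= RInt (fun u => exp (- (u * u))) x y).
  rewrite <- Gauss_real_chasles; lra.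
apply RInt_ge_0; auto using ex_RInt_gaussian; intros; apply Rlt_le, exp_pos.
Qed.

Lemma Gauss_real_tail x y : 1 <= x -> x <= y -> Gauss_real y <= Gauss_real x + exp (- (x * x)).
Proof.
intros H1 H2.
assert (RInt (fun u => exp (- (u * u))) x y <= RInt (fun u => exp (- x * u)) x y).
  apply RInt_le; auto using ex_RInt_gaussian.
    apply ex_RInt_derivable; intros; auto_derive; auto.
  intros u Hu; apply exp_le; nra.
rewrite (RInt_FTC (fun u => - (exp (- x * u) / x)) (fun u => exp (- x * u))) in H.
- rewrite <- Gauss_real_chasles in H.
  replace (- x * x) with (- (x * x)) in H by ring.
  assert (0 < exp (- x * y) / x) by (apply Rdiv_lt_0_compat; [apply exp_pos | lra]).
  assert (exp (- (x * x)) / x <= exp (- (x * x))).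
    apply (Rmult_le_reg_r x); [lra|]; unfold Rdiv; rewrite Rmult_assoc, Rinv_l by lra.
    generalize (exp_pos (- (x * x))); nra.
  lra.
- intros u _; auto_derive; [lra | field; lra].
- intros u _; apply continuous_derivable; auto_derive; auto.
Qed.

(** It enters [eta_main] and the integral of the main term alike and drops out of their quotient.
    The error terms keep it, bounded below by [kappa_gt]. *)
Definition kappa : R := real (Lim_seq (fun n => Gauss_real (INR n))).

Lemma kappa_correct : is_lim_seq (fun n => Gauss_real (INR n)) kappa.
Proof.
apply Lim_seq_correct', (ex_finite_lim_seq_incr _ (Gauss_real 1 + exp (- (1 * 1)))).
- intros n; apply Gauss_real_incr; rewrite S_INR; lra.
- intros [|n].
    generalize (exp_pos (- (1 * 1))) (Gauss_real_incr 0 1 ltac:(lra)); simpl; lra.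
  apply Gauss_real_tail; [lra|]; rewrite S_INR; generalize (pos_INR n); lra.
Qed.

Lemma kappa_ge x : Gauss_real x <= kappa.
Proof.
apply (is_lim_seq_le_loc (fun _ => Gauss_real x) (fun n => Gauss_real (INR n)) (Gauss_real x) kappa).
- destruct (archimed_cor1 1 ltac:(lra)) as [_ _].
  destruct (INR_unbounded x) as [N HN]; exists N; intros n Hn.
  apply Gauss_real_incr; apply le_INR in Hn; lra.
- apply is_lim_seq_const.
- apply kappa_correct.
Qed.

Lemma kappa_le x : 1 <= x -> kappa <= Gauss_real x + exp (- (x * x)).
Proof.
intros H1.
apply (is_lim_seq_le_loc (fun n => Gauss_real (INR n)) (fun _ => Gauss_real x + exp (- (x * x)))
  kappa (Gauss_real x + exp (- (x * x)))).
- destruct (INR_unbounded x) as [N HN]; exists N; intros n Hn.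
  apply Gauss_real_tail; auto; apply le_INR in Hn; lra.
- apply kappa_correct.
- apply is_lim_seq_const.
Qed.

Lemma kappa_gt : 1 / 3 <= kappa.
Proof.
apply Rle_trans with (2 := kappa_ge 1); unfold Gauss_real.
apply Rle_trans with (RInt (fun _ => 1 / 3) 0 1).
  rewrite RInt_const; unfold scal; simpl; unfold mult; simpl; lra.
apply RInt_le; auto using ex_RInt_gaussian, ex_RInt_const; try lra.
intros u Hu; apply Rle_trans with (exp (- (1))).
  rewrite exp_Ropp; generalize (exp_le_3) (exp_pos 1); intros.
  apply (Rmult_le_reg_r (exp 1)); [lra|]; rewrite Rinv_l; lra.
apply exp_le; nra.
Qed.

Lemma Gauss_vertical_bound (f : R -> R) x y :
  (forall v, ex_derive f v) -> (forall v, Rabs (f v) <= 1) ->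
  Rabs (RInt (fun v => exp (v * v - x * x) * f v) 0 y) <= Rabs y * exp (y * y - x * x).
Proof.
intros Hd Hf.
assert (Hb : forall v, Rabs v <= Rabs y ->
  Rabs (exp (v * v - x * x) * f v) <= exp (y * y - x * x)).
  intros v Hv; rewrite Rabs_mult, (Rabs_pos_eq (exp _)) by (apply Rlt_le, exp_pos).
  replace (exp (y * y - x * x)) with (exp (y * y - x * x) * 1) by ring.
  apply Rmult_le_compat; auto using Rabs_pos, Rlt_le, exp_pos.
  apply exp_le; generalize (Rsqr_le_abs_1 _ _ Hv); unfold Rsqr; lra.
assert (He : forall a b, ex_RInt (fun v => exp (v * v - x * x) * f v) a b).
  intros a b; apply ex_RInt_derivable; intros v; auto_derive; auto.
destruct (Rle_dec 0 y) as [Hy|Hy].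
- rewrite (Rabs_pos_eq y) by lra.
  replace y with (y - 0) at 2 by ring.
  apply abs_RInt_le_const; auto.
  intros v Hv; apply Hb; rewrite !Rabs_pos_eq; lra.
- rewrite <- (opp_RInt_swap (V := R_CompleteNormedModule)) by auto.
  unfold opp; simpl; rewrite Rabs_Ropp.
  rewrite (Rabs_left y) by lra.
  replace (- y) with (0 - y) by ring.
  apply abs_RInt_le_const; auto; [lra|].
  intros v Hv; apply Hb; rewrite !Rabs_left1; lra.
Qed.

Lemma Gauss_re_bound x y : Rabs (Gauss_re x y - Gauss_real x) <= Rabs y * exp (y * y - x * x).
Proof.
unfold Gauss_re; fold (Gauss_real x).
rewrite Rplus_minus_l; apply Gauss_vertical_bound.
  intros; auto_derive; auto.
intros v; apply Rabs_le, SIN_bound.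
Qed.

Lemma Gauss_im_bound x y : Rabs (Gauss_im x y) <= Rabs y * exp (y * y - x * x).
Proof.
apply Gauss_vertical_bound.
  intros; auto_derive; auto.
intros v; apply Rabs_le, COS_bound.
Qed.

(** On the vertical part of the path the integrand is largest in modulus at the endpoint w, where it
    equals exp(Im^2 - Re^2). The summand 1 pays for the part of the real axis beyond Re w. *)
Lemma Gauss_kappa_bound w : 1 <= Re w ->
  Cmod (Gauss w - kappa) <= (2 * Rabs (Im w) + 1) * exp (Im w * Im w - Re w * Re w).
Proof.
intros H; eapply Rle_trans; [apply Cmod_le_abs|].
replace (Re (Gauss w - kappa)) with (Gauss_re (Re w) (Im w) - kappa) by (simpl; ring).
replace (Im (Gauss w - kappa)) with (Gauss_im (Re w) (Im w)) by (simpl; ring).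
generalize (Gauss_re_bound (Re w) (Im w)) (Gauss_im_bound (Re w) (Im w))
  (kappa_ge (Re w)) (kappa_le (Re w) H); intros H1 H2 H3 H4.
assert (exp (- (Re w * Re w)) <= exp (Im w * Im w - Re w * Re w)) by (apply exp_le; nra).
assert (Rabs (Gauss_re (Re w) (Im w) - kappa) <= Rabs (Gauss_re (Re w) (Im w) - Gauss_real (Re w)) + exp (- (Re w * Re w))).
  replace (_ - _) with
    ((Gauss_re (Re w) (Im w) - Gauss_real (Re w)) + (Gauss_real (Re w) - kappa)) by ring.
  eapply Rle_trans; [apply Rabs_triang|]; apply Rplus_le_compat_l.
  rewrite Rabs_left1; lra.
lra.
Qed.

Lemma Gauss_real_abs x : Rabs (Gauss_real x) <= Rabs x.
Proof.
unfold Gauss_real.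
assert (Hb : forall v, Rabs (exp (- (v * v))) <= 1).
  intros v; rewrite Rabs_pos_eq by (apply Rlt_le, exp_pos).
  rewrite <- exp_0; apply exp_le; nra.
destruct (Rle_dec 0 x) as [Hy|Hy].
- rewrite (Rabs_pos_eq x) by lra.
  replace x with ((x - 0) * 1) at 2 by ring.
  apply abs_RInt_le_const; auto using ex_RInt_gaussian.
- rewrite <- (opp_RInt_swap (V := R_CompleteNormedModule)) by apply ex_RInt_gaussian.
  unfold opp; simpl; rewrite Rabs_Ropp.
  rewrite (Rabs_left x) by lra.
  replace (- x) with ((0 - x) * 1) by ring.
  apply abs_RInt_le_const; auto using ex_RInt_gaussian; lra.
Qed.

Lemma Gauss_bound w :
  Cmod (Gauss w) <= Cmod w * (1 + 2 * exp (Im w * Im w - Re w * Re w)).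
Proof.
eapply Rle_trans; [apply Cmod_le_abs|]; unfold Gauss; simpl Re; simpl Im.
generalize (Gauss_re_bound (Re w) (Im w)) (Gauss_im_bound (Re w) (Im w))
  (Gauss_real_abs (Re w)) (re_le_Cmod w) (im_le_Cmod w)
  (exp_pos (Im w * Im w - Re w * Re w)); intros H1 H2 H3 H4 H5 H6.
generalize (Rabs_triang (Gauss_re (Re w) (Im w) - Gauss_real (Re w)) (Gauss_real (Re w))).
replace (_ + _) with (Gauss_re (Re w) (Im w)) by ring.
intros H7; unfold fst, snd; fold (Re w) (Im w) in *.
generalize (Rmult_le_compat_r _ _ _ (Rlt_le _ _ H6) H5); unfold Re, Im in *; lra.
Qed.

(** * Symmetries of [Gauss] and its limit along rays *)

Lemma RInt_neg (f : R -> R) x : (forall u, ex_derive f u) ->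
  RInt f 0 (- x) = RInt (fun u => - f (- u)) 0 x.
Proof.
intros Hd; symmetry; apply is_RInt_unique.
apply (is_RInt_comp_opp (V := R_NormedModule)); rewrite Ropp_0.
apply (RInt_correct (V := R_CompleteNormedModule)), ex_RInt_derivable, Hd.
Qed.

Lemma RInt_odd (f : R -> R) x : (forall u, ex_derive f u) -> (forall u, f (- u) = - f u) ->
  RInt f 0 (- x) = RInt f 0 x.
Proof.
intros Hd Hf; rewrite RInt_neg by exact Hd.
apply RInt_eq; intros u; rewrite Hf; ring.
Qed.

Lemma RInt_even (f : R -> R) x : (forall u, ex_derive f u) -> (forall u, f (- u) = f u) ->
  RInt f 0 (- x) = - RInt f 0 x.
Proof.
intros Hd Hf; rewrite RInt_neg by exact Hd.
rewrite <- (RInt_opp (V := R_CompleteNormedModule)) by (apply ex_RInt_derivable, Hd).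
apply RInt_eq; intros u; rewrite Hf; reflexivity.
Qed.

Lemma Gauss_re_opp_r x y : Gauss_re x (- y) = Gauss_re x y.
Proof.
unfold Gauss_re; f_equal; apply RInt_odd; intros u; [auto_derive; auto|].
replace (2 * x * - u) with (- (2 * x * u)) by ring; rewrite sin_neg.
replace (- u * - u) with (u * u) by ring; ring.
Qed.

Lemma Gauss_im_opp_r x y : Gauss_im x (- y) = - Gauss_im x y.
Proof.
apply RInt_even; intros u; [auto_derive; auto|].
replace (2 * x * - u) with (- (2 * x * u)) by ring; rewrite cos_neg.
replace (- u * - u) with (u * u) by ring; ring.
Qed.

Lemma Gauss_re_opp_l x y : Gauss_re (- x) y = - Gauss_re x y.
Proof.
unfold Gauss_re; rewrite (RInt_even (fun u => exp (- (u * u)))); intros.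
- rewrite Ropp_plus_distr; f_equal.
  rewrite <- (RInt_opp (V := R_CompleteNormedModule)) by
      (apply ex_RInt_derivable; intros; auto_derive; auto).
  apply RInt_eq; intros v.
  replace (2 * - x * v) with (- (2 * x * v)) by ring; rewrite sin_neg.
  replace (- x * - x) with (x * x) by ring; exact (Ropp_mult_distr_r_reverse _ _).
- auto_derive; auto.
- f_equal; ring.
Qed.

Lemma Gauss_im_opp_l x y : Gauss_im (- x) y = Gauss_im x y.
Proof.
apply RInt_eq; intros v.
replace (2 * - x * v) with (- (2 * x * v)) by ring; rewrite cos_neg.
replace (- x * - x) with (x * x) by ring; ring.
Qed.

Lemma Gauss_conj w : Gauss (Cconj w) = Cconj (Gauss w).
Proof.
apply Ceq; [apply Gauss_re_opp_r | apply Gauss_im_opp_r].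
Qed.

Lemma Gauss_opp w : Gauss (- w) = (- Gauss w)%C.
Proof.
apply Ceq.
- transitivity (Gauss_re (- Re w) (- Im w)); [reflexivity|].
  rewrite Gauss_re_opp_r, Gauss_re_opp_l; reflexivity.
- transitivity (Gauss_im (- Re w) (- Im w)); [reflexivity|].
  rewrite Gauss_im_opp_r, Gauss_im_opp_l; reflexivity.
Qed.

Lemma Gauss_lim (c b : C) (eps : R) : Rabs (Im c) < Re c -> 0 < eps ->
  exists Y, forall y, Y <= y -> Cmod (Gauss (c * y + b) - kappa) <= eps.
Proof.
intros Hc He.
set (d := Re c - Rabs (Im c)); set (B := Rabs (Re b) + Rabs (Im b)).
assert (Hd : 0 < d) by (unfold d; lra).
exists (Rmax 0 ((B + Rmax 2 (/ eps)) / d)); intros y Hy.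
assert (Hy0 := Rle_trans _ _ _ (Rmax_l _ _) Hy).
assert (Hy1 := Rle_trans _ _ _ (Rmax_r _ _) Hy).
assert (Hy2 : B + Rmax 2 (/ eps) <= y * d).
  apply (Rmult_le_compat_r d) in Hy1; [|lra].
  unfold Rdiv in Hy1; rewrite Rmult_assoc, Rinv_l in Hy1; lra.
set (D := y * d - B).
assert (HD2 : 2 <= D) by (generalize (Rmax_l 2 (/ eps)); unfold D; lra).
assert (HDe : / eps <= D) by (generalize (Rmax_r 2 (/ eps)); unfold D; lra).
set (w := (c * y + b)%C).
assert (Hre : Re w = Re c * y + Re b) by (unfold w; rewrite re_plus, re_scal_r; reflexivity).
assert (Him : Im w = Im c * y + Im b) by (unfold w; rewrite im_plus, im_scal_r; reflexivity).
assert (HD : D + Rabs (Im w) <= Re w).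
  rewrite Hre, Him; generalize (Rabs_triang (Im c * y) (Im b)).
  rewrite Rabs_mult, (Rabs_pos_eq y) by lra.
  generalize (Rle_abs (- Re b)); rewrite Rabs_Ropp; unfold D, B, d; lra.
assert (H0 := Rabs_pos (Im w)).
eapply Rle_trans; [apply Gauss_kappa_bound; lra|].
assert (Hq : Im w * Im w = Rabs (Im w) * Rabs (Im w)).
  rewrite <- Rabs_mult, Rabs_pos_eq; nra.
(* The prefactor 2 |Im w| + 1 is at most exp(2 |Im w|). Since Re w >= D + |Im w| with D >= 2, the
   exponent is at most -2 |Im w| - D, so exp(-D) remains. *)
apply Rle_trans with (exp (2 * Rabs (Im w)) * exp (- (2 * Rabs (Im w)) - D)).
  apply Rmult_le_compat; [lra | apply Rlt_le, exp_pos | | ].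
    generalize (exp_ineq1_le (2 * Rabs (Im w))); lra.
  apply exp_le; rewrite Hq; nra.
rewrite <- exp_plus; replace (_ + _) with (- D) by ring.
rewrite exp_Ropp, <- (Rinv_inv eps).
apply Rinv_le_contravar; [apply Rinv_0_lt_compat; lra|].
generalize (exp_ineq1_le D); lra.
Qed.

(** * The kernel cos^(2N+1) *)

Fixpoint Rsum (f : nat -> R) (n : nat) : R :=
  match n with O => 0 | S n => Rsum f n + f n end.

Lemma Rsum_le f g n : (forall k, (k < n)%nat -> f k <= g k) -> Rsum f n <= Rsum g n.
Proof. induction n as [|n IH]; simpl; intros H; [lra|]; apply Rplus_le_compat; auto. Qed.

Lemma Rsum_eq f g n : (forall k, (k < n)%nat -> f k = g k) -> Rsum f n = Rsum g n.
Proof. induction n as [|n IH]; simpl; intros H; [auto|]; rewrite IH, H; auto. Qed.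

Lemma Rsum_scal a f n : Rsum (fun k => a * f k) n = a * Rsum f n.
Proof. induction n as [|n IH]; simpl; [ring | rewrite IH; ring]. Qed.

(** The coefficient of cos((2k+1) y) in cos^(2N+1) y, that is binomial(2N+1, N-k) / 4^N. The
    recursion is multiplication by cos^2; the 3/4 at k = 0 arises because the frequency -1 folds
    back onto 1. *)
Fixpoint cos_coef (N k : nat) : R :=
  match N, k with
  | O, O => 1
  | O, S _ => 0
  | S N, O => 3 / 4 * cos_coef N 0 + 1 / 4 * cos_coef N 1
  | S N, S k => 1 / 4 * cos_coef N k + 1 / 2 * cos_coef N (S k) + 1 / 4 * cos_coef N (S (S k))
  end.

Lemma cos_coef_gt N : forall k, (N < k)%nat -> cos_coef N k = 0.
Proof.
induction N as [|N IH]; intros [|k] Hk; simpl; try lia; [auto|].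
rewrite !IH by lia; ring.
Qed.

Lemma cos_coef_decr N : forall k, 0 <= cos_coef N (S k) <= cos_coef N k.
Proof.
induction N as [|N IH].
- intros [|k]; simpl; lra.
- intros [|k]; simpl.
  + generalize (IH 0%nat) (IH 1%nat) (IH 2%nat); lra.
  + generalize (IH k) (IH (S k)) (IH (S (S k))) (IH (S (S (S k)))); lra.
Qed.

Lemma cos_coef_pos N k : 0 <= cos_coef N k.
Proof. generalize (cos_coef_decr N k); lra. Qed.

Lemma cos_coef_le0 N k : cos_coef N k <= cos_coef N 0.
Proof. induction k as [|k IH]; [lra|]; generalize (cos_coef_decr N k); lra. Qed.

Definition odd_freq (k : nat) : R := 2 * INR k + 1.

Lemma odd_freq_S k : odd_freq (S k) = odd_freq k + 2.
Proof. unfold odd_freq; rewrite S_INR; ring. Qed.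

Lemma cos_sqr_mult_cos (w y : R) :
  cos y * cos y * cos (w * y) =
  1 / 2 * cos (w * y) + 1 / 4 * cos ((w + 2) * y) + 1 / 4 * cos ((w - 2) * y).
Proof.
replace ((w + 2) * y) with (w * y + 2 * y) by ring.
replace ((w - 2) * y) with (w * y - 2 * y) by ring.
rewrite cos_plus, cos_minus, cos_2a_cos; field.
Qed.

(** The two extra terms are what crosses the cut at K. At K = N the first one is the new top
    coefficient and the second one vanishes. *)
Lemma cos_coef_step N K y :
  cos y * cos y * Rsum (fun k => cos_coef N k * cos (odd_freq k * y)) (S K) =
  Rsum (fun k => cos_coef (S N) k * cos (odd_freq k * y)) (S K)
  + 1 / 4 * cos_coef N K * cos (odd_freq (S K) * y)
  - 1 / 4 * cos_coef N (S K) * cos (odd_freq K * y).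
Proof.
induction K as [|K IH].
- simpl Rsum; simpl cos_coef; rewrite !Rplus_0_l, odd_freq_S.
  transitivity (cos_coef N 0 * (cos y * cos y * cos (odd_freq 0 * y))); [ring|].
  rewrite cos_sqr_mult_cos.
  replace ((odd_freq 0 - 2) * y) with (- (odd_freq 0 * y)) by (unfold odd_freq; simpl; ring).
  rewrite cos_neg; field.
- change (Rsum ?f (S (S K))) with (Rsum f (S K) + f (S K)) at 1 2.
  rewrite Rmult_plus_distr_l, IH.
  transitivity (Rsum (fun k => cos_coef (S N) k * cos (odd_freq k * y)) (S K) +
   1 / 4 * cos_coef N K * cos (odd_freq (S K) * y) - 1 / 4 * cos_coef N (S K) * cos (odd_freq K * y) +
   cos_coef N (S K) * (cos y * cos y * cos (odd_freq (S K) * y))); [ring|].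
  rewrite cos_sqr_mult_cos.
  rewrite (odd_freq_S (S K)); replace (odd_freq (S K) - 2) with (odd_freq K) by (rewrite odd_freq_S; ring).
  simpl cos_coef; field.
Qed.

Lemma cos_odd_pow N y :
  cos y ^ (2 * N + 1) = Rsum (fun k => cos_coef N k * cos (odd_freq k * y)) (S N).
Proof.
induction N as [|N IH].
- simpl; unfold odd_freq; simpl; replace ((2 * 0 + 1) * y) with y by ring; ring.
- replace (2 * S N + 1)%nat with (S (S (2 * N + 1))) by lia.
  change (cos y ^ S (S (2 * N + 1))) with (cos y * (cos y * cos y ^ (2 * N + 1))).
  rewrite <- Rmult_assoc, IH.
  change (Rsum ?f (S (S N))) with (Rsum f (S N) + f (S N)).
  rewrite cos_coef_step, (cos_coef_gt N (S N)) by lia.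
  simpl cos_coef; rewrite (cos_coef_gt N (S N)), (cos_coef_gt N (S (S N))) by lia.
  field.
Qed.

Lemma sin_nat_PI (k : nat) : sin (INR k * PI) = 0.
Proof. apply sin_eq_0_1; exists (Z.of_nat k); rewrite <- INR_IZR_INZ; reflexivity. Qed.

Lemma RInt_cos_zero (k : nat) : (0 < k)%nat ->
  RInt (fun x => cos (2 * INR k * (PI * x))) (- (1 / 2)) (1 / 2) = 0.
Proof.
intros Hk; assert (0 < INR k) by (apply lt_0_INR; lia).
eqR; rewrite (RInt_FTC (fun x => sin (2 * INR k * (PI * x)) / (2 * INR k * PI))).
- replace (_ * _) with (INR k * PI) by field.
  replace (2 * INR k * (PI * - (1 / 2))) with (- (INR k * PI)) by field.
  rewrite sin_neg, sin_nat_PI; unfold Rdiv; ring.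
- intros x _; auto_derive; [auto|]; field; split; [apply PI_neq0 | lra].
- intros x _; apply continuous_derivable; auto_derive; auto.
Qed.

Lemma RInt_cos_odd (k : nat) :
  RInt (fun x => cos (odd_freq k * (PI * x)) * cos (PI * x)) (- (1 / 2)) (1 / 2) =
  match k with O => 1 / 2 | _ => 0 end.
Proof.
eqR; rewrite (RInt_eq _ (fun x => 1 / 2 * cos (2 * INR (S k) * (PI * x)) + 1 / 2 * cos (2 * INR k * (PI * x)))).
2: { intros x.
  replace (2 * INR (S k) * (PI * x)) with (odd_freq k * (PI * x) + PI * x)
    by (unfold odd_freq; rewrite S_INR; ring).
  replace (2 * INR k * (PI * x)) with (odd_freq k * (PI * x) - PI * x) by (unfold odd_freq; ring).
  rewrite cos_plus, cos_minus; field. }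
assert (He : forall j, ex_RInt (fun x => cos (2 * INR j * (PI * x))) (- (1 / 2)) (1 / 2)).
  intros j; apply ex_RInt_derivable; intros; auto_derive; auto.
rewrite RInt_plus_R, 2 RInt_scal_R, RInt_cos_zero; auto with arith;
  try (apply ex_RInt_derivable; intros; auto_derive; auto).
destruct k as [|k].
- rewrite (RInt_eq _ (fun _ => 1)), RInt_const_R; [field|].
  intros x; simpl; replace (2 * 0 * (PI * x)) with 0 by ring; apply cos_0.
- rewrite RInt_cos_zero by lia; field.
Qed.

Lemma RInt_Rsum (f : nat -> R -> R) n a b :
  (forall k x, ex_derive (f k) x) ->
  RInt (fun x => Rsum (fun k => f k x) n) a b = Rsum (fun k => RInt (f k) a b) n.
Proof.
intros Hd; eqR; induction n as [|n IH]; simpl.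
- rewrite RInt_const_R; ring.
- rewrite <- IH; apply RInt_plus_R; apply ex_RInt_derivable; auto.
  intros x; clear IH; induction n as [|n IH]; simpl.
    apply ex_derive_const.
  apply (ex_derive_plus (V := R_NormedModule) _ _ _ IH); apply Hd.
Qed.

Lemma cos_coef_RInt N :
  RInt (fun x => cos (PI * x) ^ (2 * N + 2)) (- (1 / 2)) (1 / 2) = cos_coef N 0 / 2.
Proof.
eqR; rewrite (RInt_eq _ (fun x => Rsum (fun k => cos_coef N k * (cos (odd_freq k * (PI * x)) * cos (PI * x))) (S N))).
- rewrite (RInt_Rsum (fun k x => cos_coef N k * (cos (odd_freq k * (PI * x)) * cos (PI * x)))).
  2: intros; auto_derive; auto.
  transitivity (Rsum (fun k => match k with O => cos_coef N 0 / 2 | _ => 0 end) (S N)).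
  + apply Rsum_eq; intros k _.
    rewrite RInt_scal_R by (apply ex_RInt_derivable; intros; auto_derive; auto).
    rewrite RInt_cos_odd; destruct k; field.
  + clear; induction N as [|n IH]; [simpl; ring|].
    assert (H : forall m, Rsum (fun k => match k with O => cos_coef (S n) 0 / 2 | _ => 0 end) (S m) = cos_coef (S n) 0 / 2).
      induction m as [|m IHm]; [simpl; ring|].
      change (Rsum ?f (S (S m))) with (Rsum f (S m) + 0); rewrite IHm; ring.
    apply H.
- intros x; replace (2 * N + 2)%nat with (S (2 * N + 1)) by lia.
  change (cos (PI * x) ^ S (2 * N + 1)) with (cos (PI * x) * cos (PI * x) ^ (2 * N + 1)).
  rewrite cos_odd_pow, <- Rsum_scal; apply Rsum_eq; intros; ring.
Qed.

Lemma cos_half_PI : cos (PI * (1 / 2)) = 0 /\ cos (PI * - (1 / 2)) = 0.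
Proof.
replace (PI * - (1 / 2)) with (- (PI * (1 / 2))) by ring; rewrite cos_neg.
replace (PI * (1 / 2)) with (PI / 2) by field; split; apply cos_PI2.
Qed.

(* Wallis' recurrence, from integrating the derivative of sin * cos^(2N+3). *)
Lemma cos_coef_0_S N : (2 * INR N + 4) * cos_coef (S N) 0 = (2 * INR N + 3) * cos_coef N 0.
Proof.
assert (H : RInt (fun x => PI * ((2 * INR N + 4) * cos (PI * x) ^ (2 * S N + 2)
   - (2 * INR N + 3) * cos (PI * x) ^ (2 * N + 2))) (- (1 / 2)) (1 / 2) = 0).
- eqR; rewrite (RInt_FTC (fun x => sin (PI * x) * cos (PI * x) ^ (2 * N + 3))).
  + destruct cos_half_PI as [-> ->]; rewrite pow_i by lia; ring.
  + intros x _; auto_derive; [auto|].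
    replace (N + (N + 0) + 3)%nat with (S (2 * N + 2)) by lia.
    replace (2 * S N + 2)%nat with (S (S (2 * N + 2))) by lia.
    generalize (sin2_cos2 (PI * x)); unfold Rsqr; intros Hs.
    rewrite S_INR, plus_INR, mult_INR; simpl Init.Nat.pred; simpl pow; simpl INR.
    generalize (cos (PI * x) ^ (N + (N + 0) + 2)); intros p.
    generalize dependent (cos (PI * x)); generalize (sin (PI * x)); intros u v Hs.
    transitivity (PI * (v * v * p) - PI * ((2 * INR N + 3) * p * (u * u))); [ring|].
    replace (u * u) with (1 - v * v) by lra; ring.
  + intros x _; apply continuous_derivable; auto_derive; auto.
- rewrite RInt_scal_R, RInt_minus_R, !RInt_scal_R, !cos_coef_RInt in H;
    try (apply ex_RInt_derivable; intros; auto_derive; auto).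
  apply Rmult_integral in H; destruct H as [H|H]; [now apply PI_neq0 in H | lra].
Qed.

(** The induction closes because (2N+3)^2 >= 4 (N+1)(N+2). The order 1/sqrt(N+1) matters: the kernel
    has this mass up to a constant, while [cos_kernel_approx] has an error of order 1/(N+1), so the
    quotient tends to 0. *)
Lemma cos_coef_0_lower N : 1 <= cos_coef N 0 * sqrt (INR N + 1).
Proof.
induction N as [|N IH].
- simpl; rewrite Rplus_0_l, sqrt_1; lra.
- generalize (pos_INR N) (cos_coef_0_S N) (cos_coef_pos N 0) (cos_coef_pos (S N) 0); intros H0 H1 H2 H3.
  rewrite S_INR.
  apply Rle_trans with (1 := IH).
  assert (E : cos_coef (S N) 0 = (2 * INR N + 3) / (2 * INR N + 4) * cos_coef N 0).
    apply (Rmult_eq_reg_l (2 * INR N + 4)); [rewrite H1; field; lra | lra].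
  rewrite E, (Rmult_comm _ (cos_coef N 0)), Rmult_assoc.
  apply Rmult_le_compat_l; auto.
  assert (Hp : 0 <= (2 * INR N + 3) / (2 * INR N + 4)) by (apply Rlt_le, Rdiv_lt_0_compat; lra).
  rewrite <- (sqrt_square _ Hp), <- sqrt_mult_alt by nra.
  apply sqrt_le_1_alt.
  apply (Rmult_le_reg_r ((2 * INR N + 4) * (2 * INR N + 4))); [nra|].
  replace (_ * (INR N + 1 + 1) * _) with ((2 * INR N + 3) * (2 * INR N + 3) * (INR N + 1 + 1)) by (field; lra).
  nra.
Qed.

Lemma RInt_cos_pow_sin N :
  RInt (fun x => cos (PI * x) ^ (2 * N + 1) * sin (PI * x)) 0 (1 / 2) = / (2 * PI * (INR N + 1)).
Proof.
assert (0 <= INR N) by apply pos_INR.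
assert (HPI := PI_neq0).
eqR; rewrite (RInt_FTC (fun x => - cos (PI * x) ^ (2 * N + 2) / (2 * PI * (INR N + 1)))).
- destruct cos_half_PI as [-> _]; rewrite pow_i, Rmult_0_r, cos_0, pow1 by lia.
  field; lra.
- intros x _; auto_derive; [auto|].
  replace (N + (N + 0) + 2)%nat with (S (2 * N + 1)) by lia.
  rewrite S_INR, plus_INR, mult_INR; simpl Init.Nat.pred; simpl INR.
  replace (N + (N + 0) + 1)%nat with (2 * N + 1)%nat by lia; field; lra.
- intros x _; apply continuous_derivable; auto_derive; auto.
Qed.

(** Comparing h(x) with h(0) cos(pi x) rather than with h(0) makes the main integral equal to
    [cos_coef_RInt], and a deviation bounded by |sin(pi x)| makes the error integral elementary, so
    no localisation near 0 is required. *)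
Lemma cos_kernel_approx (h : R -> R) (B : R) (N : nat) :
  (forall x, ex_derive h x) ->
  (forall x, Rabs x <= 1 / 2 -> Rabs (h x - h 0 * cos (PI * x)) <= B * Rabs (sin (PI * x))) ->
  Rabs (RInt (fun x => cos (PI * x) ^ (2 * N + 1) * h x) (- (1 / 2)) (1 / 2)
        - h 0 * (cos_coef N 0 / 2)) <= B / (PI * (INR N + 1)).
Proof.
intros Hd HB.
assert (0 <= INR N) by apply pos_INR.
assert (HPI := PI_RGT_0).
set (g := fun x => cos (PI * x) ^ (2 * N + 1) * (h x - h 0 * cos (PI * x))).
assert (Hg : forall x, ex_derive g x) by (intros; unfold g; auto_derive; auto).
assert (Hge : forall a b, ex_RInt g a b) by (intros; apply ex_RInt_derivable, Hg).
assert (Hs : forall x, 0 <= x <= 1 / 2 -> 0 <= sin (PI * x) /\ 0 <= cos (PI * x)).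
  intros x Hx; split; [apply sin_ge_0 | apply cos_ge_0]; nra.
assert (Hpos : Rabs (RInt g 0 (1 / 2)) <= B * / (2 * PI * (INR N + 1))).
  rewrite <- RInt_cos_pow_sin, <- RInt_scal_R by
    (apply ex_RInt_derivable; intros; auto_derive; auto).
  eapply Rle_trans; [apply abs_RInt_le; [lra | apply Hge]|].
  apply RInt_le; [lra| | |].
  - exact (ex_RInt_norm _ _ _ (Hge _ _)).
  - apply ex_RInt_derivable; intros; auto_derive; auto.
  - intros x Hx; destruct (Hs x ltac:(lra)) as [H1 H2].
    unfold g; rewrite Rabs_mult, (Rabs_pos_eq (_ ^ _)) by (apply pow_le, H2).
    generalize (HB x ltac:(rewrite Rabs_pos_eq; lra)).
    rewrite (Rabs_pos_eq (sin _)) by auto; intros H3.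
    apply (Rmult_le_compat_l _ _ _ (pow_le _ (2 * N + 1) H2)) in H3; lra.
assert (Hneg : Rabs (RInt g (- (1 / 2)) 0) <= B * / (2 * PI * (INR N + 1))).
  rewrite <- (opp_RInt_swap (V := R_CompleteNormedModule)) by apply Hge.
  unfold opp; simpl; rewrite Rabs_Ropp, RInt_neg by exact Hg.
  rewrite <- RInt_cos_pow_sin, <- RInt_scal_R by
    (apply ex_RInt_derivable; intros; auto_derive; auto).
  assert (He : ex_RInt (fun u => - g (- u)) 0 (1 / 2)).
    apply ex_RInt_derivable; intros; auto_derive; auto.
  eapply Rle_trans; [apply abs_RInt_le; [lra | exact He]|].
  apply RInt_le; [lra| | |].
  - exact (ex_RInt_norm _ _ _ He).
  - apply ex_RInt_derivable; intros; auto_derive; auto.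
  - intros x Hx; destruct (Hs x ltac:(lra)) as [H1 H2].
    generalize (HB (- x) ltac:(rewrite Rabs_Ropp, Rabs_pos_eq; lra)).
    unfold g; replace (PI * - x) with (- (PI * x)) by ring; rewrite cos_neg, sin_neg.
    rewrite !Rabs_Ropp, Rabs_mult, (Rabs_pos_eq (_ ^ _)) by (apply pow_le, H2).
    rewrite (Rabs_pos_eq (sin _)) by auto; intros H3.
    apply (Rmult_le_compat_l _ _ _ (pow_le _ (2 * N + 1) H2)) in H3; lra.
replace (_ - _) with (RInt g (- (1 / 2)) 0 + RInt g 0 (1 / 2)).
- eapply Rle_trans; [apply Rabs_triang|].
  replace (B / (PI * (INR N + 1))) with
    (B * / (2 * PI * (INR N + 1)) + B * / (2 * PI * (INR N + 1))) by (field; lra).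
  lra.
- rewrite RInt_Chasles_R by apply Hge.
  rewrite <- cos_coef_RInt, <- RInt_scal_R, <- RInt_minus_R;
    try (apply ex_RInt_derivable; intros; auto_derive; auto).
  apply RInt_eq; intros x; unfold g.
  replace (2 * N + 2)%nat with (S (2 * N + 1)) by lia; simpl pow; ring.
Qed.

(** * Theta inversion by Poisson summation *)

Fixpoint Csum (f : nat -> C) (n : nat) : C :=
  match n with O => 0%C | S n => (Csum f n + f n)%C end.

Lemma Re_Csum f n : Re (Csum f n) = Rsum (fun k => Re (f k)) n.
Proof. induction n as [|n IH]; simpl Csum; [reflexivity|]; rewrite re_plus, IH; reflexivity. Qed.

Lemma Im_Csum f n : Im (Csum f n) = Rsum (fun k => Im (f k)) n.
Proof. induction n as [|n IH]; simpl Csum; [reflexivity|]; rewrite im_plus, IH; reflexivity. Qed.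

Lemma Csum_eq f g n : (forall k, (k < n)%nat -> f k = g k) -> Csum f n = Csum g n.
Proof. induction n as [|n IH]; simpl; intros H; [auto|]; rewrite IH, H; auto. Qed.

Lemma Csum_minus f g n : (Csum f n - Csum g n)%C = Csum (fun k => f k - g k)%C n.
Proof. induction n as [|n IH]; simpl; [ring | rewrite <- IH; ring]. Qed.

Lemma Cmod_Csum f n : Cmod (Csum f n) <= Rsum (fun k => Cmod (f k)) n.
Proof.
induction n as [|n IH]; simpl; [rewrite Cmod_0; lra|].
eapply Rle_trans; [apply Cmod_triangle | lra].
Qed.

Definition gaussian (c : C) (y : R) : C := Cexp (- ((c * y) * (c * y))).

(** Symmetric truncation of the sum of (-1)^m exp(-c^2 (y + m)^2), a theta function of Jacobi. The
    full sum changes sign under y -> y + 1, hence only the odd frequencies (2k+1) pi occur. *)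
Fixpoint theta (c : C) (M : nat) (y : R) : C :=
  match M with
  | O => gaussian c y
  | S M' => (theta c M' y + RtoC ((-1) ^ M) * (gaussian c (y + INR M) + gaussian c (y - INR M)))%C
  end.

Lemma Cmod_gaussian c y :
  Cmod (gaussian c y) = exp (- ((Re c * Re c - Im c * Im c) * (y * y))).
Proof.
unfold gaussian; rewrite Cmod_Cexp; f_equal.
rewrite re_opp, re_mult, re_scal_r, im_scal_r; ring.
Qed.

Lemma is_Cderive_linear (c b : C) y : is_Cderive (fun y => c * RtoC y + b)%C y c.
Proof.
eapply is_Cderive_eq.
- apply is_Cderive_plus; [apply is_Cderive_scal, is_Cderive_RtoC, is_derive_id | apply is_Cderive_const].
- transitivity (c * 1 + 0)%C; [reflexivity | ring].
Qed.

Lemma is_Cderive_gaussian c y :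
  is_Cderive (gaussian c) y (- (2 * (c * c) * y * gaussian c y))%C.
Proof.
assert (H : is_Cderive (fun y => c * RtoC y)%C y c).
  eapply is_Cderive_ext; [|apply (is_Cderive_linear c 0)]; intros; cbv beta; ring.
eapply is_Cderive_eq.
- apply is_Cderive_exp, is_Cderive_opp, is_Cderive_mult; exact H.
- cbv beta; fold (gaussian c y); ring.
Qed.

Section Poisson.
Variables (c : C) (x0 : R).
Hypothesis Hc : Rabs (Im c) < Re c.
Hypothesis Hx0 : Rabs x0 <= 1 / 2.

Lemma c_neq0 : c <> 0.
Proof.
intros E; rewrite E in Hc; simpl in Hc; rewrite Rabs_R0 in Hc; lra.
Qed.

Lemma gaussian_decay : exists K, 0 <= K /\ forall y,
  Cmod (gaussian c y) <= K * exp (- Rabs y) /\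
  Cmod (2 * (c * c) * y * gaussian c y) <= K * exp (- Rabs y).
Proof.
set (s := Re c * Re c - Im c * Im c).
assert (Hs : 0 < s).
  unfold s; generalize (Rabs_pos (Im c)); intros.
  replace (Im c * Im c) with (Rabs (Im c) * Rabs (Im c)) by (rewrite <- Rabs_mult, Rabs_pos_eq; nra).
  nra.
exists (exp (/ s) * (1 + 2 * (Cmod c * Cmod c))); split.
  apply Rmult_le_pos; [apply Rlt_le, exp_pos | nra].
intros y.
assert (Hq : y * y = Rabs y * Rabs y) by (rewrite <- Rabs_mult, Rabs_pos_eq; nra).
assert (H0 := Rabs_pos y).
(* With s = Re (c^2), the bound -s y^2 <= 1/s - 2 |y| is (s |y| - 1)^2 >= 0. One of the two factors
   exp(-|y|) is spent on the |y| in the derivative. *)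
assert (Hg : Cmod (gaussian c y) <= exp (/ s) * exp (- (2 * Rabs y))).
  rewrite Cmod_gaussian, <- exp_plus; fold s; rewrite Hq; apply exp_le.
  apply (Rmult_le_reg_l s); [lra|].
  rewrite Rmult_plus_distr_l, Rinv_r by lra.
  generalize (Rle_0_sqr (s * Rabs y - 1)); unfold Rsqr; lra.
assert (He := exp_pos (/ s)).
assert (H1 : exp (- (2 * Rabs y)) <= exp (- Rabs y)) by (apply exp_le; lra).
assert (H2 : Rabs y * exp (- (2 * Rabs y)) <= exp (- Rabs y)).
  replace (- (2 * Rabs y)) with (- Rabs y + - Rabs y) by ring.
  rewrite exp_plus, <- Rmult_assoc.
  rewrite <- (Rmult_1_l (exp (- Rabs y))) at 3.
  apply Rmult_le_compat_r; [apply Rlt_le, exp_pos|].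
  apply (Rmult_le_reg_r (exp (Rabs y))); [apply exp_pos|].
  rewrite Rmult_assoc, <- exp_plus, Rplus_opp_l, exp_0.
  generalize (exp_ineq1_le (Rabs y)); lra.
assert (Hn := exp_pos (- Rabs y)).
split.
- eapply Rle_trans; [exact Hg|].
  rewrite (Rmult_assoc (exp (/ s)) (1 + _)); apply Rmult_le_compat_l; nra.
- rewrite !Cmod_mult, !Cmod_R, (Rabs_pos_eq 2) by lra.
  apply Rle_trans with (2 * (Cmod c * Cmod c) * Rabs y * (exp (/ s) * exp (- (2 * Rabs y)))).
    apply Rmult_le_compat_l; [nra | exact Hg].
  replace (_ * _)
    with (exp (/ s) * (2 * (Cmod c * Cmod c) * (Rabs y * exp (- (2 * Rabs y))))) by ring.
  rewrite (Rmult_assoc (exp (/ s)) (1 + _)); apply Rmult_le_compat_l; [lra|]; nra.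
Qed.

Lemma exp_opp_INR m : exp (- INR m) <= (1 / 2) ^ m.
Proof.
induction m as [|m IH]; [simpl; rewrite Ropp_0, exp_0; lra|].
rewrite S_INR, Ropp_plus_distr, exp_plus; simpl pow; rewrite Rmult_comm.
apply Rmult_le_compat; try (apply Rlt_le, exp_pos); auto.
rewrite exp_Ropp; generalize (exp_ineq1_le 1); intros.
unfold Rdiv; rewrite Rmult_1_l; apply Rinv_le_contravar; lra.
Qed.

(** Stated by components because it comes from the mean value theorem, and used by components
    because [cos_kernel_approx] is about real functions. *)
Definition near_lipschitz (f : R -> C) (K : R) (y : R) : Prop :=
  Cmod (f y) <= K /\ forall x, Rabs x <= 1 / 2 ->
  Rabs (Re (f (y + x)) - Re (f y)) <= K * Rabs x /\
  Rabs (Im (f (y + x)) - Im (f y)) <= K * Rabs x.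

Lemma gaussian_lipschitz : exists K, 0 <= K /\ forall m y, INR m - 1 / 2 <= Rabs y ->
  near_lipschitz (gaussian c) (K * (1 / 2) ^ m) y.
Proof.
destruct gaussian_decay as [K [HK Hb]].
exists (K * exp 1); split; [apply Rmult_le_pos; [lra | apply Rlt_le, exp_pos]|].
intros m y Hy.
assert (He : forall z, INR m - 1 <= Rabs z -> K * exp (- Rabs z) <= K * exp 1 * (1 / 2) ^ m).
  intros z Hz; rewrite Rmult_assoc; apply Rmult_le_compat_l; [lra|].
  apply Rle_trans with (exp 1 * exp (- INR m)).
    rewrite <- exp_plus; apply exp_le; lra.
  apply Rmult_le_compat_l; [apply Rlt_le, exp_pos | apply exp_opp_INR].
split; [eapply Rle_trans; [apply Hb | apply He; lra]|].
intros x Hx.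
assert (Hd : forall z, Rabs (z - y) <= Rabs x ->
  Cmod (- (2 * (c * c) * z * gaussian c z)) <= K * exp 1 * (1 / 2) ^ m).
  intros z Hz; rewrite Cmod_opp; eapply Rle_trans; [apply Hb | apply He].
  generalize (Rabs_triang_inv y (y - z)); rewrite (Rabs_minus_sym y z).
  replace (y - (y - z)) with z by ring; lra.
split.
- destruct (MVT_cor4 (fun z => Re (gaussian c z)) (fun z => Re (- (2 * (c * c) * z * gaussian c z)))
    y (Rabs x)) with (b := y + x) as [z [E Hz]].
  + intros z _; apply is_Cderive_gaussian.
  + replace (y + x - y) with x by ring; lra.
  + replace (y + x - y) with x in E, Hz by ring.
    rewrite E, Rabs_mult; apply Rmult_le_compat_r; [apply Rabs_pos|].
    eapply Rle_trans; [apply re_le_Cmod | apply Hd, Hz].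
- destruct (MVT_cor4 (fun z => Im (gaussian c z)) (fun z => Im (- (2 * (c * c) * z * gaussian c z)))
    y (Rabs x)) with (b := y + x) as [z [E Hz]].
  + intros z _; apply is_Cderive_gaussian.
  + replace (y + x - y) with x by ring; lra.
  + replace (y + x - y) with x in E, Hz by ring.
    rewrite E, Rabs_mult; apply Rmult_le_compat_r; [apply Rabs_pos|].
    eapply Rle_trans; [apply im_le_Cmod | apply Hd, Hz].
Qed.

Lemma theta_lipschitz : exists B, forall M, near_lipschitz (theta c M) B x0.
Proof.
destruct gaussian_lipschitz as [K [HK HL]].
(* The term m = 0 contributes K and each pair of shifts by m and -m contributes 2 K / 2^m, which
   adds up to K (3 - 2 / 2^M). *)
cut (forall M, near_lipschitz (theta c M) (K * (3 - 2 * (1 / 2) ^ M)) x0).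
  intros H; exists (3 * K); intros M; destruct (H M) as [H1 H2].
  assert (Hle : K * (3 - 2 * (1 / 2) ^ M) <= 3 * K).
    assert (0 < (1 / 2) ^ M) by (apply pow_lt; lra); nra.
  split; [lra|]; intros x Hx; destruct (H2 x Hx) as [H3 H4].
  assert (Hx' := Rabs_pos x); split; eapply Rle_trans; try eassumption;
    apply Rmult_le_compat_r; auto.
induction M as [|M [IH1 IH2]].
- replace (_ * _) with (K * (1 / 2) ^ 0) by (simpl; ring).
  apply HL; simpl; generalize (Rabs_pos x0); lra.
- assert (Hm := pos_INR M).
  assert (Hp : INR (S M) - 1 / 2 <= Rabs (x0 + INR (S M))).
    generalize (Rle_abs (x0 + INR (S M))) (Rle_abs (- x0)); rewrite Rabs_Ropp; lra.
  assert (Hn : INR (S M) - 1 / 2 <= Rabs (x0 - INR (S M))).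
    rewrite Rabs_minus_sym.
    generalize (Rle_abs (INR (S M) - x0)) (Rle_abs x0); lra.
  destruct (HL _ _ Hp) as [P1 P2], (HL _ _ Hn) as [N1 N2].
  assert (E : K * (3 - 2 * (1 / 2) ^ S M) =
    K * (3 - 2 * (1 / 2) ^ M) + (K * (1 / 2) ^ S M + K * (1 / 2) ^ S M)) by (simpl; field).
  rewrite E; split.
  + eapply Rle_trans; [apply Cmod_triangle|]; apply Rplus_le_compat; [exact IH1|].
    rewrite Cmod_mult, Cmod_R, pow_1_abs, Rmult_1_l.
    eapply Rle_trans; [apply Cmod_triangle|]; lra.
  + intros x Hx; destruct (IH2 x Hx) as [I1 I2], (P2 x Hx) as [Q1 Q2], (N2 x Hx) as [S1 S2].
    replace (x0 + INR (S M) + x) with (x0 + x + INR (S M)) in Q1, Q2 by ring.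
    replace (x0 - INR (S M) + x) with (x0 + x - INR (S M)) in S1, S2 by ring.
    cbn [theta]; rewrite !re_plus, !im_plus, !re_scal_l, !im_scal_l, !re_plus, !im_plus.
    assert (G : forall a b p q r s u v w : R, Rabs u = 1 ->
      Rabs (a - b) <= v * Rabs x -> Rabs (p - q) <= w * Rabs x -> Rabs (r - s) <= w * Rabs x ->
      Rabs (a + u * (p + r) - (b + u * (q + s))) <= (v + (w + w)) * Rabs x).
      intros a b p q r s u v w Hu G1 G2 G3.
      replace (_ - _) with ((a - b) + u * ((p - q) + (r - s))) by ring.
      eapply Rle_trans; [apply Rabs_triang|]; rewrite Rabs_mult, Hu, Rmult_1_l.
      generalize (Rabs_triang (p - q) (r - s)); lra.
    split; apply G; auto using pow_1_abs.
Qed.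

(** A primitive of [gaussian c y] times cos((2k+1) pi (y - x0)): the cosine splits into two
    exponentials, and completing the square shifts c y by -i b and i b with b = (2k+1) pi / (2c). *)
Definition gaussian_prim (k : nat) (y : R) : C :=
  (Cexp (- ((odd_freq k * PI / (2 * c)) * (odd_freq k * PI / (2 * c)))) / (2 * c) *
   (Cexp (- (Ci * RtoC (odd_freq k * PI * x0))) * Gauss (c * y + - (Ci * (odd_freq k * PI / (2 * c))))
    + Cexp (Ci * RtoC (odd_freq k * PI * x0)) * Gauss (c * y + Ci * (odd_freq k * PI / (2 * c)))))%C.

Lemma Cexp_Ci (t : R) : Cexp (Ci * t) = (cos t, sin t).
Proof.
assert (E1 : Re (Ci * t) = 0) by (simpl; ring).
assert (E2 : Im (Ci * t) = t) by (simpl; ring).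
apply Ceq; rewrite ?Re_Cexp, ?Im_Cexp, E1, E2, exp_0; simpl; ring.
Qed.

Lemma cos_Cexp (t : R) : RtoC (cos t) = ((Cexp (Ci * t) + Cexp (- (Ci * t))) / 2)%C.
Proof.
replace (- (Ci * t))%C with (Ci * RtoC (- t))%C by (rewrite RtoC_opp; ring).
rewrite !Cexp_Ci, cos_neg, sin_neg.
apply Ceq; simpl; field.
Qed.

Lemma is_Cderive_gaussian_prim k y :
  is_Cderive (gaussian_prim k) y (gaussian c y * RtoC (cos (odd_freq k * (PI * (y - x0)))))%C.
Proof.
assert (Hc0 := c_neq0).
eapply is_Cderive_eq.
- apply is_Cderive_scal, is_Cderive_plus; apply is_Cderive_scal, is_Cderive_Gauss, is_Cderive_linear.
- cbv beta; rewrite cos_Cexp.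
  set (b := (odd_freq k * PI / (2 * c))%C).
  assert (Eb : (2 * c * b = RtoC (odd_freq k * PI))%C).
    unfold b; rewrite RtoC_mult; field; exact Hc0.
  replace (RtoC (odd_freq k * (PI * (y - x0)))) with (2 * c * b * (y - x0))%C.
  2: { rewrite Eb, !RtoC_mult, RtoC_minus; ring. }
  replace (RtoC (odd_freq k * PI * x0)) with (2 * c * b * x0)%C.
  2: { rewrite Eb, !RtoC_mult; ring. }
  unfold gaussian.
  transitivity ((Cexp (- (b * b)) * Cexp (- (Ci * (2 * c * b * x0))) * Cexp (- ((c * y + - (Ci * b)) * (c * y + - (Ci * b))))
   + Cexp (- (b * b)) * Cexp (Ci * (2 * c * b * x0)) * Cexp (- ((c * y + Ci * b) * (c * y + Ci * b)))) / 2)%C.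
    field; exact Hc0.
  transitivity ((Cexp (- (c * y * (c * y))) * Cexp (Ci * (2 * c * b * (y - x0)))
    + Cexp (- (c * y * (c * y))) * Cexp (- (Ci * (2 * c * b * (y - x0))))) / 2)%C.
  2: { field. }
  rewrite <- !Cexp_plus.
  assert (Hi : (Ci * Ci = - (1))%C) by (apply Ceq; simpl; ring).
  do 2 f_equal; f_equal.
  + transitivity (- (c * y * (c * y)) - b * b * (1 + Ci * Ci) + (Ci * (2 * c * b * (y - x0))))%C;
      [ring | rewrite Hi; ring].
  + transitivity (- (c * y * (c * y)) - b * b * (1 + Ci * Ci) - (Ci * (2 * c * b * (y - x0))))%C;
      [ring | rewrite Hi; ring].
Qed.

Lemma cos_odd_freq_shift k m t :
  cos (odd_freq k * (PI * (t + INR m))) = (-1) ^ m * cos (odd_freq k * (PI * t)).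
Proof.
induction m as [|m IH]; [simpl; rewrite Rplus_0_r; ring|].
rewrite S_INR.
replace (_ * _)
  with (odd_freq k * (PI * (t + INR m)) + PI + 2 * INR k * PI) by (unfold odd_freq; ring).
rewrite cos_period, neg_cos, IH; simpl; ring.
Qed.

Lemma pow_m1_sqr m : (-1) ^ m * (-1) ^ m = 1.
Proof. rewrite <- Rpow_mult_distr; replace (-1 * -1) with 1 by ring; apply pow1. Qed.

Lemma cos_odd_freq_shift_neg k m t :
  cos (odd_freq k * (PI * (t - INR m))) = (-1) ^ m * cos (odd_freq k * (PI * t)).
Proof.
generalize (cos_odd_freq_shift k m (t - INR m)).
replace (t - INR m + INR m) with t by ring; intros ->.
rewrite <- (Rmult_assoc ((-1) ^ m)), pow_m1_sqr; ring.
Qed.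

(* A primitive of theta(x0 + x) cos((2k+1) pi x): the shift by an integer m
   changes the cosine by (-1)^m, which is the sign in theta. *)
Fixpoint theta_prim (k M : nat) (x : R) : C :=
  match M with
  | O => gaussian_prim k (x0 + x)
  | S M' => (theta_prim k M' x
             + (gaussian_prim k (x0 + x + INR M) + gaussian_prim k (x0 + x - INR M)))%C
  end.

Lemma is_Cderive_shift (f : R -> C) a b y l :
  is_Cderive f (a + y + b) l -> is_Cderive (fun y => f (a + y + b)) y l.
Proof.
assert (H : is_derive (fun y => a + y + b) y 1) by (auto_derive; auto).
intros [H1 H2]; split.
- apply (is_derive_eq _ _ (Re l * 1)); [|ring].
  apply (is_derive_Rcomp (fun z => Re (f z)) (fun y => a + y + b)); assumption.
- apply (is_derive_eq _ _ (Im l * 1)); [|ring].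
  apply (is_derive_Rcomp (fun z => Im (f z)) (fun y => a + y + b)); assumption.
Qed.

Lemma is_Cderive_theta_prim k M x :
  is_Cderive (theta_prim k M) x (theta c M (x0 + x) * RtoC (cos (odd_freq k * (PI * x))))%C.
Proof.
induction M as [|M IH]; cbn [theta theta_prim].
- eapply is_Cderive_ext.
    2: { apply (is_Cderive_eq _ _ (gaussian c (x0 + x + 0) * RtoC (cos (odd_freq k * (PI * (x0 + x + 0 - x0)))))%C).
      apply is_Cderive_shift, is_Cderive_gaussian_prim.
      rewrite Rplus_0_r; replace (x0 + x - x0) with x by ring; reflexivity. }
  intros y; cbv beta; rewrite Rplus_0_r; reflexivity.
- eapply is_Cderive_eq.
    apply is_Cderive_plus; [exact IH|]; apply is_Cderive_plus.
    + apply is_Cderive_shift, is_Cderive_gaussian_prim.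
    + apply (is_Cderive_shift _ _ (- INR (S M))), is_Cderive_gaussian_prim.
  + cbv beta.
    replace (x0 + x + INR (S M) - x0) with (x + INR (S M)) by ring.
    replace (_ - _) with (x - INR (S M)) by ring.
    rewrite cos_odd_freq_shift, cos_odd_freq_shift_neg, RtoC_mult.
    unfold Rminus; ring.
Qed.

(** The translates of [-1/2, 1/2] by the integers from -M to M tile the interval of radius M + 1/2,
    so the values at the inner endpoints cancel. *)
Lemma theta_prim_telescope k M :
  (theta_prim k M (1 / 2) - theta_prim k M (- (1 / 2)) =
   gaussian_prim k (x0 + (INR M + 1 / 2)) - gaussian_prim k (x0 - (INR M + 1 / 2)))%C.
Proof.
induction M as [|M IH]; cbn [theta_prim].
- simpl INR; rewrite Rplus_0_l; reflexivity.
- replace (_ - _)%C with ((theta_prim k M (1 / 2) - theta_prim k M (- (1 / 2)))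
   + (gaussian_prim k (x0 + 1 / 2 + INR (S M)) + gaussian_prim k (x0 + 1 / 2 - INR (S M))
     - (gaussian_prim k (x0 + - (1 / 2) + INR (S M)) + gaussian_prim k (x0 + - (1 / 2) - INR (S M)))))%C by ring.
  rewrite IH, S_INR.
  replace (x0 + (INR M + 1 + 1 / 2)) with (x0 + 1 / 2 + (INR M + 1)) by ring.
  replace (x0 - (INR M + 1 + 1 / 2)) with (x0 + - (1 / 2) - (INR M + 1)) by ring.
  replace (x0 + - (1 / 2) + (INR M + 1)) with (x0 + (INR M + 1 / 2)) by field.
  replace (x0 + 1 / 2 - (INR M + 1)) with (x0 - (INR M + 1 / 2)) by field.
  ring.
Qed.

Lemma is_Cderive_theta M y : exists l, is_Cderive (theta c M) y l.
Proof.
induction M as [|M [l IH]]; cbn [theta].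
- eexists; apply is_Cderive_gaussian.
- assert (H1 := is_Cderive_shift (gaussian c) 0 (INR (S M)) y _ (is_Cderive_gaussian c _)).
  assert (H2 := is_Cderive_shift (gaussian c) 0 (- INR (S M)) y _ (is_Cderive_gaussian c _)).
  eexists.
  eapply is_Cderive_ext; [|exact (is_Cderive_plus _ _ _ _ _ IH (is_Cderive_scal (RtoC ((-1) ^ S M)) _ _ _
    (is_Cderive_plus _ _ _ _ _ H1 H2)))].
  intros z; cbv beta; rewrite Rplus_0_l; reflexivity.
Qed.

Lemma is_Cderive_theta_shift M x : exists l, is_Cderive (fun x => theta c M (x0 + x)) x l.
Proof.
destruct (is_Cderive_theta M (x0 + x + 0)) as [l H]; exists l.
eapply is_Cderive_ext; [|exact (is_Cderive_shift _ _ _ _ _ H)].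
intros z; cbv beta; rewrite Rplus_0_r; reflexivity.
Qed.

Lemma ex_derive_Re_theta M x : ex_derive (fun x => Re (theta c M (x0 + x))) x.
Proof. destruct (is_Cderive_theta_shift M x) as [l [H _]]; eexists; exact H. Qed.

Lemma ex_derive_Im_theta M x : ex_derive (fun x => Im (theta c M (x0 + x))) x.
Proof. destruct (is_Cderive_theta_shift M x) as [l [_ H]]; eexists; exact H. Qed.

Definition theta_coef (k M : nat) : C :=
  (gaussian_prim k (x0 + (INR M + 1 / 2)) - gaussian_prim k (x0 - (INR M + 1 / 2)))%C.

Lemma RInt_Re_theta k M :
  RInt (fun x => Re (theta c M (x0 + x)) * cos (odd_freq k * (PI * x))) (- (1 / 2)) (1 / 2)
  = Re (theta_coef k M).
Proof.
eqR; rewrite (RInt_FTC (fun x => Re (theta_prim k M x))).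
- unfold theta_coef; rewrite <- theta_prim_telescope; reflexivity.
- intros x _; destruct (is_Cderive_theta_prim k M x) as [H _].
  rewrite re_scal_r in H; exact H.
- intros x _; apply continuous_derivable.
  apply ex_derive_Rmult; [apply ex_derive_Re_theta | auto_derive; auto].
Qed.

Lemma RInt_Im_theta k M :
  RInt (fun x => Im (theta c M (x0 + x)) * cos (odd_freq k * (PI * x))) (- (1 / 2)) (1 / 2)
  = Im (theta_coef k M).
Proof.
eqR; rewrite (RInt_FTC (fun x => Im (theta_prim k M x))).
- unfold theta_coef; rewrite <- theta_prim_telescope; reflexivity.
- intros x _; destruct (is_Cderive_theta_prim k M x) as [_ H].
  rewrite im_scal_r in H; exact H.
- intros x _; apply continuous_derivable.
  apply ex_derive_Rmult; [apply ex_derive_Im_theta | auto_derive; auto].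
Qed.

(** The limit of [theta_coef k] as the truncation grows, obtained by replacing the four values of
    [Gauss] at the endpoints by [kappa] up to sign. Twice this is the k-th term of the dual theta
    series. *)
Definition theta_dual (k : nat) : C :=
  (2 * kappa / c * RtoC (cos (odd_freq k * PI * x0)) *
   Cexp (- ((odd_freq k * PI / (2 * c)) * (odd_freq k * PI / (2 * c)))))%C.

Lemma theta_coef_lim k (eps : R) : 0 < eps ->
  exists M0, forall M, (M0 <= M)%nat -> Cmod (theta_coef k M - theta_dual k) <= eps.
Proof.
intros He; assert (Hc0 := c_neq0).
set (b := (Ci * (odd_freq k * PI / (2 * c)))%C).
set (A := (Cexp (- ((odd_freq k * PI / (2 * c)) * (odd_freq k * PI / (2 * c)))) / (2 * c))%C).
set (e1 := Cexp (- (Ci * RtoC (odd_freq k * PI * x0)))).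
set (e2 := Cexp (Ci * RtoC (odd_freq k * PI * x0))).
assert (H1 : Cmod e1 = 1).
  unfold e1; rewrite Cmod_Cexp, <- exp_0; f_equal; simpl; ring.
assert (H2 : Cmod e2 = 1).
  unfold e2; rewrite Cmod_Cexp, <- exp_0; f_equal; simpl; ring.
assert (HA := Cmod_ge_0 A).
set (d := eps / (4 * (Cmod A + 1))).
assert (Hd : 0 < d) by (apply Rdiv_lt_0_compat; lra).
assert (HdA : Cmod A * (d + d + (d + d)) <= eps).
  replace eps with (4 * (Cmod A + 1) * d) by (unfold d; field; lra); nra.
destruct (Gauss_lim c (- b) d Hc Hd) as [Y1 HY1], (Gauss_lim c b d Hc Hd) as [Y2 HY2].
destruct (INR_unbounded (Rmax Y1 Y2)) as [M0 HM0]; exists M0; intros M HM.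
apply le_INR in HM.
assert (L1 := Rmax_l Y1 Y2); assert (L2 := Rmax_r Y1 Y2).
assert (Hx : - (1 / 2) <= x0 <= 1 / 2) by (apply Rabs_le_between, Hx0).
set (y := x0 + (INR M + 1 / 2)); set (z := INR M + 1 / 2 - x0).
(* Oddness of [Gauss] moves the left endpoint to the positive ray through z, so that all four values
   tend to [kappa]. *)
assert (E : (theta_coef k M - theta_dual k = A *
  (e1 * (Gauss (c * y + - b) - kappa) + e2 * (Gauss (c * y + b) - kappa)
   + (e1 * (Gauss (c * z + b) - kappa) + e2 * (Gauss (c * z + - b) - kappa))))%C).
  unfold theta_coef, gaussian_prim; fold y b A e1 e2.
  replace (x0 - (INR M + 1 / 2)) with (- z) by (unfold z; ring).
  replace (c * RtoC (- z) + - b)%C with (- (c * z + b))%C by (rewrite RtoC_opp; ring).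
  replace (c * RtoC (- z) + b)%C with (- (c * z + - b))%C by (rewrite RtoC_opp; ring).
  rewrite !Gauss_opp.
  unfold theta_dual; rewrite cos_Cexp; fold e1 e2.
  replace (2 * kappa / c * ((e2 + e1) / 2) * Cexp (- (odd_freq k * PI / (2 * c) * (odd_freq k * PI / (2 * c)))))%C
    with (A * (2 * kappa * (e1 + e2)))%C by (unfold A; field; exact Hc0).
  ring.
rewrite E, Cmod_mult.
eapply Rle_trans; [apply Rmult_le_compat_l; [exact HA|]|exact HdA].
assert (Q1 := HY1 y ltac:(unfold y; lra)); assert (Q2 := HY2 y ltac:(unfold y; lra)).
assert (Q3 := HY1 z ltac:(unfold z; lra)); assert (Q4 := HY2 z ltac:(unfold z; lra)).
eapply Rle_trans; [apply Cmod_triangle|].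
apply Rplus_le_compat; (eapply Rle_trans; [apply Cmod_triangle|]);
  rewrite !Cmod_mult, H1, H2, !Rmult_1_l; apply Rplus_le_compat; assumption.
Qed.

Lemma theta_coef_lim_unif N (eps : R) : 0 < eps ->
  exists M0, forall M k, (M0 <= M)%nat -> (k <= N)%nat -> Cmod (theta_coef k M - theta_dual k) <= eps.
Proof.
intros He; induction N as [|N [M1 H1]].
- destruct (theta_coef_lim 0 eps He) as [M0 H]; exists M0; intros M k HM Hk.
  replace k with 0%nat by lia; auto.
- destruct (theta_coef_lim (S N) eps He) as [M0 H]; exists (Nat.max M0 M1); intros M k HM Hk.
  destruct (Nat.eq_dec k (S N)) as [->|Hk']; [apply H | apply H1]; lia.
Qed.

Lemma sin_bounds_half x : Rabs x <= 1 / 2 ->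
  Rabs x <= Rabs (sin (PI * x)) /\ 1 - cos (PI * x) <= Rabs (sin (PI * x)).
Proof.
assert (HP4 := PI_4); assert (HP2 := PI2_1).
assert (G : forall x, 0 <= x <= 1 / 2 -> x <= sin (PI * x) /\ 1 - cos (PI * x) <= sin (PI * x)).
  intros u Hu.
  assert (0 <= sin (PI * u)) by (apply sin_ge_0; nra).
  assert (0 <= cos (PI * u)) by (apply cos_ge_0; nra).
  generalize (sin2_cos2 (PI * u)) (COS_bound (PI * u)); unfold Rsqr; intros.
  split; [|nra].
  destruct (proj1 Hu) as [Hu0|<-]; [|rewrite Rmult_0_r, sin_0; lra].
  assert (Hs := sin_bound (PI * u) 0 ltac:(nra) ltac:(nra)).
  assert (E : sin_approx (PI * u) (2 * 0 + 1) = PI * u * (1 - (PI * u) * (PI * u) / 6)).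
    unfold sin_approx, sin_term; simpl; field.
  rewrite E in Hs; assert (PI * u <= 2) by nra; assert (0 < PI * u) by nra.
  (* As pi u <= 2, the cubic Taylor factor 1 - (pi u)^2 / 6 is at least 1/3, and pi / 3 > 1. *)
  assert (PI * u * (1 / 3) <= PI * u * (1 - (PI * u) * (PI * u) / 6)) by (apply Rmult_le_compat_l; nra).
  assert (3 < PI) by (generalize PI2_3_2; lra).
  nra.
intros Hx; destruct (Rle_dec 0 x) as [H0|H0].
- rewrite (Rabs_pos_eq x) in * by lra; destruct (G x ltac:(lra)).
  rewrite Rabs_pos_eq; lra.
- rewrite (Rabs_left x) in * by lra; destruct (G (- x) ltac:(lra)) as [G1 G2].
  replace (PI * - x) with (- (PI * x)) in G1, G2 by ring; rewrite sin_neg in G1, G2; rewrite cos_neg in G2.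
  rewrite Rabs_left1; lra.
Qed.

(* The kernel cos^(2N+1)(pi x) concentrates at 0 and its integral against theta
   is the sum of cosine coefficients on the right. As 0 <= cos_coef N k <= cos_coef N 0,
   theta is 2 theta_coef 0 up to the tail of the dual series, whatever N is. *)
Lemma theta_approx : exists B, forall N M,
  Cmod (theta c M x0 - Csum (fun k => RtoC (2 * cos_coef N k / cos_coef N 0) * theta_coef k M)%C (S N))
  <= B / sqrt (INR N + 1).
Proof.
destruct theta_lipschitz as [B HB].
exists (8 * B / PI); intros N M.
assert (HP := PI_RGT_0); assert (HN := pos_INR N).
assert (Hq : 0 < sqrt (INR N + 1)) by (apply sqrt_lt_R0; lra).
assert (Hl := cos_coef_0_lower N).
assert (Hb : 0 < cos_coef N 0) by nra.
destruct (HB M) as [Hm HL].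
assert (G : forall (h : R -> R) (a : nat -> R), (forall x, ex_derive h x) ->
  Rabs (h 0) <= B -> (forall x, Rabs x <= 1 / 2 -> Rabs (h x - h 0) <= B * Rabs x) ->
  (forall k, RInt (fun x => h x * cos (odd_freq k * (PI * x))) (- (1 / 2)) (1 / 2) = a k) ->
  Rabs (h 0 - Rsum (fun k => 2 * cos_coef N k / cos_coef N 0 * a k) (S N)) <= 4 * B / PI / sqrt (INR N + 1)).
  intros h a Hd H0 Hx Ha.
  assert (HK := cos_kernel_approx h (2 * B) N Hd).
  rewrite (RInt_eq _ (fun x => Rsum (fun k => cos_coef N k * (h x * cos (odd_freq k * (PI * x)))) (S N))) in HK.
  2: { intros x; rewrite cos_odd_pow, Rmult_comm, <- Rsum_scal; apply Rsum_eq; intros; ring. }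
  rewrite (RInt_Rsum (fun k x => cos_coef N k * (h x * cos (odd_freq k * (PI * x))))) in HK.
  2: { intros k x; auto_derive; auto. }
  rewrite (Rsum_eq _ (fun k => cos_coef N 0 / 2 * (2 * cos_coef N k / cos_coef N 0 * a k))) in HK.
  2: { intros k _; rewrite RInt_scal_R, Ha; [field; lra|].
       apply ex_RInt_derivable; intros; auto_derive; auto. }
  rewrite Rsum_scal in HK.
  set (S' := Rsum _ _) in *.
  assert (HK' : Rabs (cos_coef N 0 / 2 * S' - h 0 * (cos_coef N 0 / 2)) <= 2 * B / (PI * (INR N + 1))).
    apply HK; intros x Hx'; destruct (sin_bounds_half x Hx') as [S1 S2].
    replace (_ - _) with ((h x - h 0) + h 0 * (1 - cos (PI * x))) by ring.
    eapply Rle_trans; [apply Rabs_triang|]; rewrite Rabs_mult.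
    rewrite (Rabs_pos_eq (1 - _)) by (generalize (COS_bound (PI * x)); lra).
    generalize (Hx x Hx') (Rabs_pos (h 0)) (COS_bound (PI * x)); intros.
    assert (B * Rabs x <= B * Rabs (sin (PI * x))) by (apply Rmult_le_compat_l; lra).
    assert (Rabs (h 0) * (1 - cos (PI * x)) <= B * Rabs (sin (PI * x))) by (apply Rmult_le_compat; lra).
    lra.
  replace (_ - _) with (- (cos_coef N 0 / 2 * (h 0 - S'))) in HK' by ring.
  rewrite Rabs_Ropp, Rabs_mult, (Rabs_pos_eq (_ / 2)) in HK' by lra.
  assert (E : INR N + 1 = sqrt (INR N + 1) * sqrt (INR N + 1)) by (rewrite sqrt_sqrt; lra).
  rewrite E in HK' at 1.
  apply (Rmult_le_reg_r (/ (2 * sqrt (INR N + 1)))); [apply Rinv_0_lt_compat; lra|].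
  apply Rle_trans with (cos_coef N 0 / 2 * Rabs (h 0 - S')).
  - rewrite Rmult_comm; apply Rmult_le_compat_r; [apply Rabs_pos|].
    apply (Rmult_le_reg_r (2 * sqrt (INR N + 1))); [lra|]; rewrite Rinv_l by lra; lra.
  - eapply Rle_trans; [exact HK'|]; right; field; lra.
eapply Rle_trans; [apply Cmod_le_abs|].
replace (_ / _) with (4 * B / PI / sqrt (INR N + 1) + 4 * B / PI / sqrt (INR N + 1))
  by (field; lra).
apply Rplus_le_compat.
- assert (G1 := G (fun x => Re (theta c M (x0 + x))) (fun k => Re (theta_coef k M))).
  cbv beta in G1; rewrite Rplus_0_r in G1.
  unfold Cminus; rewrite re_plus, re_opp, Re_Csum.
  rewrite (Rsum_eq _ (fun k => 2 * cos_coef N k / cos_coef N 0 * Re (theta_coef k M)))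
    by (intros; apply re_scal_l).
  apply G1.
  + apply ex_derive_Re_theta.
  + eapply Rle_trans; [apply re_le_Cmod | exact Hm].
  + intros x Hx; apply HL, Hx.
  + intros k; apply RInt_Re_theta.
- assert (G1 := G (fun x => Im (theta c M (x0 + x))) (fun k => Im (theta_coef k M))).
  cbv beta in G1; rewrite Rplus_0_r in G1.
  unfold Cminus; rewrite im_plus, im_opp, Im_Csum.
  rewrite (Rsum_eq _ (fun k => 2 * cos_coef N k / cos_coef N 0 * Im (theta_coef k M)))
    by (intros; apply im_scal_l).
  apply G1.
  + apply ex_derive_Im_theta.
  + eapply Rle_trans; [apply im_le_Cmod | exact Hm].
  + intros x Hx; apply HL, Hx.
  + intros k; apply RInt_Im_theta.
Qed.

Lemma Csum_shift f n : Csum f (S n) = (f 0%nat + Csum (fun k => f (S k)) n)%C.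
Proof. induction n as [|n IH]; [simpl; ring|]; change (Csum f (S (S n))) with (Csum f (S n) + f (S n))%C; rewrite IH; simpl; ring. Qed.

Lemma Rsum_const a n : Rsum (fun _ => a) n = INR n * a.
Proof. induction n as [|n IH]; [simpl; ring|]; rewrite S_INR; simpl Rsum; rewrite IH; ring. Qed.

(** The order of the choices matters: N is fixed by the kernel error of [theta_approx], whose bound
    is independent of M, and only then is M taken large for the finitely many coefficients k <= N.
    The weights r k lie in [0, 2] with r 0 = 2, so the dual terms with k >= 1 contribute at most T
    whatever N is. *)
Lemma theta_inversion (T eps : R) :
  (forall N, Rsum (fun k => 2 * Cmod (theta_dual (S k))) N <= T) -> 0 < eps ->
  exists M0, forall M, (M0 <= M)%nat -> Cmod (theta c M x0 - 2 * theta_dual 0) <= T + eps.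
Proof.
intros HT He.
destruct theta_approx as [B HB].
assert (HN : exists N, B / sqrt (INR N + 1) <= eps / 2).
  destruct (INR_unbounded ((2 * Rabs B / eps) * (2 * Rabs B / eps))) as [N HN]; exists N.
  assert (0 <= 2 * Rabs B / eps).
    apply Rmult_le_pos; [generalize (Rabs_pos B); lra | apply Rlt_le, Rinv_0_lt_compat, He].
  assert (Hs : 2 * Rabs B / eps <= sqrt (INR N + 1)).
    rewrite <- (sqrt_square (2 * Rabs B / eps)) by assumption; apply sqrt_le_1_alt; lra.
  assert (Hq : 0 < sqrt (INR N + 1)) by (apply sqrt_lt_R0; generalize (pos_INR N); lra).
  apply (Rmult_le_reg_r (sqrt (INR N + 1))); [exact Hq|].
  unfold Rdiv at 1; rewrite Rmult_assoc, Rinv_l, Rmult_1_r by lra.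
  apply (Rmult_le_compat_l (eps / 2)) in Hs; [|lra].
  replace (_ * _) with (Rabs B) in Hs by (field; lra).
  generalize (Rle_abs B); lra.
destruct HN as [N HN].
set (d := eps / (4 * INR (S N))).
assert (HSN : 0 < INR (S N)) by (apply lt_0_INR; lia).
assert (Hd : 0 < d) by (apply Rdiv_lt_0_compat; lra).
destruct (theta_coef_lim_unif N d Hd) as [M0 HM0]; exists M0; intros M HM.
assert (Hb : 0 < cos_coef N 0).
  assert (Hl := cos_coef_0_lower N).
  generalize (sqrt_pos (INR N + 1)); nra.
set (r := fun k => 2 * cos_coef N k / cos_coef N 0).
assert (Hr : forall k, 0 <= r k <= 2).
  intros k; generalize (cos_coef_pos N k) (cos_coef_le0 N k); intros; unfold r; split.
    apply Rmult_le_pos; [lra | apply Rlt_le, Rinv_0_lt_compat, Hb].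
  apply (Rmult_le_reg_r (cos_coef N 0)); [exact Hb|].
  unfold Rdiv; rewrite Rmult_assoc, Rinv_l by lra; lra.
assert (Hr0 : r 0%nat = 2) by (unfold r; field; lra).
specialize (HB N M).
replace (_ - _)%C with
  ((theta c M x0 - Csum (fun k => RtoC (r k) * theta_coef k M)%C (S N)) +
   (Csum (fun k => RtoC (r k) * theta_coef k M)%C (S N) - Csum (fun k => RtoC (r k) * theta_dual k)%C (S N)) +
   (Csum (fun k => RtoC (r k) * theta_dual k)%C (S N) - 2 * theta_dual 0))%C by ring.
assert (P2 : Cmod (Csum (fun k => RtoC (r k) * theta_coef k M)%C (S N) - Csum (fun k => RtoC (r k) * theta_dual k)%C (S N)) <= eps / 2).
  rewrite Csum_minus; eapply Rle_trans; [apply Cmod_Csum|].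
  replace (eps / 2) with (Rsum (fun _ => 2 * d) (S N)).
  2: { rewrite Rsum_const; unfold d; field; lra. }
  apply Rsum_le; intros k Hk.
  replace (_ - _)%C with (r k * (theta_coef k M - theta_dual k))%C by ring.
  rewrite Cmod_mult, Cmod_R, Rabs_pos_eq by apply Hr.
  apply Rmult_le_compat; [apply Hr | apply Cmod_ge_0 | apply Hr | apply HM0; lia].
assert (P3 : Cmod (Csum (fun k => RtoC (r k) * theta_dual k)%C (S N) - 2 * theta_dual 0) <= T).
  rewrite Csum_shift, Hr0.
  replace (_ - _)%C with (Csum (fun k => RtoC (r (S k)) * theta_dual (S k))%C N) by ring.
  eapply Rle_trans; [apply Cmod_Csum|]; eapply Rle_trans; [|apply (HT N)].
  apply Rsum_le; intros k Hk; rewrite Cmod_mult, Cmod_R, Rabs_pos_eq by apply Hr.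
  apply Rmult_le_compat_r; [apply Cmod_ge_0 | apply Hr].
eapply Rle_trans; [apply Cmod_triangle|].
eapply Rle_trans; [apply Rplus_le_compat_r, Cmod_triangle|].
change (Cmod (theta c M x0 - Csum (fun k => RtoC (r k) * theta_coef k M)%C (S N))
  <= B / sqrt (INR N + 1)) in HB; lra.
Qed.
End Poisson.

(** * Shanks' finite form of Euler's pentagonal number theorem *)

Fixpoint euler_prod (q : C) (s n : nat) : C :=
  match n with
  | O => 1%C
  | S n' => (euler_prod q s n' * (1 - q ^ (s + n)))%C
  end.

(* gpent m = m (3 m + 1) / 2; the other pentagonal numbers are gpent (m - 1) + 2 m - 1. *)
Fixpoint gpent (m : nat) : nat :=
  match m with O => 0 | S m' => gpent m' + 3 * m' + 2 end.

Fixpoint pent_sum (q : C) (M : nat) : C :=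
  match M with
  | O => 1%C
  | S M' => (pent_sum q M' + RtoC ((-1) ^ M) * (q ^ (gpent M' + 2 * M' + 1) + q ^ gpent M))%C
  end.

Fixpoint tri (s : nat) : nat := match s with O => 0 | S s' => tri s' + s end.

Lemma gpent_tri n : (gpent n = n * n + tri n)%nat.
Proof. induction n as [|n IH]; simpl; [auto|]; rewrite IH; nia. Qed.

Lemma euler_prod_shift q s n :
  euler_prod q s (S n) = ((1 - q ^ S s) * euler_prod q (S s) n)%C.
Proof.
induction n as [|n IH].
- simpl; replace (s + 1)%nat with (S s) by lia; simpl; ring.
- change (euler_prod q s (S (S n))) with (euler_prod q s (S n) * (1 - q ^ (s + S (S n))))%C.
  rewrite IH; cbn [euler_prod]; replace (s + S (S n))%nat with (S s + S n)%nat by lia; ring.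
Qed.

Definition shanks_term (q : C) (N s : nat) : C :=
  (RtoC ((-1) ^ s) * q ^ (s * N + tri s) * euler_prod q s (N - s))%C.

(** Passing from N to N + 1 changes the sum over s <= K by a single term. At K = N that term is the
    pentagonal one with exponent gpent N + 2 N + 1; the new summand s = N + 1 supplies gpent (N +
    1). *)
Lemma shanks_telescope q N K : (K <= N)%nat ->
  (Csum (fun s => RtoC ((-1) ^ s) * q ^ (s * S N + tri s) * euler_prod q s (S N - s)) (S K)
   - Csum (shanks_term q N) (S K)
   = - (RtoC ((-1) ^ K) * q ^ (K * N + tri K + K + N + 1) * euler_prod q K (N - K)))%C.
Proof.
induction K as [|K IH]; intros HK.
- unfold shanks_term; cbn [Csum tri Nat.mul Nat.add pow].
  rewrite !Nat.sub_0_r; cbn [euler_prod].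
  replace (N + 1)%nat with (0 + S N)%nat by lia; simpl; ring.
- change (Csum ?f (S (S K))) with (Csum f (S K) + f (S K))%C.
  match goal with |- (?A + ?a - (?B + ?b) = _)%C =>
    transitivity ((A - B) + (a - b))%C; [ring|] end.
  rewrite IH by lia; unfold shanks_term.
  replace (N - K)%nat with (S (N - S K)) by lia.
  rewrite euler_prod_shift.
  replace (S N - S K)%nat with (S (N - S K)) by lia.
  cbn [euler_prod]; set (E := euler_prod q (S K) (N - S K)).
  replace (S K + S (N - S K))%nat with (S N) by lia.
  replace (_ + _)%nat with (S K * N + tri (S K))%nat by (simpl; lia).
  replace (S K * S N + tri (S K))%nat with (S K * N + tri (S K) + S K)%nat by lia.
  replace (S K * N + tri (S K) + S K + N + 1)%nat with ((S K * N + tri (S K)) + S K + S N)%nat by lia.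
  rewrite !Cpow_add_r.
  replace (RtoC ((-1) ^ S K)) with (- RtoC ((-1) ^ K))%C by (rewrite <- RtoC_opp; f_equal; simpl; ring).
  ring.
Qed.

(** An exact identity for every N. The summand s = 0 is the Euler product and every other one is
    divisible by q^N. This gives both the approximation of the product by [pent_sum] and, after
    division by the product, Euler's recurrence. *)
Lemma shanks q N : pent_sum q N = Csum (shanks_term q N) (S N).
Proof.
induction N as [|N IH].
- unfold shanks_term; simpl; ring.
- cbn [pent_sum]; rewrite IH.
  generalize (shanks_telescope q N N (Nat.le_refl N)).
  rewrite Nat.sub_diag; cbn [euler_prod]; rewrite Cmult_1_r; intros H.
  change (Csum (shanks_term q (S N)) (S (S N))) with
    (Csum (fun s => RtoC ((-1) ^ s) * q ^ (s * S N + tri s) * euler_prod q s (S N - s)) (S N)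
     + shanks_term q (S N) (S N))%C.
  match type of H with (?A - ?B = ?r)%C => replace A with (B + r)%C by (rewrite <- H; ring) end.
  replace (shanks_term q (S N) (S N)) with (RtoC ((-1) ^ S N) * q ^ (S N * S N + tri (S N)))%C.
  2: { unfold shanks_term; rewrite Nat.sub_diag; cbn [euler_prod]; ring. }
  rewrite !gpent_tri.
  replace (_ + _)%nat with (N * N + tri N + N + N + 1)%nat by lia.
  replace (RtoC ((-1) ^ S N)) with (- RtoC ((-1) ^ N))%C by (rewrite <- RtoC_opp; f_equal; simpl; ring).
  ring.
Qed.

Lemma Rsum_geom r n : r <> 1 -> Rsum (fun k => r ^ k) n = (1 - r ^ n) / (1 - r).
Proof.
intros Hr; induction n as [|n IH]; simpl; [field; lra | rewrite IH; field; lra].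
Qed.

Lemma Rsum_geom_le r n : 0 <= r < 1 -> Rsum (fun k => r ^ k) n <= / (1 - r).
Proof.
intros Hr; rewrite Rsum_geom by lra.
assert (0 < / (1 - r)) by (apply Rinv_0_lt_compat; lra).
assert (0 <= r ^ n) by (apply pow_le; lra).
unfold Rdiv; nra.
Qed.

Lemma Cmod_one_minus_pow q k : 1 - Cmod q ^ k <= Cmod (1 - q ^ k) <= 1 + Cmod q ^ k.
Proof.
rewrite <- Cmod_pow; split.
- generalize (Cmod_triangle_rev 1 (q ^ k)); rewrite Cmod_1; auto.
- generalize (Cmod_triangle 1 (- q ^ k)); rewrite Cmod_1, Cmod_opp; auto.
Qed.

Lemma euler_prod_bound q s n : Cmod q < 1 -> Cmod (euler_prod q s n) <= exp (/ (1 - Cmod q)).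
Proof.
intros Hq; assert (H0 := Cmod_ge_0 q).
apply Rle_trans with (exp (Cmod q ^ s * Rsum (fun k => Cmod q ^ k) (S n))).
- induction n as [|n IH]; cbn [euler_prod].
  + rewrite Cmod_1, <- exp_0; apply exp_le; simpl; generalize (pow_le _ s H0); lra.
  + change (Rsum ?f (S (S n))) with (Rsum f (S n) + Cmod q ^ S n).
    rewrite Rmult_plus_distr_l, exp_plus, Cmod_mult.
    apply Rmult_le_compat; auto using Cmod_ge_0.
    eapply Rle_trans; [apply Cmod_one_minus_pow|].
    rewrite <- pow_add; apply exp_ineq1_le.
- apply exp_le.
  assert (Cmod q ^ s <= 1) by (rewrite <- (pow1 s); apply pow_incr; lra).
  generalize (pow_le _ s H0) (Rsum_geom_le (Cmod q) (S n) (conj H0 Hq)); intros.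
  assert (0 < / (1 - Cmod q)) by (apply Rinv_0_lt_compat; lra).
  apply Rle_trans with (1 * / (1 - Cmod q)); [|lra].
  destruct (Rle_dec 0 (Rsum (fun k => Cmod q ^ k) (S n))); [apply Rmult_le_compat; lra | nra].
Qed.

Lemma euler_prod_cauchy q N j : Cmod q < 1 ->
  Cmod (euler_prod q 0 N - euler_prod q 0 (N + j)) <= exp (/ (1 - Cmod q)) * (Cmod q ^ N * Rsum (fun k => Cmod q ^ k) (S j)).
Proof.
intros Hq; assert (H0 := Cmod_ge_0 q); induction j as [|j IH].
- rewrite Nat.add_0_r; replace (_ - _)%C with (RtoC 0) by ring; rewrite Cmod_0.
  apply Rmult_le_pos; [apply Rlt_le, exp_pos|]; simpl; generalize (pow_le _ N H0); lra.
- replace (N + S j)%nat with (S (N + j)) by lia; cbn [euler_prod].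
  change (Rsum ?f (S (S j))) with (Rsum f (S j) + Cmod q ^ S j).
  replace (_ - _)%C
    with ((euler_prod q 0 N - euler_prod q 0 (N + j)) + euler_prod q 0 (N + j) * q ^ (N + S j))%C.
  2: { replace (0 + S (N + j))%nat with (N + S j)%nat by lia; ring. }
  eapply Rle_trans; [apply Cmod_triangle|].
  rewrite Rmult_plus_distr_l, Rmult_plus_distr_l; apply Rplus_le_compat; [exact IH|].
  rewrite Cmod_mult, Cmod_pow, pow_add.
  apply Rmult_le_compat_r; [|apply euler_prod_bound, Hq].
  apply Rmult_le_pos; apply pow_le, H0.
Qed.

Lemma pow_le_pow r m n : 0 <= r <= 1 -> (m <= n)%nat -> r ^ n <= r ^ m.
Proof.
intros Hr H; replace n with (m + (n - m))%nat by lia; rewrite pow_add.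
assert (r ^ (n - m) <= 1) by (rewrite <- (pow1 (n - m)); apply pow_incr; lra).
generalize (pow_le r m (proj1 Hr)); nra.
Qed.

Lemma pent_sum_euler_prod q N : Cmod q < 1 ->
  Cmod (pent_sum q N - euler_prod q 0 N) <= exp (/ (1 - Cmod q)) * (Cmod q ^ N * / (1 - Cmod q)).
Proof.
intros Hq; assert (H0 := Cmod_ge_0 q).
rewrite shanks, Csum_shift.
unfold shanks_term at 1; rewrite Nat.sub_0_r.
replace (_ - _)%C with (Csum (fun s => shanks_term q N (S s)) N) by (simpl; ring).
eapply Rle_trans; [apply Cmod_Csum|].
apply Rle_trans with (Rsum (fun s => exp (/ (1 - Cmod q)) * Cmod q ^ N * Cmod q ^ s) N).
- apply Rsum_le; intros s Hs; unfold shanks_term.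
  rewrite !Cmod_mult, Cmod_R, pow_1_abs, Rmult_1_l, Rmult_comm, Rmult_assoc.
  apply Rmult_le_compat; auto using Cmod_ge_0, euler_prod_bound.
  rewrite Cmod_pow, <- pow_add; apply pow_le_pow; [lra|]; simpl; nia.
- rewrite Rsum_scal, Rmult_assoc.
  apply Rmult_le_compat_l; [apply Rlt_le, exp_pos|].
  apply Rmult_le_compat_l; [apply pow_le, H0 | apply Rsum_geom_le; lra].
Qed.

(** The threshold depends on |q| only, and M may exceed N. Theta inversion is available pointwise in
    q, with a threshold for M that depends on q, whereas one N has to serve a whole vertical
    segment. *)
Lemma euler_prod_pent_uniform (r eps : R) : 0 <= r < 1 -> 0 < eps ->
  exists N0, forall N M q, (N0 <= N <= M)%nat -> Cmod q = r ->
  Cmod (euler_prod q 0 N - pent_sum q M) <= eps.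
Proof.
intros Hr He.
set (K := exp (/ (1 - r)) * / (1 - r)).
assert (HK : 0 < K) by (apply Rmult_lt_0_compat; [apply exp_pos | apply Rinv_0_lt_compat; lra]).
assert (Hd : 0 < eps / (2 * K)) by (apply Rdiv_lt_0_compat; lra).
destruct (pow_lt_1_zero r ltac:(rewrite Rabs_pos_eq; lra) _ Hd) as [N0 HN0].
exists N0; intros N M q [HN HM] Hq.
assert (Hp : forall n, (N0 <= n)%nat -> K * r ^ n <= eps / 2).
  intros n Hn; specialize (HN0 n Hn); rewrite Rabs_pos_eq in HN0 by (apply pow_le; lra).
  replace (eps / 2) with (K * (eps / (2 * K))) by (field; lra).
  apply Rmult_le_compat_l; lra.
assert (G1 := euler_prod_cauchy q N (M - N) ltac:(lra)).
assert (G2 := pent_sum_euler_prod q M ltac:(lra)).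
rewrite Hq in G1, G2; replace (N + (M - N))%nat with M in G1 by lia.
replace (_ - _)%C with
  ((euler_prod q 0 N - euler_prod q 0 M) - (pent_sum q M - euler_prod q 0 M))%C by ring.
eapply Rle_trans; [apply Cmod_triangle|]; rewrite Cmod_opp.
assert (G3 : exp (/ (1 - r)) * (r ^ N * Rsum (fun k => r ^ k) (S (M - N))) <= K * r ^ N).
  unfold K; rewrite Rmult_assoc; apply Rmult_le_compat_l; [apply Rlt_le, exp_pos|].
  rewrite Rmult_comm; apply Rmult_le_compat_r; [apply pow_le; lra | apply Rsum_geom_le; lra].
generalize (Hp N HN) (Hp M ltac:(lia)); unfold K in *; lra.
Qed.

(** * The principal square root *)

(* The principal square root, on the half-plane [0 < Re z]. *)
Definition Csqrt_re (z : C) : R := sqrt ((Cmod z + Re z) / 2).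
Definition Csqrt (z : C) : C := (Csqrt_re z, Im z / (2 * Csqrt_re z)).

Section Csqrt.
Variable z : C.
Hypothesis Hz : 0 < Re z.

Lemma Csqrt_re_pos : 0 < Csqrt_re z.
Proof. apply sqrt_lt_R0; generalize (Cmod_ge_0 z); lra. Qed.

Lemma Csqrt_re_sqr : Csqrt_re z * Csqrt_re z = (Cmod z + Re z) / 2.
Proof. apply sqrt_sqrt; generalize (Cmod_ge_0 z); lra. Qed.

Lemma Csqrt_im_sqr :
  Im z / (2 * Csqrt_re z) * (Im z / (2 * Csqrt_re z)) = (Cmod z - Re z) / 2.
Proof.
generalize Csqrt_re_pos Csqrt_re_sqr (Cmod_sqr z) (Cmod_ge_0 z); intros H1 H2 H3 H4.
apply (Rmult_eq_reg_r (4 * (Csqrt_re z * Csqrt_re z))); [|nra].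
replace (_ * (4 * _)) with (Im z * Im z) at 1 by (field; lra).
rewrite H2; lra.
Qed.

Lemma Csqrt_sqr : (Csqrt z * Csqrt z = z)%C.
Proof.
generalize Csqrt_re_pos Csqrt_re_sqr Csqrt_im_sqr; intros H1 H2 H3.
apply Ceq; rewrite ?re_mult, ?im_mult; unfold Csqrt; simpl.
- rewrite H2; unfold Rdiv in H3 |- *; rewrite H3; field.
- field; lra.
Qed.

Lemma Csqrt_sector : Rabs (Im (Csqrt z)) < Re (Csqrt z).
Proof.
generalize Csqrt_re_pos Csqrt_re_sqr Csqrt_im_sqr; intros H1 H2 H3.
unfold Csqrt; cbn [Im Re fst snd].
rewrite <- (Rabs_pos_eq (Csqrt_re z)) at 2 by lra.
apply Rsqr_lt_abs_0; unfold Rsqr; lra.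
Qed.

Lemma Csqrt_neq0 : Csqrt z <> 0.
Proof.
intros E; generalize Csqrt_sqr; rewrite E; intros E2.
rewrite <- E2 in Hz; simpl in Hz; lra.
Qed.

Lemma Cmod_Csqrt : Cmod (Csqrt z) * Cmod (Csqrt z) = Cmod z.
Proof. rewrite <- Cmod_mult, Csqrt_sqr; reflexivity. Qed.
End Csqrt.

(** Computed by components: with A = [Csqrt_re] and m the modulus, A^2 = (m + t) / 2 and y^2 = 4 A^2
    (m - A^2), which reduces both components to identities of rational functions in A and m. *)
Lemma is_Cderive_Csqrt t y : 0 < t ->
  is_Cderive (fun y => Csqrt (t, y)) y (Ci / (2 * Csqrt (t, y)))%C.
Proof.
intros Ht.
assert (Hz : 0 < Re (t, y)) by exact Ht.
assert (H1 := Csqrt_re_pos _ Hz); assert (H2 := Csqrt_re_sqr _ Hz); assert (H3 := Csqrt_im_sqr _ Hz).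
assert (Hm : 0 < Cmod (t, y)) by (generalize (re_le_Cmod (t, y)) (Rle_abs (Re (t, y))); lra).
assert (HN := Csqrt_neq0 _ Hz).
cbn [Re Im fst snd] in *.
assert (Dm : is_derive (fun y => Cmod (t, y)) y (y / Cmod (t, y))).
  unfold Cmod; cbn [fst snd]; auto_derive; [nra|].
  unfold Cmod in Hm; cbn [fst snd] in Hm; simpl pow in *; field; lra.
assert (DA : is_derive (fun y => Csqrt_re (t, y)) y (y / (4 * Csqrt_re (t, y) * Cmod (t, y)))).
  assert (Ds : is_derive sqrt ((Cmod (t, y) + t) / 2) (/ (2 * Csqrt_re (t, y)))).
    auto_derive; [lra|]; unfold Csqrt_re; cbn [Re fst]; field.
    apply Rgt_not_eq, sqrt_lt_R0; lra.
  assert (Di : is_derive (fun y => (Cmod (t, y) + t) / 2) y (y / Cmod (t, y) / 2)).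
    apply (is_derive_ext (fun y => / 2 * Cmod (t, y) + t / 2)); [intros; simpl; field|].
    eapply is_derive_eq.
    - apply (is_derive_plus (K := R_AbsRing) (V := R_NormedModule)).
      + apply is_derive_Rmult; [apply (is_derive_const (V := R_NormedModule)) | exact Dm].
      + apply (is_derive_const (V := R_NormedModule)).
    - unfold plus, zero; simpl; field; lra.
  eapply is_derive_eq; [exact (is_derive_Rcomp sqrt (fun y => (Cmod (t, y) + t) / 2) _ _ _ Ds Di)|].
  field; lra.
assert (E : (Ci / (2 * Csqrt (t, y)))%C = (y / (4 * Csqrt_re (t, y) * Cmod (t, y)), Csqrt_re (t, y) / (2 * Cmod (t, y)))).
  cut (Ci = (y / (4 * Csqrt_re (t, y) * Cmod (t, y)), Csqrt_re (t, y) / (2 * Cmod (t, y)))%R * (2 * Csqrt (t, y)))%C.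
    intros F; rewrite F at 1; field; exact HN.
  unfold Csqrt; set (A := Csqrt_re (t, y)) in *; set (m := Cmod (t, y)) in *; cbn [Im snd].
  apply Ceq; simpl.
  - field; lra.
  - assert (Hy : y * y = 4 * (A * A) * (m - A * A)).
      replace (y * y) with (4 * (A * A) * (y / (2 * A) * (y / (2 * A)))) by (field; lra).
      rewrite H3, H2; field.
    field_simplify_eq; [|lra].
    replace (y ^ 2) with (y * y) by ring; rewrite Hy; ring.
rewrite E; split; [exact DA|].
eapply is_derive_ext; [|eapply is_derive_eq; [apply (is_derive_Rmult (fun y => y / 2) (fun y => / Csqrt_re (t, y)) y (/ 2)
   (- (y / (4 * Csqrt_re (t, y) * Cmod (t, y))) / (Csqrt_re (t, y)) ^ 2))|]].
- intros u; cbn [Im snd]; simpl; unfold Rdiv; rewrite Rinv_mult; ring.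
- auto_derive; auto; field.
- apply is_derive_inv; [exact DA | lra].
- cbn [Im snd]; set (A := Csqrt_re (t, y)) in *; set (m := Cmod (t, y)) in *.
  assert (Hy : y * y = 4 * (A * A) * (m - A * A)).
    replace (y * y) with (4 * (A * A) * (y / (2 * A) * (y / (2 * A)))) by (field; lra).
    rewrite H3, H2; field.
  field_simplify_eq; [|lra].
  replace (y ^ 2) with (y * y) by ring; rewrite Hy; ring.
Qed.

(** * Euler products near a positive real nome *)

Definition zeta2 : R := PI * PI / 6.

Lemma zeta2_pos : 0 < zeta2.
Proof. unfold zeta2; generalize PI_RGT_0; nra. Qed.

Lemma gpent_INR m : 2 * INR (gpent m) = INR m * (3 * INR m + 1).
Proof.
induction m as [|m IH]; [simpl; ring|].
cbn [gpent]; rewrite !plus_INR, mult_INR, (S_INR m), !Rmult_plus_distr_l, IH; simpl; ring.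
Qed.

(* The inverse of the leading term sqrt(tau / (2 pi)) exp(pi^2/(6 tau) - tau/24)
   of the generating function of partitions at exp(-tau); kappa is sqrt(pi) / 2. *)
Definition eta_main (tau : C) : C :=
  (RtoC (2 * sqrt 2 * kappa) / Csqrt tau * Cexp (tau / 24 - zeta2 / tau))%C.

Section Eta.
Variable tau : C.
Hypothesis Htau : 0 < Re tau.

(** From m (3m + 1) / 2 = (3/2) (m + 1/6)^2 - 1/24: at q = exp(-tau) the pentagonal series is
    exp(tau/24) times [theta] at the point 1/6 with c^2 = (3/2) tau. *)
Definition theta_scale : C := (RtoC (sqrt (3 / 2)) * Csqrt tau)%C.

Lemma tau_neq0 : tau <> 0.
Proof. intros E; rewrite E in Htau; simpl in Htau; lra. Qed.

Lemma theta_scale_sqr : (theta_scale * theta_scale = 3 / 2 * tau)%C.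
Proof.
unfold theta_scale.
transitivity (RtoC (sqrt (3 / 2)) * RtoC (sqrt (3 / 2)) * (Csqrt tau * Csqrt tau))%C; [ring|].
rewrite (Csqrt_sqr _ Htau), <- RtoC_mult, sqrt_sqrt, RtoC_div by lra; reflexivity.
Qed.

Lemma sqrt32_pos : 0 < sqrt (3 / 2).
Proof. apply sqrt_lt_R0; lra. Qed.

Lemma theta_scale_sector : Rabs (Im theta_scale) < Re theta_scale.
Proof.
unfold theta_scale; rewrite re_scal_l, im_scal_l, Rabs_mult, (Rabs_pos_eq (sqrt _)) by apply sqrt_pos.
apply Rmult_lt_compat_l; [apply sqrt32_pos | apply (Csqrt_sector _ Htau)].
Qed.

Lemma theta_scale_neq0 : theta_scale <> 0.
Proof. exact (c_neq0 _ theta_scale_sector). Qed.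

Lemma Cexp_pow_gaussian (n : nat) (y : R) : INR n = 3 / 2 * (y * y) - 1 / 24 ->
  (Cexp (- tau) ^ n = Cexp (tau / 24) * gaussian theta_scale y)%C.
Proof.
intros H; rewrite <- Cexp_nat; unfold gaussian; rewrite <- Cexp_plus; f_equal.
transitivity (tau / 24 - theta_scale * theta_scale * y * y)%C; [|field].
rewrite theta_scale_sqr, H, RtoC_minus, !RtoC_mult, !RtoC_div by lra; field.
Qed.

Lemma pent_sum_theta M :
  pent_sum (Cexp (- tau)) M = (Cexp (tau / 24) * theta theta_scale M (1 / 6))%C.
Proof.
induction M as [|M IH]; cbn [pent_sum theta].
- rewrite <- Cexp_pow_gaussian with (n := 0%nat); [simpl; ring | simpl; field].
- assert (H := gpent_INR M); assert (H' := gpent_INR (S M)).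
  rewrite IH, (Cexp_pow_gaussian (gpent M + 2 * M + 1) (1 / 6 - INR (S M))),
    (Cexp_pow_gaussian (gpent (S M)) (1 / 6 + INR (S M))).
  + ring.
  + lra.
  + rewrite !plus_INR, mult_INR, (S_INR M); simpl (INR 1); simpl (INR 2); lra.
Qed.

Definition eta_decay : R := zeta2 * Re tau / (Cmod tau * Cmod tau).

Lemma Re_zeta2_div : Re (zeta2 / tau)%C = eta_decay.
Proof.
unfold eta_decay; rewrite Cmod_sqr.
destruct tau as [t y]; simpl in *; field; nra.
Qed.

Lemma dual_exponent (w : R) :
  (w * PI / (2 * theta_scale) * (w * PI / (2 * theta_scale)) = RtoC (w * w) * (zeta2 / tau))%C.
Proof.
assert (H := theta_scale_neq0); assert (H1 := tau_neq0).
transitivity (w * w * PI * PI / (4 * (theta_scale * theta_scale)))%C; [field; exact H|].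
rewrite theta_scale_sqr; unfold zeta2; rewrite RtoC_div, !RtoC_mult by lra; field; exact H1.
Qed.

Lemma Cmod_theta_dual k : Cmod (theta_dual theta_scale (1 / 6) k) <=
  2 * kappa / Cmod theta_scale * exp (- (odd_freq k * odd_freq k * eta_decay)).
Proof.
assert (H := theta_scale_neq0); assert (Hk := kappa_gt).
assert (Hm : 0 < Cmod theta_scale) by (apply Cmod_gt_0, H).
unfold theta_dual; rewrite dual_exponent, !Cmod_mult, Cmod_div, <- RtoC_mult, !Cmod_R, Cmod_Cexp by exact H.
rewrite re_opp, re_scal_l, Re_zeta2_div, (Rabs_pos_eq (2 * kappa)) by lra.
apply Rmult_le_compat_r; [apply Rlt_le, exp_pos|].
rewrite <- (Rmult_1_r (2 * kappa / _)) at 2.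
apply Rmult_le_compat_l; [apply Rlt_le, Rdiv_lt_0_compat; lra|].
apply Rabs_le, COS_bound.
Qed.

Lemma cos_PI6_ge : 2 / 3 <= cos (PI / 6).
Proof.
rewrite cos_PI6.
assert (4 / 3 <= sqrt 3); [|lra].
rewrite <- (sqrt_square (4 / 3)) by lra; apply sqrt_le_1_alt; lra.
Qed.

(** The point 1/6 enters through cos(pi/6) = sqrt 3 / 2, and 4 (sqrt 3 / 2) / sqrt(3/2) = 2 sqrt 2
    is the constant of [eta_main]. *)
Lemma eta_main_dual : eta_main tau = (Cexp (tau / 24) * (2 * theta_dual theta_scale (1 / 6) 0))%C.
Proof.
assert (H := Csqrt_neq0 _ Htau).
assert (H32 : RtoC (sqrt (3 / 2)) <> 0) by (intros E; injection E; generalize sqrt32_pos; lra).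
unfold eta_main, theta_dual; rewrite dual_exponent.
replace (odd_freq 0) with 1 by (unfold odd_freq; simpl; ring).
replace (1 * PI * (1 / 6)) with (PI / 6) by field; rewrite cos_PI6.
replace (RtoC (1 * 1) * (zeta2 / tau))%C with (zeta2 / tau)%C by (rewrite Rmult_1_l; ring).
unfold Cminus; rewrite Cexp_plus; unfold theta_scale.
replace (RtoC _) with (RtoC (4 * kappa * (sqrt 3 / 2)) / RtoC (sqrt (3 / 2)))%C.
  rewrite !RtoC_mult, !RtoC_div by lra.
  field; split; auto.
rewrite <- RtoC_div by (generalize sqrt32_pos; lra); f_equal.
replace (sqrt 3) with (sqrt (3 / 2) * sqrt 2).
  field; generalize sqrt32_pos; lra.
rewrite <- sqrt_mult by lra; f_equal; field.
Qed.

Lemma odd_freq_sqr_ge k : 1 + 8 * INR (S k) <= odd_freq (S k) * odd_freq (S k).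
Proof. unfold odd_freq; rewrite S_INR; generalize (pos_INR k); nra. Qed.

Lemma eta_decay_pos : 0 < eta_decay.
Proof.
unfold eta_decay; apply Rdiv_lt_0_compat.
- apply Rmult_lt_0_compat; [apply zeta2_pos | exact Htau].
- generalize tau_neq0; intros H; apply Cmod_gt_0 in H; nra.
Qed.

(** By (2k+1)^2 >= 1 + 8 k the terms with k >= 1 are dominated by a geometric series of ratio x =
    exp(-8 eta_decay) <= 1/2. Relative to the main term without its cosine they sum to at most 2 x,
    and cos(pi/6) >= 2/3 turns the 2 into 3. *)
Lemma theta_dual_sum N : exp (- (8 * eta_decay)) <= 1 / 2 ->
  Rsum (fun k => 2 * Cmod (theta_dual theta_scale (1 / 6) (S k))) N <=
  3 * exp (- (8 * eta_decay)) * Cmod (2 * theta_dual theta_scale (1 / 6) 0).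
Proof.
intros He; set (x := exp (- (8 * eta_decay))) in *.
assert (H := theta_scale_neq0); assert (Hk := kappa_gt).
assert (Hm : 0 < Cmod theta_scale) by (apply Cmod_gt_0, H).
assert (Hd := eta_decay_pos); assert (Hx : 0 < x) by apply exp_pos.
set (A := 2 * kappa / Cmod theta_scale).
assert (HA : 0 < A) by (apply Rdiv_lt_0_compat; lra).
set (e := exp (- eta_decay)); assert (0 < e) by apply exp_pos.
apply Rle_trans with (Rsum (fun k => 2 * A * e * x * x ^ k) N).
- apply Rsum_le; intros k _.
  eapply Rle_trans; [apply Rmult_le_compat_l; [lra | apply Cmod_theta_dual]|].
  fold A; replace (2 * A * e * x * x ^ k) with (2 * (A * (e * x * x ^ k))) by ring.
  do 2 (apply Rmult_le_compat_l; [lra|]).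
  unfold x, e; rewrite <- exp_plus.
  assert (E : exp (- (8 * eta_decay)) ^ k = exp (- (8 * eta_decay) * INR k)).
    clear; induction k as [|k IH]; [simpl; rewrite Rmult_0_r, exp_0; ring|].
    rewrite S_INR; simpl pow; rewrite IH, <- exp_plus; f_equal; ring.
  rewrite E, <- exp_plus; apply exp_le.
  generalize (odd_freq_sqr_ge k); rewrite S_INR; intros Hq.
  apply (Rmult_le_compat_r eta_decay) in Hq; lra.
- rewrite Rsum_scal.
  assert (E : Cmod (2 * theta_dual theta_scale (1 / 6) 0) = 2 * A * cos (PI / 6) * e).
    unfold theta_dual; rewrite dual_exponent, !Cmod_mult, Cmod_div, <- RtoC_mult, !Cmod_R, Cmod_Cexp by exact H.
    rewrite re_opp, re_scal_l, Re_zeta2_div, (Rabs_pos_eq (2 * kappa)), (Rabs_pos_eq 2) by lra.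
    replace (odd_freq 0) with 1 by (unfold odd_freq; simpl; ring).
    replace (1 * PI * (1 / 6)) with (PI / 6) by field.
    rewrite Rabs_pos_eq by (generalize cos_PI6_ge; lra).
    unfold A, e; replace (- (1 * 1 * eta_decay)) with (- eta_decay) by ring; ring.
  rewrite E.
  assert (Hg := Rsum_geom_le x N ltac:(lra)).
  assert (/ (1 - x) <= 2).
    replace 2 with (/ (1 / 2)) by field; apply Rinv_le_contravar; lra.
  assert (Hc := cos_PI6_ge).
  clearbody A e x; assert (HP : 0 < 2 * A * e * x) by (repeat apply Rmult_lt_0_compat; lra).
  apply Rle_trans with (2 * A * e * x * 2).
    apply Rmult_le_compat_l; [lra|]; apply Rle_trans with (1 := Hg); lra.
  replace (3 * x * (2 * A * cos (PI / 6) * e)) with (2 * A * e * x * (3 * cos (PI / 6))) by ring.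
  apply Rmult_le_compat_l; lra.
Qed.

Lemma pent_sum_eta (eps : R) : exp (- (8 * eta_decay)) <= 1 / 2 -> 0 < eps ->
  exists M0, forall M, (M0 <= M)%nat ->
  Cmod (pent_sum (Cexp (- tau)) M - eta_main tau) <= 3 * exp (- (8 * eta_decay)) * Cmod (eta_main tau) + eps.
Proof.
intros He Heps.
set (w := Cmod (Cexp (tau / 24))).
assert (Hw : 0 < w) by (unfold w; rewrite Cmod_Cexp; apply exp_pos).
destruct (theta_inversion theta_scale (1 / 6) theta_scale_sector ltac:(rewrite Rabs_pos_eq; lra) _ (eps / w)
  (fun N => theta_dual_sum N He) ltac:(apply Rdiv_lt_0_compat; lra)) as [M0 HM].
exists M0; intros M HM0; specialize (HM M HM0).
rewrite pent_sum_theta, eta_main_dual.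
replace (_ - _)%C
  with (Cexp (tau / 24) * (theta theta_scale M (1 / 6) - 2 * theta_dual theta_scale (1 / 6) 0))%C by ring.
rewrite (Cmod_mult (Cexp _)), (Cmod_mult (Cexp _)); fold w.
apply (Rmult_le_compat_l w) in HM; [|lra].
replace eps with (w * (eps / w)) by (field; lra); lra.
Qed.
End Eta.

Lemma Cmod_eta_main tau : 0 < Re tau -> Cmod (eta_main tau) =
  2 * sqrt 2 * kappa / sqrt (Cmod tau) * exp (Re tau / 24 - eta_decay tau).
Proof.
intros Ht; assert (Hk := kappa_gt); assert (H2 := sqrt_pos 2).
unfold eta_main; rewrite Cmod_mult, Cmod_div, Cmod_R, Cmod_Cexp by apply (Csqrt_neq0 _ Ht).
rewrite Rabs_pos_eq by (apply Rmult_le_pos; lra).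
f_equal.
- f_equal; rewrite <- (Cmod_Csqrt _ Ht), sqrt_square; auto using Cmod_ge_0.
- unfold Cminus; rewrite re_plus, re_opp, Re_zeta2_div by exact Ht; unfold Rminus; do 2 f_equal.
  replace (tau / 24)%C with (RtoC (/ 24) * tau)%C.
    rewrite re_scal_l; field.
  rewrite RtoC_inv by lra; field.
Qed.

(** For |y| <= 3 t the square of |tau| lies between t^2 and 10 t^2. Together with the 8 in the
    exponent of [theta_dual_sum] the lower bound gives the rate (4/5) zeta2 / t. *)
Lemma eta_decay_bounds (t y : R) : 0 < t -> Rabs y <= 3 * t ->
  zeta2 / (10 * t) <= eta_decay (t, y) <= zeta2 / t.
Proof.
intros Ht Hy; assert (Hz := zeta2_pos); unfold eta_decay; rewrite Cmod_sqr; cbn [Re Im fst snd].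
assert (Hy2 : y * y <= 9 * (t * t)).
  replace (y * y) with (Rabs y * Rabs y) by (rewrite <- Rabs_mult, Rabs_pos_eq; nra).
  generalize (Rabs_pos y); intros; replace (9 * (t * t)) with (3 * t * (3 * t)) by ring.
  apply Rmult_le_compat; assumption.
assert (Ht2 : 0 < t * t) by nra.
assert (Hd : t * t <= t * t + y * y <= 10 * (t * t)) by nra.
split.
- replace (zeta2 / (10 * t)) with (zeta2 * t * / (10 * (t * t))) by (field; lra).
  apply Rmult_le_compat_l; [nra | apply Rinv_le_contravar; lra].
- replace (zeta2 / t) with (zeta2 * t * / (t * t)) by (field; lra).
  apply Rmult_le_compat_l; [nra | apply Rinv_le_contravar; lra].
Qed.

Lemma euler_prod_eta (t eps : R) : 0 < t -> exp (- (4 / 5 * (zeta2 / t))) <= 1 / 2 -> 0 < eps ->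
  exists N0, forall N y, (N0 <= N)%nat -> Rabs y <= 3 * t ->
  Cmod (euler_prod (Cexp (- (t, y))) 0 N - eta_main (t, y)) <=
  (3 * exp (- (4 / 5 * (zeta2 / t))) + eps) * Cmod (eta_main (t, y)).
Proof.
intros Ht He Heps; assert (Hk := kappa_gt).
assert (Hs2 : 0 < sqrt 2) by (apply sqrt_lt_R0; lra).
assert (Hst : 0 < sqrt (4 * t)) by (apply sqrt_lt_R0; lra).
(* A lower bound for |eta_main| on the whole segment, where |tau| <= 4 t: it turns the absolute
   errors of the two approximations into relative ones, uniformly in y. *)
set (V := 2 * sqrt 2 * kappa / sqrt (4 * t) * exp (- (zeta2 / t))).
assert (HV : 0 < V).
  apply Rmult_lt_0_compat; [|apply exp_pos]; apply Rdiv_lt_0_compat; [|lra].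
  apply Rmult_lt_0_compat; lra.
assert (HVy : forall y, Rabs y <= 3 * t -> V <= Cmod (eta_main (t, y))).
  intros y Hy; rewrite Cmod_eta_main by exact Ht; unfold V.
  destruct (eta_decay_bounds t y Ht Hy) as [B1 B2].
  assert (Hm : 0 < Cmod (t, y)) by (apply Cmod_gt_0; intros E; injection E; lra).
  assert (Hm4 : Cmod (t, y) <= 4 * t).
    eapply Rle_trans; [apply Cmod_le_abs|]; cbn [Re Im fst snd]; rewrite (Rabs_pos_eq t); lra.
  apply Rmult_le_compat.
  - apply Rlt_le, Rdiv_lt_0_compat; [apply Rmult_lt_0_compat; lra | lra].
  - apply Rlt_le, exp_pos.
  - apply Rmult_le_compat_l; [apply Rmult_le_pos; lra|].
    apply Rinv_le_contravar; [apply sqrt_lt_R0, Hm | apply sqrt_le_1_alt, Hm4].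
  - apply exp_le; cbn [Re fst]; lra.
assert (Hr : 0 <= exp (- t) < 1).
  split; [apply Rlt_le, exp_pos|]; rewrite <- exp_0; apply exp_increasing; lra.
assert (HeV : 0 < eps * V) by nra.
destruct (euler_prod_pent_uniform (exp (- t)) (eps * V / 2) Hr ltac:(lra)) as [N0 HN].
exists N0; intros N y HN0 Hy.
destruct (eta_decay_bounds t y Ht Hy) as [B1 _].
assert (Hd : exp (- (8 * eta_decay (t, y))) <= exp (- (4 / 5 * (zeta2 / t)))).
  apply exp_le; replace (4 / 5 * (zeta2 / t)) with (8 * (zeta2 / (10 * t))) by (field; lra); lra.
destruct (pent_sum_eta (t, y) Ht (eps * V / 2) ltac:(lra) ltac:(lra)) as [M0 HM].
set (M := Nat.max N M0).
specialize (HM M ltac:(lia)).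
specialize (HN N M (Cexp (- (t, y))) ltac:(lia)).
rewrite Cmod_Cexp in HN; specialize (HN eq_refl).
specialize (HVy y Hy).
replace (_ - _)%C with
 ((euler_prod (Cexp (- (t, y))) 0 N - pent_sum (Cexp (- (t, y))) M) + (pent_sum (Cexp (- (t, y))) M - eta_main (t, y)))%C by ring.
eapply Rle_trans; [apply Cmod_triangle|].
assert (3 * exp (- (8 * eta_decay (t, y))) * Cmod (eta_main (t, y)) <= 3 * exp (- (4 / 5 * (zeta2 / t))) * Cmod (eta_main (t, y))).
  apply Rmult_le_compat_r; lra.
nra.
Qed.

(** * Coefficients of Euler products as Fourier integrals *)

Definition ex_Cderive (f : R -> C) : Prop := forall x, exists l, is_Cderive f x l.

Lemma ex_Cderive_const z : ex_Cderive (fun _ => z).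
Proof. intros x; eexists; apply is_Cderive_const. Qed.

Lemma ex_Cderive_plus f g : ex_Cderive f -> ex_Cderive g -> ex_Cderive (fun x => f x + g x)%C.
Proof. intros Hf Hg x; destruct (Hf x), (Hg x); eexists; apply is_Cderive_plus; eassumption. Qed.

Lemma ex_Cderive_minus f g : ex_Cderive f -> ex_Cderive g -> ex_Cderive (fun x => f x - g x)%C.
Proof. intros Hf Hg x; destruct (Hf x), (Hg x); eexists; apply is_Cderive_minus; eassumption. Qed.

Lemma ex_Cderive_mult f g : ex_Cderive f -> ex_Cderive g -> ex_Cderive (fun x => f x * g x)%C.
Proof. intros Hf Hg x; destruct (Hf x), (Hg x); eexists; apply is_Cderive_mult; eassumption. Qed.

Lemma ex_Cderive_opp f : ex_Cderive f -> ex_Cderive (fun x => - f x)%C.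
Proof. intros Hf x; destruct (Hf x); eexists; apply is_Cderive_opp; eassumption. Qed.

Lemma ex_Cderive_exp f : ex_Cderive f -> ex_Cderive (fun x => Cexp (f x)).
Proof. intros Hf x; destruct (Hf x); eexists; apply is_Cderive_exp; eassumption. Qed.

Lemma ex_Cderive_inv f : ex_Cderive f -> (forall x, f x <> 0) -> ex_Cderive (fun x => / f x)%C.
Proof. intros Hf H0 x; destruct (Hf x); eexists; apply is_Cderive_inv; [eassumption | apply H0]. Qed.

Lemma ex_Cderive_pow f n : ex_Cderive f -> ex_Cderive (fun x => f x ^ n)%C.
Proof.
intros Hf; induction n as [|n IH]; simpl; [apply ex_Cderive_const | apply ex_Cderive_mult; assumption].
Qed.

Lemma is_Cderive_vertical t y : is_Cderive (fun y => (t, y)) y Ci.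
Proof.
split; cbn [Re Im fst snd]; [apply (is_derive_const (V := R_NormedModule)) | apply (is_derive_id (K := R_AbsRing))].
Qed.

Lemma ex_Cderive_vertical t : ex_Cderive (fun y => (t, y)).
Proof. intros y; eexists; apply is_Cderive_vertical. Qed.

Lemma ex_derive_Re f x : ex_Cderive f -> ex_derive (fun x => Re (f x)) x.
Proof. intros Hf; destruct (Hf x) as [l [H _]]; eexists; exact H. Qed.

Lemma ex_Cderive_euler_prod f s n : ex_Cderive f -> ex_Cderive (fun x => euler_prod (f x) s n).
Proof.
intros Hf; induction n as [|n IH]; cbn [euler_prod]; [apply ex_Cderive_const|].
apply ex_Cderive_mult; [exact IH|]; apply ex_Cderive_minus; [apply ex_Cderive_const | apply ex_Cderive_pow, Hf].
Qed.

Fixpoint euler_prod_R (r : R) (n : nat) : R :=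
  match n with O => 1 | S n' => euler_prod_R r n' * (1 - r ^ n) end.

Lemma euler_prod_R_pos r n : 0 <= r < 1 -> 0 < euler_prod_R r n.
Proof.
intros Hr; induction n as [|n IH]; cbn [euler_prod_R]; [lra|].
apply Rmult_lt_0_compat; [exact IH|].
generalize (pow_lt_1_compat r (S n) Hr ltac:(lia)); lra.
Qed.

Lemma Cmod_euler_prod_ge q n : Cmod q < 1 -> euler_prod_R (Cmod q) n <= Cmod (euler_prod q 0 n).
Proof.
intros Hq; assert (H0 := Cmod_ge_0 q); induction n as [|n IH]; cbn [euler_prod euler_prod_R]; [rewrite Cmod_1; lra|].
rewrite Cmod_mult; apply Rmult_le_compat.
- apply Rlt_le, euler_prod_R_pos; lra.
- generalize (pow_lt_1_compat (Cmod q) (S n) (conj H0 Hq) ltac:(lia)); lra.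
- exact IH.
- apply Cmod_one_minus_pow.
Qed.

Lemma euler_prod_neq0 q n : Cmod q < 1 -> euler_prod q 0 n <> 0.
Proof.
intros Hq; apply Cmod_gt_0; apply Rlt_le_trans with (2 := Cmod_euler_prod_ge q n Hq).
apply euler_prod_R_pos; generalize (Cmod_ge_0 q); lra.
Qed.

Lemma euler_prod_split q m n : euler_prod q 0 (m + n) = (euler_prod q 0 m * euler_prod q m n)%C.
Proof.
induction n as [|n IH]; [rewrite Nat.add_0_r; simpl; ring|].
rewrite Nat.add_succ_r; cbn [euler_prod]; rewrite IH, Nat.add_0_l, Nat.add_succ_r; ring.
Qed.

Section Coefficients.
Variable t : R.
Hypothesis Ht : 0 < t.

Definition nome (y : R) : C := Cexp (- (t, y)).

Lemma Cmod_nome y : Cmod (nome y) = exp (- t).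
Proof. unfold nome; rewrite Cmod_Cexp; reflexivity. Qed.

Lemma exp_opp_t : 0 <= exp (- t) < 1.
Proof. split; [apply Rlt_le, exp_pos|]; rewrite <- exp_0; apply exp_increasing; lra. Qed.

Lemma Cmod_nome_lt1 y : Cmod (nome y) < 1.
Proof. rewrite Cmod_nome; apply exp_opp_t. Qed.

Lemma ex_Cderive_nome : ex_Cderive nome.
Proof. apply ex_Cderive_exp, ex_Cderive_opp, ex_Cderive_vertical. Qed.

Definition mean (f : R -> C) : R := RInt (fun y => Re (f y)) (- PI) PI / (2 * PI).

Lemma mean_eq f g : (forall y, f y = g y) -> mean f = mean g.
Proof. intros H; unfold mean; f_equal; apply RInt_eq; intros; rewrite H; reflexivity. Qed.

Lemma ex_RInt_Re f a b : ex_Cderive f -> ex_RInt (fun y => Re (f y)) a b.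
Proof. intros H; apply ex_RInt_derivable; intros; apply ex_derive_Re, H. Qed.

Lemma mean_plus f g : ex_Cderive f -> ex_Cderive g -> mean (fun y => f y + g y)%C = mean f + mean g.
Proof.
intros Hf Hg; unfold mean, Rdiv; rewrite <- Rmult_plus_distr_r; f_equal.
rewrite <- RInt_plus_R by (apply ex_RInt_Re; assumption).
apply RInt_eq; intros; apply re_plus.
Qed.

Lemma mean_scal (a : R) f : ex_Cderive f -> mean (fun y => a * f y)%C = a * mean f.
Proof.
intros Hf; unfold mean, Rdiv; rewrite <- Rmult_assoc; f_equal.
rewrite <- RInt_scal_R by (apply ex_RInt_Re; assumption).
apply RInt_eq; intros; apply re_scal_l.
Qed.

Lemma mean_bound f B : ex_Cderive f -> (forall y, Rabs y <= PI -> Cmod (f y) <= B) -> Rabs (mean f) <= B.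
Proof.
intros Hf HB; assert (HP := PI_RGT_0).
unfold mean, Rdiv; rewrite Rabs_mult, (Rabs_pos_eq (/ _)) by (apply Rlt_le, Rinv_0_lt_compat; lra).
apply (Rmult_le_reg_r (2 * PI)); [lra|]; rewrite Rmult_assoc, Rinv_l, Rmult_1_r by lra.
rewrite Rmult_comm; replace (2 * PI) with (PI - - PI) by ring.
apply abs_RInt_le_const; [lra | apply ex_RInt_Re, Hf |].
intros y Hy; eapply Rle_trans; [apply re_le_Cmod | apply HB, Rabs_le; lra].
Qed.

(** Cauchy's formula on |q| = exp(-t) for the coefficient of q^k in the inverse product. The index
    is an integer so that the shift in [gen_coef_rec] holds without a case distinction; vanishing
    for k < 0 is then a lemma. *)
Definition gen_coef (N : nat) (k : Z) : R :=
  mean (fun y => Cexp (IZR k * (t, y)) / euler_prod (nome y) 0 N)%C.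

Lemma ex_Cderive_gen N k (g : R -> C) : ex_Cderive g ->
  ex_Cderive (fun y => Cexp (IZR k * (t, y)) * g y / euler_prod (nome y) 0 N)%C.
Proof.
intros Hg; apply ex_Cderive_mult.
- apply ex_Cderive_mult; [|exact Hg].
  apply ex_Cderive_exp, ex_Cderive_mult; [apply ex_Cderive_const | apply ex_Cderive_vertical].
- apply ex_Cderive_inv; [apply ex_Cderive_euler_prod, ex_Cderive_nome|].
  intros; apply euler_prod_neq0, Cmod_nome_lt1.
Qed.

Lemma ex_Cderive_gen_coef N k : ex_Cderive (fun y => Cexp (IZR k * (t, y)) / euler_prod (nome y) 0 N)%C.
Proof.
intros y; destruct (ex_Cderive_gen N k _ (ex_Cderive_const 1) y) as [l Hl]; exists l.
eapply is_Cderive_ext; [|exact Hl]; intros; cbv beta; rewrite Cmult_1_r; reflexivity.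
Qed.

Lemma Cexp_nome_pow k n y : (Cexp (IZR k * (t, y)) * nome y ^ n = Cexp (IZR (k - Z.of_nat n) * (t, y)))%C.
Proof.
unfold nome; rewrite <- Cexp_nat, <- Cexp_plus; f_equal.
rewrite minus_IZR, <- INR_IZR_INZ, RtoC_minus; ring.
Qed.

Lemma gen_coef_0 k : gen_coef 0 k = if Z.eq_dec k 0 then 1 else 0.
Proof.
assert (HP := PI_RGT_0); unfold gen_coef, mean; cbn [euler_prod].
destruct (Z.eq_dec k 0) as [->|Hk].
- rewrite (RInt_eq _ (fun _ => 1)).
    rewrite RInt_const_R; field; lra.
  intros y; replace (IZR 0 * (t, y))%C with (RtoC 0) by ring; rewrite Cexp_0.
  replace (1 / 1)%C with (RtoC 1) by field; reflexivity.
- assert (Hk' : IZR k <> 0) by (apply not_0_IZR, Hk).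
  rewrite (RInt_FTC (fun y => exp (IZR k * t) * (sin (IZR k * y) / IZR k))).
  + replace (IZR k * - PI) with (- (IZR k * PI)) by ring; rewrite sin_neg.
    rewrite (sin_eq_0_1 (IZR k * PI)) by (exists k; reflexivity); field; split; lra.
  + intros y _; auto_derive; [auto|].
    replace (_ / _)%C with (Cexp (IZR k * (t, y))) by field.
    rewrite Re_Cexp, re_scal_l, im_scal_l; cbn [Re Im fst snd]; field; exact Hk'.
  + intros y _; apply continuous_derivable, ex_derive_Re.
    exact (ex_Cderive_gen_coef 0 k).
Qed.

Lemma gen_coef_rec N k : gen_coef (S N) k = gen_coef N k + gen_coef (S N) (k - Z.of_nat (S N)).
Proof.
unfold gen_coef; rewrite <- mean_plus by apply ex_Cderive_gen_coef.
apply mean_eq; intros y.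
rewrite <- Cexp_nome_pow; cbn [euler_prod]; rewrite Nat.add_0_l.
generalize (euler_prod_neq0 (nome y) N (Cmod_nome_lt1 y)) (euler_prod_neq0 (nome y) (S N) (Cmod_nome_lt1 y)).
cbn [euler_prod]; rewrite Nat.add_0_l; intros H1 H2.
assert (H3 : (1 - nome y ^ S N)%C <> 0) by (intros E; apply H2; rewrite E; ring).
field; auto.
Qed.

Lemma gen_coef_bound N k : Rabs (gen_coef N k) <= exp (IZR k * t) / euler_prod_R (exp (- t)) N.
Proof.
apply mean_bound; [apply ex_Cderive_gen_coef|]; intros y _.
assert (H := euler_prod_neq0 (nome y) N (Cmod_nome_lt1 y)).
rewrite Cmod_div, Cmod_Cexp, re_scal_l by exact H; cbn [Re fst].
apply Rmult_le_compat_l; [apply Rlt_le, exp_pos|].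
apply Rinv_le_contravar; [apply euler_prod_R_pos, exp_opp_t|].
rewrite <- (Cmod_nome y); apply Cmod_euler_prod_ge, Cmod_nome_lt1.
Qed.

(* Given the case of N, the coefficients for N + 1 have period N + 1 on the
   negative integers, while [gen_coef_bound] makes them decay exponentially. *)
Lemma gen_coef_neg N k : (k < 0)%Z -> gen_coef N k = 0.
Proof.
revert k; induction N as [|N IH]; intros k Hk.
- rewrite gen_coef_0; destruct (Z.eq_dec k 0); [lia | reflexivity].
- assert (Hj : forall j : nat, gen_coef (S N) k = gen_coef (S N) (k - Z.of_nat j * Z.of_nat (S N))).
    induction j as [|j IHj]; [f_equal; lia|].
    rewrite IHj, gen_coef_rec, IH, Rplus_0_l by lia; f_equal; lia.
  destruct (Req_dec (gen_coef (S N) k) 0) as [E|E]; [exact E|exfalso].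
  assert (Ha : 0 < Rabs (gen_coef (S N) k)) by (apply Rabs_pos_lt, E).
  set (D := euler_prod_R (exp (- t)) (S N)).
  assert (HD : 0 < D) by (apply euler_prod_R_pos, exp_opp_t).
  set (a := Rabs (gen_coef (S N) k)) in *.
  destruct (INR_unbounded (/ (a * D * t))) as [j Hjj].
  assert (HaD : 0 < a * D) by (apply Rmult_lt_0_compat; assumption).
  assert (HaDt : 0 < a * D * t) by (apply Rmult_lt_0_compat; assumption).
  assert (Hb := gen_coef_bound (S N) (k - Z.of_nat j * Z.of_nat (S N))).
  rewrite <- Hj in Hb; fold a D in Hb.
  assert (Hb' : a * D <= exp (- (INR j * t))).
    apply Rle_trans with (exp (IZR (k - Z.of_nat j * Z.of_nat (S N)) * t)).
    - apply (Rmult_le_compat_r D) in Hb; [|lra].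
      unfold Rdiv in Hb; rewrite Rmult_assoc, Rinv_l in Hb; lra.
    - apply exp_le; rewrite Ropp_mult_distr_l; apply Rmult_le_compat_r; [lra|].
      rewrite INR_IZR_INZ, <- opp_IZR; apply IZR_le; nia.
  rewrite exp_Ropp in Hb'.
  assert (Hx := exp_ineq1_le (INR j * t)).
  assert (Hp := exp_pos (INR j * t)).
  apply (Rmult_le_compat_r (exp (INR j * t))) in Hb'; [|lra].
  rewrite Rinv_l in Hb' by lra.
  apply Rgt_lt, (Rmult_lt_compat_l (a * D * t)) in Hjj; [|exact HaDt].
  rewrite Rinv_r in Hjj by lra; nra.
Qed.

Lemma gen_coef_unique (P : nat -> nat -> R) :
  P 0%nat 0%nat = 1 -> (forall n, P 0%nat (S n) = 0) ->
  (forall N n, P (S N) n = P N n + if le_dec (S N) n then P (S N) (n - S N)%nat else 0) ->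
  forall N n, P N n = gen_coef N (Z.of_nat n).
Proof.
intros P00 P0S PS; induction N as [|N IH].
- intros n; rewrite gen_coef_0; destruct n as [|n]; simpl; auto.
- intros n; induction n as [n IHn] using lt_wf_ind.
  rewrite PS, gen_coef_rec, IH; f_equal.
  destruct (le_dec (S N) n) as [H|H].
  + rewrite IHn by lia; f_equal; lia.
  + symmetry; apply gen_coef_neg; lia.
Qed.

Fixpoint pent_conv (N : nat) (k : Z) (M : nat) : R :=
  match M with
  | O => gen_coef N k
  | S M' => pent_conv N k M' + (-1) ^ M *
     (gen_coef N (k - Z.of_nat (gpent M' + 2 * M' + 1)) + gen_coef N (k - Z.of_nat (gpent M)))
  end.

Lemma ex_Cderive_pent_sum M : ex_Cderive (fun y => pent_sum (nome y) M).
Proof.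
induction M as [|M IH]; cbn [pent_sum]; [apply ex_Cderive_const|].
apply ex_Cderive_plus; [exact IH|]; apply ex_Cderive_mult; [apply ex_Cderive_const|].
apply ex_Cderive_plus; apply ex_Cderive_pow, ex_Cderive_nome.
Qed.

Lemma pent_conv_mean N k M :
  pent_conv N k M = mean (fun y => Cexp (IZR k * (t, y)) * pent_sum (nome y) M / euler_prod (nome y) 0 N)%C.
Proof.
induction M as [|M IH]; cbn [pent_conv pent_sum].
- apply mean_eq; intros; rewrite Cmult_1_r; reflexivity.
- rewrite IH; unfold gen_coef.
  rewrite <- mean_plus by apply ex_Cderive_gen_coef.
  rewrite <- mean_scal by (apply ex_Cderive_plus; apply ex_Cderive_gen_coef).
  rewrite <- mean_plus.
  + apply mean_eq; intros y; rewrite <- !Cexp_nome_pow; unfold Cdiv; ring.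
  + apply ex_Cderive_gen, ex_Cderive_pent_sum.
  + apply ex_Cderive_mult; [apply ex_Cderive_const|]; apply ex_Cderive_plus; apply ex_Cderive_gen_coef.
Qed.

Lemma mean_Csum (f : nat -> R -> C) n : (forall k, ex_Cderive (f k)) ->
  mean (fun y => Csum (fun k => f k y) n) = Rsum (fun k => mean (f k)) n.
Proof.
intros Hf; assert (Hs : forall n, ex_Cderive (fun y => Csum (fun k => f k y) n)).
  intros m; induction m as [|m IH]; simpl; [apply ex_Cderive_const | apply ex_Cderive_plus; auto].
induction n as [|n IH]; simpl.
- rewrite (mean_eq _ (fun _ => 0 * 0)%C) by (intros; ring).
  rewrite mean_scal by apply ex_Cderive_const; ring.
- rewrite mean_plus, IH; auto.
Qed.

Lemma Csum_scal (a : C) f n : (a * Csum f n = Csum (fun k => a * f k) n)%C.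
Proof. induction n as [|n IH]; simpl; [ring | rewrite <- IH; ring]. Qed.

(** Dividing [shanks] by the product leaves (-1)^s q^(s N + tri s) over the product of length s. For
    s >= 1 all exponents exceed N >= k; for s = 0 the term is the constant 1, which does not
    contribute as k > 0. *)
Lemma pentagonal_recurrence N k : (0 < k <= Z.of_nat N)%Z -> pent_conv N k N = 0.
Proof.
intros Hk; rewrite pent_conv_mean.
rewrite (mean_eq _ (fun y => Csum (fun s => RtoC ((-1) ^ s) *
   (Cexp (IZR (k - Z.of_nat (s * N + tri s)) * (t, y)) / euler_prod (nome y) 0 s)) (S N))%C).
- rewrite (mean_Csum (fun s y => RtoC ((-1) ^ s) *
   (Cexp (IZR (k - Z.of_nat (s * N + tri s)) * (t, y)) / euler_prod (nome y) 0 s))%C).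
  2: { intros s; apply ex_Cderive_mult; [apply ex_Cderive_const | apply ex_Cderive_gen_coef]. }
  rewrite (Rsum_eq _ (fun _ => 0)); [rewrite Rsum_const; ring|].
  intros s Hs; rewrite mean_scal by apply ex_Cderive_gen_coef.
  fold (gen_coef s (k - Z.of_nat (s * N + tri s))).
  destruct s as [|s].
  + rewrite gen_coef_0; destruct (Z.eq_dec _ 0); [simpl in *; lia | ring].
  + rewrite gen_coef_neg; [ring|]; simpl; nia.
- intros y; rewrite shanks.
  unfold Cdiv; rewrite <- (Cmult_assoc _ (Csum _ _)), (Cmult_comm (Csum _ _)), Cmult_assoc, Csum_scal.
  apply Csum_eq; intros s Hs; unfold shanks_term.
  rewrite <- Cexp_nome_pow.
  replace (euler_prod (nome y) 0 N) with (euler_prod (nome y) 0 (s + (N - s))) by (f_equal; lia).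
  rewrite euler_prod_split.
  assert (H1 := euler_prod_neq0 (nome y) s (Cmod_nome_lt1 y)).
  assert (H2 := euler_prod_neq0 (nome y) (s + (N - s)) (Cmod_nome_lt1 y)).
  rewrite euler_prod_split in H2.
  assert (H3 : euler_prod (nome y) s (N - s) <> 0) by (intros E; apply H2; rewrite E; ring).
  field; auto.
Qed.
End Coefficients.

(** * Euler products away from a positive real nome *)

Lemma exp_chord (l A : R) : 0 <= l <= 1 -> exp (l * A) <= 1 + l * (exp A - 1).
Proof.
intros Hl; assert (He := exp_pos (l * A)).
assert (H1 : exp (l * A) * (1 - l * A) <= 1).
  apply Rle_trans with (exp (l * A) * exp (- (l * A))).
    apply Rmult_le_compat_l; [lra|]; generalize (exp_ineq1_le (- (l * A))); lra.
  rewrite <- exp_plus, Rplus_opp_r, exp_0; lra.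
assert (H2 : exp (l * A) * (1 + (1 - l) * A) <= exp A).
  replace (exp A) with (exp (l * A) * exp ((1 - l) * A)) by (rewrite <- exp_plus; f_equal; ring).
  apply Rmult_le_compat_l; [lra|]; apply exp_ineq1_le.
assert (H3 := Rmult_le_compat_l (1 - l) _ _ ltac:(lra) H1).
assert (H4 := Rmult_le_compat_l l _ _ (proj1 Hl) H2).
lra.
Qed.

(** The difference (1 + s) exp(-s) - (1 - s) exp s vanishes at 0 and has the derivative s (exp s -
    exp(-s)) >= 0. *)
Lemma exp_pade (r : R) : 0 <= r -> (1 - r) * exp (2 * r) <= 1 + r.
Proof.
intros Hr.
assert (H : (1 - r) * exp r <= (1 + r) * exp (- r)).
  destruct Hr as [Hr|<-]; [|rewrite Ropp_0, exp_0; lra].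
  destruct (MVT_cor2 (fun s => (1 + s) * exp (- s) - (1 - s) * exp s) (fun s => s * (exp s - exp (- s))) 0 r Hr) as [s [E Hs]].
    intros s _; apply is_derive_Reals; auto_derive; auto; ring.
  rewrite Ropp_0, exp_0 in E.
  assert (exp (- s) <= exp s) by (apply exp_le; lra).
  assert (0 <= s * (exp s - exp (- s))) by (apply Rmult_le_pos; lra).
  nra.
apply (Rmult_le_compat_r (exp r)) in H; [|apply Rlt_le, exp_pos].
rewrite !Rmult_assoc, <- !exp_plus in H.
replace (- r + r) with 0 in H by ring; rewrite exp_0 in H.
replace (2 * r) with (r + r) by ring; lra.
Qed.

(* Keeps only the linear term of log |1 - z|; at z = q^k these terms add up to
   a difference of geometric series. *)
Lemma Cmod_one_minus_ge (z : C) : Cmod z < 1 ->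
  (1 - Cmod z) * exp (Cmod z - Re z) <= Cmod (1 - z).
Proof.
intros Hz; assert (H0 := Cmod_ge_0 z); set (r := Cmod z) in *.
set (y := r - Re z).
assert (Hy : 0 <= y <= 2 * r).
  generalize (re_le_Cmod z) (Rle_abs (Re z)) (Rle_abs (- Re z)); rewrite Rabs_Ropp; fold r; unfold y; lra.
apply (Rsqr_incr_0); [unfold Rsqr | apply Rmult_le_pos; [lra | apply Rlt_le, exp_pos] | apply Cmod_ge_0].
(* After squaring, the right side is linear in y and the left side (1 - r)^2 exp(2 y) is convex. The
   endpoints therefore suffice: y = 0 is an equality, and y = 2 r is the square of [exp_pade]. *)
assert (E : Cmod (1 - z) * Cmod (1 - z) = (1 - r) * (1 - r) + 2 * y).
  rewrite Cmod_sqr; assert (Hs := Cmod_sqr z); fold r in Hs; unfold y.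
  replace (Re (1 - z)) with (1 - Re z) by (unfold Cminus; rewrite re_plus, re_opp, re_RtoC; ring).
  replace (Im (1 - z)) with (- Im z) by (unfold Cminus; rewrite im_plus, im_opp, im_RtoC; ring); lra.
rewrite E.
transitivity ((1 - r) * (1 - r) * exp (2 * y)).
  right; replace (2 * y) with (y + y) by ring; rewrite exp_plus; ring.
destruct H0 as [H0|H0].
- assert (Hc := exp_chord (y / (2 * r)) (4 * r)).
  replace (y / (2 * r) * (4 * r)) with (2 * y) in Hc by (field; lra).
  assert (Hl : 0 <= y / (2 * r) <= 1).
    split; [apply Rmult_le_pos; [lra | apply Rlt_le, Rinv_0_lt_compat; lra]|].
    apply (Rmult_le_reg_r (2 * r)); [lra|]; unfold Rdiv; rewrite Rmult_assoc, Rinv_l; lra.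
  specialize (Hc Hl).
  assert (Hp := exp_pade r ltac:(lra)).
  assert (He := exp_pos (2 * r)).
  assert (Hp2 : (1 - r) * (1 - r) * exp (4 * r) <= (1 + r) * (1 + r)).
    replace (4 * r) with (2 * r + 2 * r) by ring; rewrite exp_plus.
    replace (_ * _) with (((1 - r) * exp (2 * r)) * ((1 - r) * exp (2 * r))) by ring.
    assert (0 <= (1 - r) * exp (2 * r)) by (apply Rmult_le_pos; lra).
    apply Rmult_le_compat; lra.
  apply (Rmult_le_compat_l ((1 - r) * (1 - r))) in Hc; [|nra].
  eapply Rle_trans; [exact Hc|].
  apply (Rmult_le_compat_l (y / (2 * r))) in Hp2; [|lra].
  replace (2 * y) with (y / (2 * r) * (4 * r)) by (field; lra).
  lra.
- assert (y = 0) by lra; rewrite H, Rmult_0_r, exp_0; lra.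
Qed.

Lemma Cmod_euler_prod_minor q n : Cmod q < 1 ->
  euler_prod_R (Cmod q) n * exp (Rsum (fun k => Cmod q ^ S k - Re (q ^ S k)) n) <= Cmod (euler_prod q 0 n).
Proof.
intros Hq; assert (H0 := Cmod_ge_0 q); induction n as [|n IH]; cbn [euler_prod euler_prod_R Rsum].
- rewrite exp_0, Cmod_1; lra.
- rewrite Cmod_mult, exp_plus, Nat.add_0_l.
  assert (Hz : Cmod (q ^ S n) < 1) by (rewrite Cmod_pow; apply pow_lt_1_compat; [lra | lia]).
  assert (Hf := Cmod_one_minus_ge _ Hz); rewrite Cmod_pow in Hf, Hz.
  match goal with |- ?a * ?b * (?c * ?d) <= _ => replace (a * b * (c * d)) with ((a * c) * (b * d)) by ring end.
  apply Rmult_le_compat; auto.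
  + apply Rmult_le_pos; [apply Rlt_le, euler_prod_R_pos; lra | apply Rlt_le, exp_pos].
  + apply Rmult_le_pos; [lra | apply Rlt_le, exp_pos].
Qed.

Lemma Csum_geom q n : (1 - q)%C <> 0 -> Csum (fun k => q ^ S k)%C n = ((1 - q ^ S n) / (1 - q) - 1)%C.
Proof.
intros Hq; induction n as [|n IH]; [simpl; field; exact Hq|].
cbn [Csum]; rewrite IH; simpl; field; exact Hq.
Qed.

Lemma minor_sum_ge q n : Cmod q < 1 ->
  / (1 - Cmod q) - Re (/ (1 - q)) - 2 * Cmod q ^ S n / (1 - Cmod q) <=
  Rsum (fun k => Cmod q ^ S k - Re (q ^ S k)) n.
Proof.
intros Hq; assert (H0 := Cmod_ge_0 q).
assert (Hn : (1 - q)%C <> 0).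
  apply Cmod_gt_0; generalize (proj1 (Cmod_one_minus_pow q 1)); simpl; rewrite Rmult_1_r, Cmult_1_r; lra.
assert (E : Rsum (fun k => Cmod q ^ S k - Re (q ^ S k)) n =
  Rsum (fun k => Cmod q ^ S k) n - Re (Csum (fun k => q ^ S k)%C n)).
  rewrite Re_Csum; clear; induction n as [|n IH]; cbn [Rsum]; [ring | rewrite IH; ring].
assert (E2 : Rsum (fun k => Cmod q ^ S k) n = (1 - Cmod q ^ S n) / (1 - Cmod q) - 1).
  clear E; induction n as [|n IH]; cbn [Rsum]; [simpl; field; lra|].
  rewrite IH; simpl; field; lra.
rewrite E, E2, Csum_geom by exact Hn.
replace ((1 - q ^ S n) / (1 - q) - 1)%C with (/ (1 - q) + - (q ^ S n / (1 - q)) + - (1))%C by (field; exact Hn).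
rewrite !re_plus, !re_opp, re_RtoC.
assert (Hb : Rabs (Re (q ^ S n / (1 - q))) <= Cmod q ^ S n / (1 - Cmod q)).
  eapply Rle_trans; [apply re_le_Cmod|]; rewrite Cmod_div, Cmod_pow by exact Hn.
  apply Rmult_le_compat_l; [apply pow_le, H0|].
  apply Rinv_le_contravar; [lra|].
  generalize (proj1 (Cmod_one_minus_pow q 1)); simpl; rewrite Rmult_1_r, Cmult_1_r; lra.
generalize (Rle_abs (- Re (q ^ S n / (1 - q)))); rewrite Rabs_Ropp.
unfold Rdiv in *; lra.
Qed.

Lemma exp_opp_bounds t : 0 <= t -> 1 - t <= exp (- t) /\ 1 - exp (- t) <= t.
Proof. intros Ht; generalize (exp_ineq1_le (- t)); lra. Qed.

Lemma cos_3t_le t y : 0 < t <= 1 / 30 -> 3 * t <= Rabs y <= PI ->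
  449 / 100 * (t * t) <= 1 - cos y.
Proof.
intros Ht Hy; assert (HP := PI2_3_2).
assert (Hc : cos y <= cos (3 * t)).
  replace (cos y) with (cos (Rabs y)).
    apply cos_decr_1; lra.
  unfold Rabs; destruct (Rcase_abs y); [apply cos_neg | reflexivity].
assert (Hb := cos_bound (3 * t) 0 ltac:(lra) ltac:(lra)).
replace (cos_approx (3 * t) (2 * (0 + 1))) with (1 - (3 * t) ^ 2 / 2 + (3 * t) ^ 4 / 24) in Hb.
  2: { unfold cos_approx, cos_term; simpl; field. }
assert (t * t <= / 900) by nra.
assert (0 < t * t) by nra.
assert ((t * t) * (t * t) <= / 900 * (t * t)) by (apply Rmult_le_compat_r; lra).
lra.
Qed.

(** To first order the difference is 1/t - Re (1 / (t + i y)), which at |y| = 3 t equals (9/10) / t;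
    17/20 leaves room for t up to 1/30. Exactly it is ((2 - d) / d) r w / (d^2 + 2 r w) with r =
    exp(-t), d = 1 - r, w = 1 - cos y, estimated by d <= t and r w >= 4.33 t^2. *)
Lemma minor_gap t y : 0 < t <= 1 / 30 -> 3 * t <= Rabs y <= PI ->
  17 / 20 / t <= / (1 - exp (- t)) - Re (/ (1 - nome t y)).
Proof.
intros Ht Hy; assert (Hw := cos_3t_le t y Ht Hy).
destruct (exp_opp_bounds t ltac:(lra)) as [B1 B2].
set (r := exp (- t)) in *; set (w := 1 - cos y) in *.
assert (Hr1 : r < 1) by (destruct (exp_opp_t t ltac:(lra)); assumption).
assert (Hre : Re (nome t y) = r * (1 - w)).
  unfold nome; rewrite Re_Cexp; simpl; rewrite cos_neg; unfold r, w; ring.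
assert (Hm : Cmod (nome t y) * Cmod (nome t y) = r * r) by (rewrite Cmod_nome; reflexivity).
rewrite Cmod_sqr, Hre in Hm.
set (d := 1 - r) in *.
assert (Hd : 0 < d <= t) by (unfold d; lra).
assert (Ht2 : 0 < t * t) by nra.
assert (Hrw : 433 / 100 * (t * t) <= r * w).
  apply Rle_trans with (29 / 30 * (449 / 100 * (t * t))); [lra|].
  apply Rmult_le_compat; lra.
set (D := d * d + 2 * (r * w)).
assert (HD : 0 < D) by (unfold D; nra).
assert (E : Re (/ (1 - nome t y)) = (d + r * w) / D).
  assert (Hi : 1 - 2 * Re (nome t y) + (Re (nome t y) * Re (nome t y) + Im (nome t y) * Im (nome t y)) = D).
    rewrite Hre, Hm; unfold D, d; ring.
  rewrite Hre in Hi.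
  replace (d + r * w) with (1 - Re (nome t y)) by (rewrite Hre; unfold d; ring).
  destruct (nome t y) as [p s]; simpl in *; rewrite <- Hi, <- Hre; field.
  rewrite <- Hre in Hi; nra.
rewrite E.
assert (E2 : / d - (d + r * w) / D = (2 - d) / d * (r * w / D)).
  unfold D; field_simplify_eq; [ring | split; [|lra]]; unfold D in HD; nra.
rewrite E2.
assert (H1 : 433 / 966 <= r * w / D).
  apply (Rmult_le_reg_r D); [exact HD|]; unfold Rdiv at 2; rewrite Rmult_assoc, Rinv_l by lra.
  unfold D; assert (d * d <= t * t) by nra; lra.
assert (H2 : 59 / 30 / t <= (2 - d) / d).
  apply Rmult_le_compat; try lra.
  - apply Rlt_le, Rinv_0_lt_compat; lra.
  - apply Rinv_le_contravar; lra.
apply Rle_trans with (59 / 30 / t * (433 / 966)).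
- unfold Rdiv; assert (0 < / t) by (apply Rinv_0_lt_compat; lra); lra.
- apply Rmult_le_compat; try lra.
  apply Rlt_le, Rdiv_lt_0_compat; lra.
Qed.

Lemma Cmod_t0 t : 0 < t -> Cmod (t, 0) = t.
Proof. intros Ht; change (t, 0) with (RtoC t); rewrite Cmod_R; apply Rabs_pos_eq; lra. Qed.

Lemma Cmod_eta_main_t0 t : 0 < t ->
  Cmod (eta_main (t, 0)) = 2 * sqrt 2 * kappa / sqrt t * exp (t / 24 - zeta2 / t).
Proof.
intros Ht; rewrite Cmod_eta_main by exact Ht; unfold eta_decay; rewrite Cmod_t0 by exact Ht.
cbn [Re fst]; do 3 f_equal; field; lra.
Qed.

Lemma euler_prod_R_Cmod r n : 0 <= r < 1 -> euler_prod_R r n = Cmod (euler_prod (RtoC r) 0 n).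
Proof.
intros Hr; induction n as [|n IH]; cbn [euler_prod euler_prod_R]; [rewrite Cmod_1; reflexivity|].
rewrite Cmod_mult, IH; f_equal.
rewrite Nat.add_0_l, <- RtoC_pow, <- RtoC_minus, Cmod_R, Rabs_pos_eq; [reflexivity|].
generalize (pow_lt_1_compat r (S n) Hr ltac:(lia)); lra.
Qed.

(** The product at the real nome exp(-t), which by [euler_prod_eta] at y = 0 is at least half of
    |eta_main|, is multiplied by the exponential of the gain in [minor_gap]. *)
Lemma minor_arc t : 0 < t <= 1 / 30 -> 3 * exp (- (4 / 5 * (zeta2 / t))) <= 1 / 4 ->
  exists N0, forall N y, (N0 <= N)%nat -> 3 * t <= Rabs y <= PI ->
  / Cmod (euler_prod (nome t y) 0 N) <= sqrt t / kappa * exp (zeta2 / t - 17 / 20 / t).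
Proof.
intros Ht He; assert (Hk := kappa_gt); assert (Hst : 0 < sqrt t) by (apply sqrt_lt_R0; lra).
destruct (euler_prod_eta t (1 / 4) ltac:(lra) ltac:(lra) ltac:(lra)) as [N1 HN1].
destruct (exp_opp_t t ltac:(lra)) as [Hr0 Hr1].
set (r := exp (- t)) in *.
assert (Hd : 0 < (1 - r) / 8) by lra.
destruct (pow_lt_1_zero r ltac:(rewrite Rabs_pos_eq; lra) _ Hd) as [N2 HN2].
exists (Nat.max N1 N2); intros N y HN Hy.
specialize (HN1 N 0 ltac:(lia) ltac:(rewrite Rabs_R0; lra)).
specialize (HN2 (S N) ltac:(lia)); rewrite Rabs_pos_eq in HN2 by (apply pow_le; lra).
assert (Hq : Cmod (nome t y) = r) by apply Cmod_nome.
assert (G1 := Cmod_euler_prod_minor (nome t y) N ltac:(lra)).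
assert (G2 := minor_sum_ge (nome t y) N ltac:(lra)).
assert (G3 := minor_gap t y Ht Hy).
rewrite Hq in G1, G2; fold r in G3.
assert (Hsmall : 2 * r ^ S N / (1 - r) <= 1 / 4).
  apply (Rmult_le_reg_r (1 - r)); [lra|]; unfold Rdiv at 1; rewrite Rmult_assoc, Rinv_l; lra.
set (S := Rsum (fun k => r ^ Datatypes.S k - Re (nome t y ^ Datatypes.S k)) N) in *.
assert (HE : nome t 0 = RtoC r).
  unfold nome, r; rewrite <- Cexp_RtoC; f_equal; apply Ceq; simpl; ring.
assert (HV : Cmod (eta_main (t, 0)) / 2 <= euler_prod_R r N).
  rewrite euler_prod_R_Cmod, <- HE by lra; unfold nome.
  generalize (Cmod_triangle_rev (eta_main (t, 0)) (eta_main (t, 0) - euler_prod (Cexp (- (t, 0))) 0 N)).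
  replace (eta_main (t, 0) - (eta_main (t, 0) - euler_prod (Cexp (- (t, 0))) 0 N))%C
    with (euler_prod (Cexp (- (t, 0))) 0 N) by ring.
  replace (_ - _)%C
    with (- (euler_prod (Cexp (- (t, 0))) 0 N - eta_main (t, 0)))%C by ring.
  rewrite Cmod_opp; generalize (Cmod_ge_0 (eta_main (t, 0))); nra.
rewrite Cmod_eta_main_t0 in HV by lra.
(* The sqrt 2 that remains after halving [eta_main] pays for exp(1/4), the loss from truncating the
   geometric series. *)
assert (Hs2 : 7 / 5 <= sqrt 2).
  rewrite <- (sqrt_square (7 / 5)) by lra; apply sqrt_le_1_alt; lra.
assert (HV2 : 7 / 5 * kappa / sqrt t * exp (- (zeta2 / t)) <= euler_prod_R r N).
  eapply Rle_trans; [|exact HV].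
  replace (2 * sqrt 2 * kappa / sqrt t * exp (t / 24 - zeta2 / t) / 2) with
    (sqrt 2 * kappa / sqrt t * exp (t / 24 - zeta2 / t)) by (field; lra).
  apply Rmult_le_compat.
  - apply Rlt_le, Rdiv_lt_0_compat; lra.
  - apply Rlt_le, exp_pos.
  - apply Rmult_le_compat_r; [apply Rlt_le, Rinv_0_lt_compat; lra | nra].
  - apply exp_le; lra.
assert (He4 : exp (1 / 4) <= 7 / 5).
  assert (H4 := exp_ineq1_le (- (1 / 4))); rewrite exp_Ropp in H4.
  assert (H5 := exp_pos (1 / 4)).
  apply (Rmult_le_compat_r (exp (1 / 4))) in H4; [|lra]; rewrite Rinv_l in H4; lra.
assert (G4 : kappa / sqrt t * exp (17 / 20 / t - zeta2 / t) <= Cmod (euler_prod (nome t y) 0 N)).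
  eapply Rle_trans; [|exact G1].
  apply Rle_trans with (7 / 5 * kappa / sqrt t * exp (- (zeta2 / t)) * exp (17 / 20 / t - 1 / 4)).
  - replace (exp _) with (exp (1 / 4) * exp (- (zeta2 / t)) * exp (17 / 20 / t - 1 / 4)).
    2: { rewrite <- !exp_plus; f_equal; ring. }
    replace (_ * _)
      with (exp (1 / 4) * (kappa / sqrt t * exp (- (zeta2 / t)) * exp (17 / 20 / t - 1 / 4))) by ring.
    replace (7 / 5 * kappa / sqrt t * exp (- (zeta2 / t)) * exp (17 / 20 / t - 1 / 4))
      with (7 / 5 * (kappa / sqrt t * exp (- (zeta2 / t)) * exp (17 / 20 / t - 1 / 4))) by (unfold Rdiv; ring).
    apply Rmult_le_compat_r; [|exact He4].
    repeat apply Rmult_le_pos; try (apply Rlt_le, exp_pos); [lra | apply Rlt_le, Rinv_0_lt_compat; lra].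
  - apply Rmult_le_compat; [|apply Rlt_le, exp_pos|exact HV2|apply exp_le; lra].
    apply Rmult_le_pos; [|apply Rlt_le, exp_pos].
    apply Rlt_le, Rdiv_lt_0_compat; lra.
replace (_ * _) with (/ (kappa / sqrt t * exp (17 / 20 / t - zeta2 / t))).
- apply Rinv_le_contravar; [|exact G4].
  apply Rmult_lt_0_compat; [apply Rdiv_lt_0_compat; lra | apply exp_pos].
- replace (zeta2 / t - 17 / 20 / t) with (- (17 / 20 / t - zeta2 / t)) by ring.
  rewrite exp_Ropp; field; repeat split; try lra; apply Rgt_not_eq, exp_pos.
Qed.

(** * The main term in closed form *)

Lemma Csqrt_conj z : 0 < Re z -> Csqrt (Cconj z) = Cconj (Csqrt z).
Proof.
intros Hz; assert (H := Csqrt_re_pos _ Hz).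
assert (E : Csqrt_re (Cconj z) = Csqrt_re z) by (unfold Csqrt_re; rewrite Cmod_conj; reflexivity).
unfold Csqrt; rewrite E, im_conj; apply Ceq; [reflexivity | unfold Cconj; cbn [Im snd]; field; lra].
Qed.

Lemma Cconj_plus z w : Cconj (z + w) = (Cconj z + Cconj w)%C.
Proof. apply Ceq; simpl; ring. Qed.

Section MainIntegral.
Variables x t : R.
Hypothesis Hx : 0 < x.
Hypothesis Ht : 0 < t.
Hypothesis Hxt : x * (t * t) = zeta2.

Notation tau y := ((t, y%R) : C).
Notation root y := (Csqrt (t, y%R)).

Definition saddle_exp (y : R) : C := Cexp (zeta2 / tau y + x * tau y).
Definition main_integrand (y : R) : C := (root y * saddle_exp y)%C.
(* zeta2 / tau + x tau = u^2 - 2 sg x t for u = saddle_var sg, because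
   zeta2 = x t^2; this reduces the integral to the Gaussian one. *)
Definition saddle_var (sg : R) (y : R) : C := (sqrt x * (root y + RtoC (sg * t) / root y))%C.

(** Differentiating sqrt(tau) exp(zeta2/tau + x tau) leaves, besides the wanted integrand, terms in
    tau^(-1/2) and tau^(-3/2). These are combinations of the derivatives of the two [saddle_var], so
    each is a Gaussian integral, and the coefficients solve the resulting linear system. The factor
    i in the argument of [Gauss] turns exp(-z^2) into exp(u^2). *)
Definition saddle_prim (y : R) : C :=
  (root y * saddle_exp y
   + RtoC ((sqrt x * t - / (2 * sqrt x)) * exp (2 * (x * t))) * (- Ci * Gauss (Ci * saddle_var (-1) y))
   - RtoC ((sqrt x * t + / (2 * sqrt x)) * exp (- (2 * (x * t)))) * (- Ci * Gauss (Ci * saddle_var 1 y)))%C.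

Lemma vertical_neq0 y : tau y <> 0.
Proof. intros E; injection E; lra. Qed.

Lemma root_neq0 y : root y <> 0.
Proof. apply Csqrt_neq0; exact Ht. Qed.

Lemma root_sqr y : (root y * root y = tau y)%C.
Proof. apply Csqrt_sqr; exact Ht. Qed.

Lemma sqrtx_pos : 0 < sqrt x.
Proof. apply sqrt_lt_R0, Hx. Qed.

Lemma sqrtx_sqr : (RtoC (sqrt x) * RtoC (sqrt x) = RtoC x)%C.
Proof. rewrite <- RtoC_mult, sqrt_sqrt by lra; reflexivity. Qed.

Lemma zeta2_C : (RtoC zeta2 = x * t * t)%C.
Proof. rewrite <- Hxt, !RtoC_mult; ring. Qed.

Lemma is_Cderive_saddle_exp y :
  is_Cderive saddle_exp y (saddle_exp y * (Ci * (x - zeta2 / (tau y * tau y))))%C.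
Proof.
assert (H0 := vertical_neq0 y).
eapply is_Cderive_eq.
- apply is_Cderive_exp, is_Cderive_plus; apply is_Cderive_scal.
  + apply is_Cderive_inv; [apply is_Cderive_vertical | exact H0].
  + apply is_Cderive_vertical.
- cbv beta; unfold saddle_exp; f_equal; field; exact H0.
Qed.

Lemma is_Cderive_saddle_var sg y :
  is_Cderive (saddle_var sg) y (sqrt x * (Ci / (2 * root y) * (1 - RtoC (sg * t) / tau y)))%C.
Proof.
assert (H0 := root_neq0 y).
eapply is_Cderive_eq.
- apply is_Cderive_scal, is_Cderive_plus; [apply is_Cderive_Csqrt, Ht|].
  apply is_Cderive_scal, is_Cderive_inv; [apply is_Cderive_Csqrt, Ht | exact H0].
- cbv beta; assert (E := root_sqr y); set (r := Csqrt (t, y)) in *; rewrite <- E; field; exact H0.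
Qed.

Lemma saddle_var_sqr sg y : sg * sg = 1 ->
  (saddle_var sg y * saddle_var sg y = zeta2 / tau y + x * tau y + RtoC (2 * sg * (x * t)))%C.
Proof.
intros Hs; assert (H0 := root_neq0 y); unfold saddle_var.
assert (E := root_sqr y); set (r := Csqrt (t, y)) in *; rewrite zeta2_C, <- E, !RtoC_mult.
transitivity (RtoC (sqrt x) * RtoC (sqrt x) * (r * r + 2 * sg * t + RtoC sg * RtoC sg * t * t / (r * r)))%C.
  field; exact H0.
rewrite sqrtx_sqr, <- (RtoC_mult sg sg), Hs; field; exact H0.
Qed.

Lemma is_Cderive_Gauss_saddle sg y : sg * sg = 1 ->
  is_Cderive (fun y => - Ci * Gauss (Ci * saddle_var sg y))%C y
   (saddle_exp y * RtoC (exp (2 * sg * (x * t))) * (sqrt x * (Ci / (2 * root y) * (1 - RtoC (sg * t) / tau y))))%C.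
Proof.
intros Hs; eapply is_Cderive_eq.
- apply is_Cderive_scal, is_Cderive_Gauss, is_Cderive_scal, is_Cderive_saddle_var.
- cbv beta.
  assert (Hi : (Ci * Ci = - (1))%C) by (apply Ceq; simpl; ring).
  replace (- (Ci * saddle_var sg y * (Ci * saddle_var sg y)))%C with (saddle_var sg y * saddle_var sg y)%C.
  2: { transitivity (- (Ci * Ci) * (saddle_var sg y * saddle_var sg y))%C; [rewrite Hi; ring | ring]. }
  rewrite saddle_var_sqr by exact Hs.
  rewrite Cexp_plus, Cexp_RtoC; fold (saddle_exp y).
  transitivity (- (Ci * Ci) * (saddle_exp y * RtoC (exp (2 * sg * (x * t))) * (sqrt x * (Ci / (2 * root y) * (1 - RtoC (sg * t) / tau y)))))%C.
    ring.
  rewrite Hi; ring.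
Qed.

Lemma is_Cderive_saddle_prim y : is_Cderive saddle_prim y (Ci * x * main_integrand y)%C.
Proof.
assert (H0 := root_neq0 y); assert (Hs := sqrtx_pos).
assert (Hs0 : RtoC (sqrt x) <> 0) by (intros E; injection E; lra).
eapply is_Cderive_eq.
- apply is_Cderive_minus; [apply is_Cderive_plus|].
  + apply is_Cderive_mult; [apply is_Cderive_Csqrt, Ht | apply is_Cderive_saddle_exp].
  + apply is_Cderive_scal, is_Cderive_Gauss_saddle; ring.
  + apply is_Cderive_scal, is_Cderive_Gauss_saddle; ring.
- cbv beta; unfold main_integrand; set (e := saddle_exp y).
  assert (E1 : (RtoC (exp (2 * (x * t))) * RtoC (exp (2 * -1 * (x * t))) = 1)%C).
    rewrite <- RtoC_mult, <- exp_plus; replace (_ + _) with 0 by ring; rewrite exp_0; reflexivity.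
  assert (E2 : (RtoC (exp (- (2 * (x * t)))) * RtoC (exp (2 * 1 * (x * t))) = 1)%C).
    rewrite <- RtoC_mult, <- exp_plus; replace (_ + _) with 0 by ring; rewrite exp_0; reflexivity.
  assert (E := root_sqr y); set (r := Csqrt (t, y)) in *; rewrite zeta2_C, <- !E.
  rewrite (RtoC_mult _ (exp (2 * (x * t)))), (RtoC_mult _ (exp (- (2 * (x * t))))).
  transitivity (Ci / (2 * r) * e + r * (e * (Ci * (x - x * t * t / (r * r * (r * r)))))
    + RtoC (sqrt x * t - / (2 * sqrt x)) * (RtoC (exp (2 * (x * t))) * RtoC (exp (2 * -1 * (x * t)))) *
       (e * (sqrt x * (Ci / (2 * r) * (1 - RtoC (-1 * t) / (r * r)))))
    - RtoC (sqrt x * t + / (2 * sqrt x)) * (RtoC (exp (- (2 * (x * t)))) * RtoC (exp (2 * 1 * (x * t)))) *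
       (e * (sqrt x * (Ci / (2 * r) * (1 - RtoC (1 * t) / (r * r))))))%C.
    ring.
  rewrite E1, E2, RtoC_minus, RtoC_plus, RtoC_inv, !RtoC_mult by lra.
  replace (RtoC (-1)) with (- RtoC 1)%C by (rewrite <- RtoC_opp; f_equal; ring).
  rewrite <- sqrtx_sqr; field; split; assumption.
Qed.

Lemma RInt_main Y : RInt (fun y => Re (main_integrand y)) (- Y) Y =
  (Im (saddle_prim Y) - Im (saddle_prim (- Y))) / x.
Proof.
eqR; rewrite (RInt_FTC (fun y => Im (saddle_prim y) / x)).
- field; lra.
- intros y _; destruct (is_Cderive_saddle_prim y) as [_ H].
  replace (Im _) with (x * Re (main_integrand y)) in H.
  2: { generalize (main_integrand y); intros z; destruct z; simpl; ring. }
  eapply is_derive_ext; [|eapply is_derive_eq; [exact (is_derive_Rmult (fun _ => / x) _ _ _ _ (is_derive_const (V := R_NormedModule) _ _) H)|]].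
  + intros u; simpl; unfold Rdiv; ring.
  + transitivity (0 * Im (saddle_prim y) + / x * (x * Re (main_integrand y))); [reflexivity | field; lra].
- intros y _; apply continuous_derivable.
  destruct (is_Cderive_saddle_exp y) as [_ _].
  apply (ex_derive_Re main_integrand); intros u; eexists; apply is_Cderive_mult;
    [apply is_Cderive_Csqrt, Ht | apply is_Cderive_saddle_exp].
Qed.

Lemma tau_opp y : tau (- y) = Cconj (tau y).
Proof. reflexivity. Qed.

Lemma Cconj_RtoC (r : R) : Cconj (RtoC r) = RtoC r.
Proof. apply Ceq; simpl; ring. Qed.

Lemma Cconj_Ci : Cconj Ci = (- Ci)%C.
Proof. apply Ceq; simpl; ring. Qed.

Lemma saddle_exp_conj y : saddle_exp (- y) = Cconj (saddle_exp y).
Proof.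
unfold saddle_exp; rewrite tau_opp, <- Cexp_conj; f_equal.
unfold Cdiv; rewrite Cconj_plus, !Cmult_conj, !Cconj_RtoC, Cinv_conj by apply vertical_neq0; reflexivity.
Qed.

Lemma saddle_var_conj sg y : saddle_var sg (- y) = Cconj (saddle_var sg y).
Proof.
unfold saddle_var; rewrite tau_opp, Csqrt_conj by exact Ht.
unfold Cdiv; rewrite !Cmult_conj, Cconj_plus, Cmult_conj, !Cconj_RtoC, Cinv_conj by apply root_neq0; reflexivity.
Qed.

Lemma Gauss_saddle_conj sg y :
  (- Ci * Gauss (Ci * saddle_var sg (- y)))%C = Cconj (- Ci * Gauss (Ci * saddle_var sg y)).
Proof.
rewrite saddle_var_conj.
replace (Ci * Cconj (saddle_var sg y))%C with (- Cconj (Ci * saddle_var sg y))%C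
  by (rewrite Cmult_conj, Cconj_Ci; ring).
rewrite Gauss_opp, Gauss_conj, Cmult_conj.
replace (Cconj (- Ci)) with Ci by (apply Ceq; simpl; ring); ring.
Qed.

Lemma Im_saddle_prim_opp Y : Im (saddle_prim (- Y)) = - Im (saddle_prim Y).
Proof.
unfold saddle_prim; rewrite !Gauss_saddle_conj, saddle_exp_conj, tau_opp, Csqrt_conj by exact Ht.
rewrite <- Cmult_conj; unfold Cminus; rewrite !im_plus, !im_opp, !im_scal_l, !im_conj; ring.
Qed.

Lemma Im_Gauss_saddle sg y :
  Im (- Ci * Gauss (Ci * saddle_var sg y)) = Re (Gauss (- (Ci * saddle_var sg y))).
Proof.
rewrite Gauss_opp; generalize (Gauss (Ci * saddle_var sg y)); intros [p q]; simpl; ring.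
Qed.

Let p := x * t.

Lemma Cmod_tau_3t : 3 * t <= Cmod (tau (3 * t)) <= 4 * t.
Proof.
split.
- eapply Rle_trans; [|apply im_le_Cmod]; cbn [Im snd]; apply Rle_abs.
- eapply Rle_trans; [apply Cmod_le_abs|]; cbn [Re Im fst snd]; rewrite !Rabs_pos_eq; lra.
Qed.

Lemma Cmod_Csqrt_3t : sqrt t <= Cmod (root (3 * t)) <= 2 * sqrt t.
Proof.
destruct Cmod_tau_3t as [H1 H2].
assert (E := Cmod_Csqrt (tau (3 * t)) Ht); assert (Hp := Cmod_ge_0 (root (3 * t))).
assert (Hst := sqrt_sqrt t ltac:(lra)); assert (H0 := sqrt_pos t).
split; apply Rsqr_incr_0; unfold Rsqr; lra || nra.
Qed.

(** At y = 3 t, |tau|^2 = 10 t^2, so zeta2/tau contributes p/10 and x tau contributes p. At the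
    saddle point y = 0 the value is 2 p. *)
Lemma Re_saddle_3t : Re (zeta2 / tau (3 * t) + x * tau (3 * t))%C = 11 / 10 * p.
Proof.
rewrite re_plus, Re_zeta2_div, re_scal_l by exact Ht; unfold eta_decay; rewrite Cmod_sqr.
cbn [Re Im fst snd]; rewrite <- Hxt; unfold p; field; nra.
Qed.

Lemma Cmod_saddle_var sg : Rabs sg = 1 -> Cmod (saddle_var sg (3 * t)) <= 3 * sqrt p.
Proof.
intros Hs; destruct Cmod_Csqrt_3t as [H1 H2].
assert (Hst : 0 < sqrt t) by (apply sqrt_lt_R0, Ht).
assert (Hsx := sqrtx_pos).
unfold saddle_var, p; rewrite sqrt_mult, Cmod_mult, Cmod_R, Rabs_pos_eq by lra.
replace (3 * (sqrt x * sqrt t)) with (sqrt x * (3 * sqrt t)) by ring.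
apply Rmult_le_compat_l; [lra|].
eapply Rle_trans; [apply Cmod_triangle|].
rewrite Cmod_div, Cmod_R, Rabs_mult, Hs, Rmult_1_l, (Rabs_pos_eq t) by (lra || apply root_neq0).
assert (t / Cmod (root (3 * t)) <= sqrt t).
  apply (Rmult_le_reg_r (Cmod (root (3 * t)))); [lra|].
  unfold Rdiv; rewrite Rmult_assoc, Rinv_l, Rmult_1_r by lra.
  rewrite <- (sqrt_sqrt t) at 1 by lra; apply Rmult_le_compat_l; lra.
lra.
Qed.

Lemma Im_saddle_var_pos : 0 < Im (saddle_var (-1) (3 * t)).
Proof.
set (r := root (3 * t)).
assert (Hi : 0 < Im r).
  unfold r, Csqrt; cbn [Im snd]; apply Rdiv_lt_0_compat; [lra|].
  generalize (Csqrt_re_pos (tau (3 * t)) Ht); lra.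
unfold saddle_var; fold r; rewrite im_scal_l; apply Rmult_lt_0_compat; [apply sqrtx_pos|].
rewrite im_plus; unfold Cdiv; rewrite im_scal_l.
destruct r as [u v]; simpl in *.
assert (0 < u * (u * 1) + v * (v * 1)) by nra.
assert (0 < v / (u * (u * 1) + v * (v * 1))) by (apply Rdiv_lt_0_compat; lra).
replace (_ * _) with (t * (v / (u * (u * 1) + v * (v * 1)))) by (field; lra).
nra.
Qed.

Lemma saddle_diff sg : sg * sg = 1 ->
  let w := (- (Ci * saddle_var sg (3 * t)))%C in
  Im w * Im w - Re w * Re w = 11 / 10 * p + 2 * sg * p.
Proof.
intros Hs w; assert (E := saddle_var_sqr sg (3 * t) Hs).
apply (f_equal Re) in E; rewrite (re_plus _ (RtoC _)), Re_saddle_3t, re_RtoC in E.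
unfold p in *; rewrite <- Rmult_assoc; rewrite <- Rmult_assoc in E; rewrite <- E; unfold w.
generalize (saddle_var sg (3 * t)); intros [u v]; simpl; ring.
Qed.

(** All three errors have the size exp(11/10 p): the boundary term itself; exp(2 p) exp(-9/10 p)
    from replacing [Gauss] by [kappa] for the sign -1; and exp(-2 p) exp(31/10 p) for the sign 1,
    where [Gauss] is merely bounded. *)
Lemma main_integral_bound : 2 <= p ->
  Rabs (RInt (fun y => Re (main_integrand y)) (- (3 * t)) (3 * t)
        - 2 / x * (kappa * (sqrt x * t - / (2 * sqrt x)) * exp (2 * p)))
  <= 2 / x * (exp (11 / 10 * p) * (2 * sqrt t + sqrt x * t * (6 * sqrt p + 1) + (sqrt x * t + / (2 * sqrt x)) * (9 * sqrt p))).
Proof.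
intros Hp; assert (Hsx := sqrtx_pos); assert (Hsp := sqrt_pos p).
assert (Hix : 0 < / (2 * sqrt x)) by (apply Rinv_0_lt_compat; lra).
rewrite RInt_main, Im_saddle_prim_opp.
set (w := (- (Ci * saddle_var (-1) (3 * t)))%C); set (w' := (- (Ci * saddle_var 1 (3 * t)))%C).
assert (Dw : Im w * Im w - Re w * Re w = - (9 / 10 * p)).
  unfold w; rewrite (saddle_diff (-1)) by ring; field.
assert (Dw' : Im w' * Im w' - Re w' * Re w' = 31 / 10 * p).
  unfold w'; rewrite (saddle_diff 1) by ring; field.
assert (Cw : Cmod w <= 3 * sqrt p).
  unfold w; rewrite Cmod_opp, Cmod_mult, Cmod_Ci, Rmult_1_l; apply Cmod_saddle_var; rewrite Rabs_left; lra.
assert (Cw' : Cmod w' <= 3 * sqrt p).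
  unfold w'; rewrite Cmod_opp, Cmod_mult, Cmod_Ci, Rmult_1_l; apply Cmod_saddle_var; rewrite Rabs_pos_eq; lra.
assert (Pw : 1 <= Re w).
  assert (Hw : 0 < Re w).
    replace (Re w) with (Im (saddle_var (-1) (3 * t))); [apply Im_saddle_var_pos|].
    unfold w; generalize (saddle_var (-1) (3 * t)); intros [u v]; simpl; ring.
  nra.
assert (K1 : Rabs (Re (Gauss w) - kappa) <= (6 * sqrt p + 1) * exp (- (9 / 10 * p))).
  replace (Re (Gauss w) - kappa) with (Re (Gauss w - kappa)) by (unfold Cminus; rewrite re_plus, re_opp, re_RtoC; ring).
  eapply Rle_trans; [apply re_le_Cmod|]; eapply Rle_trans; [apply Gauss_kappa_bound, Pw|].
  rewrite Dw; apply Rmult_le_compat_r; [apply Rlt_le, exp_pos|].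
  generalize (im_le_Cmod w); lra.
assert (K2 : exp (- (2 * p)) * Rabs (Re (Gauss w')) <= 9 * sqrt p * exp (11 / 10 * p)).
  apply Rle_trans with (exp (- (2 * p)) * (3 * sqrt p * (1 + 2 * exp (31 / 10 * p)))).
    apply Rmult_le_compat_l; [apply Rlt_le, exp_pos|].
    eapply Rle_trans; [apply re_le_Cmod|]; eapply Rle_trans; [apply Gauss_bound|]; rewrite Dw'.
    apply Rmult_le_compat_r; [|exact Cw'].
    generalize (exp_pos (31 / 10 * p)); lra.
  assert (1 <= exp (31 / 10 * p)) by (rewrite <- exp_0; apply exp_le; lra).
  apply Rle_trans with (exp (- (2 * p)) * (9 * sqrt p * exp (31 / 10 * p))).
    apply Rmult_le_compat_l; [apply Rlt_le, exp_pos|]; nra.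
  replace (11 / 10 * p) with (- (2 * p) + 31 / 10 * p) by field; rewrite exp_plus; right; ring.
assert (K3 : Rabs (Im (root (3 * t) * saddle_exp (3 * t))) <= 2 * sqrt t * exp (11 / 10 * p)).
  eapply Rle_trans; [apply im_le_Cmod|]; rewrite Cmod_mult; unfold saddle_exp; rewrite Cmod_Cexp, Re_saddle_3t.
  apply Rmult_le_compat_r; [apply Rlt_le, exp_pos | apply Cmod_Csqrt_3t].
assert (E : Im (saddle_prim (3 * t)) = Im (root (3 * t) * saddle_exp (3 * t))
  + (sqrt x * t - / (2 * sqrt x)) * exp (2 * p) * Re (Gauss w)
  - (sqrt x * t + / (2 * sqrt x)) * exp (- (2 * p)) * Re (Gauss w')).
  unfold saddle_prim, Cminus; rewrite !im_plus, im_opp, !im_scal_l, !Im_Gauss_saddle; reflexivity.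
rewrite E.
set (a0 := Im (root (3 * t) * saddle_exp (3 * t))) in *.
replace ((a0 + (sqrt x * t - / (2 * sqrt x)) * exp (2 * p) * Re (Gauss w) -
  (sqrt x * t + / (2 * sqrt x)) * exp (- (2 * p)) * Re (Gauss w') -
  - (a0 + (sqrt x * t - / (2 * sqrt x)) * exp (2 * p) * Re (Gauss w) -
     (sqrt x * t + / (2 * sqrt x)) * exp (- (2 * p)) * Re (Gauss w'))) / x -
 2 / x * (kappa * (sqrt x * t - / (2 * sqrt x)) * exp (2 * p)))
 with (2 / x * (a0 + (sqrt x * t - / (2 * sqrt x)) * (exp (2 * p) * (Re (Gauss w) - kappa))
   + - ((sqrt x * t + / (2 * sqrt x)) * (exp (- (2 * p)) * Re (Gauss w'))))) by (field; lra).
assert (H2x : 0 < 2 / x) by (apply Rdiv_lt_0_compat; lra).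
rewrite Rabs_mult, (Rabs_pos_eq (2 / x)) by lra.
apply Rmult_le_compat_l; [lra|].
assert (Hxt1 : / (2 * sqrt x) <= sqrt x * t).
  apply (Rmult_le_reg_r (2 * sqrt x)); [lra|]; rewrite Rinv_l by lra.
  replace (_ * _) with (2 * (sqrt x * sqrt x * t)) by ring.
  rewrite sqrt_sqrt by lra; fold p; lra.
eapply Rle_trans; [apply Rabs_triang|]; eapply Rle_trans; [apply Rplus_le_compat_r, Rabs_triang|].
rewrite Rabs_Ropp, !Rabs_mult, (Rabs_pos_eq (exp _)), (Rabs_pos_eq (exp (- _))) by (apply Rlt_le, exp_pos).
rewrite (Rabs_pos_eq (sqrt x * t - _)), (Rabs_pos_eq (sqrt x * t + _)) by lra.
rewrite !Rmult_plus_distr_l.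
apply Rplus_le_compat; [apply Rplus_le_compat|].
- rewrite Rmult_comm; lra.
- replace (_ + _)
   with (sqrt x * t * (exp (11 / 10 * p) * (6 * sqrt p + 1))) by ring.
  apply Rmult_le_compat; [lra | apply Rmult_le_pos; [apply Rlt_le, exp_pos | apply Rabs_pos] | lra |].
  replace (exp (11 / 10 * p)) with (exp (2 * p) * exp (- (9 / 10 * p))) by (rewrite <- exp_plus; f_equal; field).
  rewrite Rmult_assoc; apply Rmult_le_compat_l; [apply Rlt_le, exp_pos | lra].
- replace (exp (11 / 10 * p) * ((sqrt x * t + / (2 * sqrt x)) * (9 * sqrt p)))
   with ((sqrt x * t + / (2 * sqrt x)) * (9 * sqrt p * exp (11 / 10 * p))) by ring.
  apply Rmult_le_compat_l; lra.
Qed.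
End MainIntegral.

(** * Asymptotics of the coefficients, with explicit error *)

Lemma PI_bounds : 31415 / 10000 <= PI <= 31416 / 10000.
Proof.
generalize (PI_2_3_7_ineq 3); unfold sum_f_R0, tg_alt, PI_2_3_7_tg, Ratan_seq; simpl; lra.
Qed.

Lemma zeta2_bounds : 1644 / 1000 <= zeta2 <= 16451 / 10000.
Proof. unfold zeta2; destruct PI_bounds; split; nra. Qed.

Lemma sqrt_zeta2_bounds : 128 / 100 <= sqrt zeta2 <= 1283 / 1000.
Proof.
destruct zeta2_bounds.
rewrite <- (sqrt_square (128 / 100)), <- (sqrt_square (1283 / 1000)) by lra.
split; apply sqrt_le_1_alt; lra.
Qed.

(** The errors are of relative size exp(-17/20 u), and they have to beat 1/x^2 times the factor 1/x
    of the main term; as x = zeta2 u^2, this asks for u^6. The sixth root exp(v), v = 17/120 u, is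
    compared with a line through exp(49/10) >= 100, and (26/10)^6 >= 300. *)
Lemma exp_lower (u : R) : 348 / 10 <= u -> 300 * u ^ 6 <= exp (17 / 20 * u).
Proof.
intros Hu.
assert (H1 : (11 / 10) ^ 7 <= exp (7 / 10)).
  replace (7 / 10) with (INR 7 * (1 / 10)) by (simpl; field).
  rewrite <- Rpower_pow by lra; unfold Rpower.
  rewrite <- (exp_ln (11 / 10)) at 1 by lra; rewrite ln_exp; apply exp_le.
  apply Rmult_le_compat_l; [apply pos_INR|].
  rewrite <- (ln_exp (1 / 10)); apply Rcomplements.ln_le; [lra|].
  generalize (exp_ineq1_le (1 / 10)); lra.
assert (H2 : 100 <= exp (49 / 10)).
  replace (49 / 10) with (7 / 10 + 7 / 10 + 7 / 10 + 7 / 10 + 7 / 10 + 7 / 10 + 7 / 10) by field.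
  rewrite !exp_plus.
  apply Rle_trans with (194 / 100 * (194 / 100) * (194 / 100) * (194 / 100) * (194 / 100) * (194 / 100) * (194 / 100)); [lra|].
  repeat (apply Rmult_le_compat; try lra).
set (v := 17 / 120 * u).
assert (H3 : 26 / 10 * u <= exp v).
  replace v with (49 / 10 + (v - 49 / 10)) by ring; rewrite exp_plus.
  apply Rle_trans with (100 * (1 + (v - 49 / 10))); [unfold v; lra|].
  apply Rmult_le_compat; try (unfold v; lra); apply exp_ineq1_le.
replace (17 / 20 * u) with (v + v + v + v + v + v) by (unfold v; field).
rewrite !exp_plus.
apply Rle_trans with ((26 / 10 * u) ^ 6).
  rewrite Rpow_mult_distr; apply Rmult_le_compat_r; [apply pow_le; lra | simpl; lra].
replace (exp v * exp v * exp v * exp v * exp v * exp v) with (exp v ^ 6) by ring.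
apply pow_incr; lra.
Qed.

(* Up to the factor 1 / (2 pi sqrt 2) this is the leading term of Rademacher's
   expansion of p(n), at x = n - 1/24. *)
Definition rademacher_main (x : R) : R :=
  (sqrt zeta2 - / (2 * sqrt x)) / x * exp (2 * sqrt zeta2 * sqrt x).

Lemma Cinv_close (D V : C) (z : R) : V <> 0 -> z <= 1 / 2 -> Cmod (D - V) <= z * Cmod V ->
  Cmod (/ D - / V) <= 2 * z / Cmod V.
Proof.
intros HV Hz H.
assert (HV0 : 0 < Cmod V) by (apply Cmod_gt_0, HV).
assert (HD : Cmod V / 2 <= Cmod D).
  generalize (Cmod_triangle_rev V (V - D)); replace (V - (V - D))%C with D by ring.
  replace (V - D)%C with (- (D - V))%C by ring; rewrite Cmod_opp; nra.
assert (HD0 : D <> 0) by (apply Cmod_gt_0; lra).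
replace (/ D - / V)%C with (- (D - V) / (D * V))%C by (field; auto).
rewrite Cmod_div, Cmod_opp, Cmod_mult by (apply Cmult_neq_0; auto).
apply (Rmult_le_reg_r (Cmod D * Cmod V)); [nra|].
unfold Rdiv; rewrite Rmult_assoc, Rinv_l, Rmult_1_r by nra.
replace (_ * _) with (2 * z * Cmod D) by (field; lra).
assert (Hz0 : 0 <= z * Cmod V) by (eapply Rle_trans; [apply Cmod_ge_0 | exact H]).
nra.
Qed.

Section Asymptotics.
Variables (n : nat) (x t : R).
Hypothesis Hn : INR n = x + 1 / 24.
Hypothesis Hx : 0 < x.
Hypothesis Ht : 0 < t.
Hypothesis Hxt : x * (t * t) = zeta2.
Hypothesis Hu : 348 / 10 <= / t.

Let p := x * t.
Let u := / t.

Lemma t_mult_u : t * u = 1.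
Proof. unfold u; field; lra. Qed.

Lemma t_small : 0 < t <= 10 / 348.
Proof. generalize t_mult_u; fold u in Hu; intros; split; [exact Ht|]; nra. Qed.

Lemma p_u : p = zeta2 * u.
Proof. unfold p, u; rewrite <- Hxt; field; lra. Qed.

Lemma zeta2_t : zeta2 / t = p.
Proof. rewrite p_u; reflexivity. Qed.

Lemma p_ge : 57 <= p.
Proof. rewrite p_u; destruct zeta2_bounds; fold u in Hu; nra. Qed.

Lemma exp_p_small : 4 * exp (- (4 / 5 * p)) <= 1 / 4.
Proof.
assert (Hp := p_ge); assert (He := exp_ineq1_le (4 / 5 * p)); assert (Hq := exp_pos (4 / 5 * p)).
rewrite exp_Ropp; apply (Rmult_le_reg_r (exp (4 / 5 * p))); [exact Hq|].
rewrite Rmult_assoc, Rinv_l by lra; lra.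
Qed.

Lemma sqrt2_bounds : 14 / 10 <= sqrt 2.
Proof. rewrite <- (sqrt_square (14 / 10)) by lra; apply sqrt_le_1_alt; lra. Qed.

Let Kc := 2 * sqrt 2 * kappa.

Lemma Kc_pos : 0 < Kc.
Proof. unfold Kc; generalize kappa_gt sqrt2_bounds; nra. Qed.

(** The tau/24 in [eta_main] is what replaces n by x = n - 1/24. *)
Lemma circle_integrand_eq y : (Cexp (IZR (Z.of_nat n) * (t, y)) / eta_main (t, y) = main_integrand x t y / Kc)%C.
Proof.
assert (H0 := root_neq0 t Ht y); assert (HK := Kc_pos).
assert (HK0 : RtoC Kc <> 0) by (intros E; injection E; lra).
unfold main_integrand, saddle_exp, eta_main; fold Kc.
rewrite <- INR_IZR_INZ, Hn.
replace (_ + _)%C with (RtoC (x + 1 / 24) * (t, y) - ((t, y) / 24 - zeta2 / (t, y)))%C.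
  set (e := ((t, y) / 24 - zeta2 / (t, y))%C).
  rewrite (Cexp_minus _ e); assert (He := Cexp_neq_0 e); field; repeat split; assumption.
rewrite RtoC_plus, RtoC_div by lra; field; apply vertical_neq0, Ht.
Qed.

Lemma Cmod_main_integrand y : Rabs y <= 3 * t -> Cmod (main_integrand x t y) <= 2 * sqrt t * exp (2 * p).
Proof.
intros Hy; unfold main_integrand, saddle_exp; rewrite Cmod_mult, Cmod_Cexp.
apply Rmult_le_compat; auto using Cmod_ge_0, Rlt_le, exp_pos.
- assert (Hm : Cmod (t, y) <= 4 * t).
    eapply Rle_trans; [apply Cmod_le_abs|]; cbn [Re Im fst snd]; rewrite (Rabs_pos_eq t); lra.
  assert (E := Cmod_Csqrt (t, y) Ht); assert (Hst := sqrt_sqrt t ltac:(lra)); assert (Hs0 := sqrt_pos t).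
  apply Rsqr_incr_0; unfold Rsqr; [lra | apply Cmod_ge_0 | lra].
- apply exp_le; rewrite re_plus, Re_zeta2_div, re_scal_l by exact Ht; cbn [Re fst]; fold p.
  generalize (proj2 (eta_decay_bounds t y Ht Hy)); rewrite zeta2_t; lra.
Qed.

Definition circle_fun (N : nat) (y : R) : C :=
  (Cexp (IZR (Z.of_nat n) * (t, y)) / euler_prod (nome t y) 0 N)%C.

Lemma ex_RInt_circle N a b : ex_RInt (fun y => Re (circle_fun N y)) a b.
Proof. apply ex_RInt_Re, ex_Cderive_gen_coef, Ht. Qed.

Lemma ex_RInt_main_integrand a b : ex_RInt (fun y => Re (main_integrand x t y)) a b.
Proof.
apply ex_RInt_Re; intros y; eexists; apply is_Cderive_mult;
  [apply is_Cderive_Csqrt, Ht | apply is_Cderive_saddle_exp, Ht].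
Qed.

(** In the first error 96 = 6 * 8 * 2: the segment has length 6 t, inverting the product doubles a
    relative error of 4 exp(-4/5 p), three parts from the dual series and one from the truncation,
    and |sqrt tau| <= 2 sqrt t. The second error is [minor_arc] over a length of at most 2 pi. *)
Lemma circle_split : exists N0, forall N, (N0 <= N)%nat ->
  Rabs (2 * PI * gen_coef t N (Z.of_nat n) - RInt (fun y => Re (main_integrand x t y)) (- (3 * t)) (3 * t) / Kc)
  <= 96 * t * sqrt t * exp (- (4 / 5 * p)) * exp (2 * p) / Kc
     + 2 * PI * (exp (INR n * t) * (sqrt t / kappa * exp (zeta2 / t - 17 / 20 / t))).
Proof.
destruct t_small as [_ Hts]; assert (Hz := exp_p_small); assert (HK := Kc_pos); assert (HPI := PI2_3_2).
assert (Hez := exp_pos (- (4 / 5 * p))).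
destruct (euler_prod_eta t (exp (- (4 / 5 * p))) Ht) as [N1 HN1]; [rewrite zeta2_t; lra | exact Hez |].
destruct (minor_arc t ltac:(lra)) as [N2 HN2]; [rewrite zeta2_t; lra|].
exists (Nat.max N1 N2); intros N HN.
assert (E : 2 * PI * gen_coef t N (Z.of_nat n) = RInt (fun y => Re (circle_fun N y)) (- PI) PI).
  transitivity (2 * PI * (RInt (fun y => Re (circle_fun N y)) (- PI) PI / (2 * PI))); [reflexivity|].
  generalize (RInt (fun y => Re (circle_fun N y)) (- PI) PI : R); intros r; simpl in r.
  change (2 * PI * (r / (2 * PI)) = r); field; lra.
rewrite E, <- (RInt_Chasles_R _ (- PI) (- (3 * t)) PI), <- (RInt_Chasles_R _ (- (3 * t)) (3 * t) PI)
  by apply ex_RInt_circle.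
set (I1 := RInt _ (- PI) _); set (I2 := RInt _ (- (3 * t)) (3 * t)) at 1; set (I3 := RInt _ (3 * t) PI).
set (J := RInt _ _ _).
set (B := exp (INR n * t) * (sqrt t / kappa * exp (zeta2 / t - 17 / 20 / t))).
assert (HB : forall y, 3 * t <= Rabs y <= PI -> Rabs (Re (circle_fun N y)) <= B).
  intros y Hy; eapply Rle_trans; [apply re_le_Cmod|]; unfold circle_fun.
  rewrite Cmod_div, Cmod_Cexp, re_scal_l by (apply euler_prod_neq0, Cmod_nome_lt1, Ht).
  cbn [Re fst]; rewrite <- INR_IZR_INZ; apply Rmult_le_compat_l; [apply Rlt_le, exp_pos|].
  apply HN2; [lia | exact Hy].
assert (HB0 : 0 <= B).
  eapply Rle_trans; [apply Rabs_pos | apply (HB PI)]; rewrite Rabs_pos_eq; lra.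
assert (P1 : Rabs I1 <= PI * B).
  apply Rle_trans with ((- (3 * t) - - PI) * B); [|apply Rmult_le_compat_r; lra].
  apply abs_RInt_le_const; [lra | apply ex_RInt_circle |].
  intros y Hy; apply HB; rewrite Rabs_left; lra.
assert (P3 : Rabs I3 <= PI * B).
  apply Rle_trans with ((PI - 3 * t) * B); [|apply Rmult_le_compat_r; lra].
  apply abs_RInt_le_const; [lra | apply ex_RInt_circle |].
  intros y Hy; apply HB; rewrite Rabs_pos_eq; lra.
assert (P2 : Rabs (I2 - J / Kc) <= 96 * t * sqrt t * exp (- (4 / 5 * p)) * exp (2 * p) / Kc).
  replace (I2 - J / Kc) with (RInt (fun y => Re (circle_fun N y) - / Kc * Re (main_integrand x t y)) (- (3 * t)) (3 * t)).
  2: { rewrite RInt_minus_R, RInt_scal_R; [eqR; unfold I2, J, Rdiv; ring | apply ex_RInt_main_integrand | apply ex_RInt_circle |].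
       apply (ex_RInt_scal (V := R_NormedModule)), ex_RInt_main_integrand. }
  replace (_ / _)
    with ((3 * t - - (3 * t)) * (2 * (4 * exp (- (4 / 5 * p))) * (2 * sqrt t * exp (2 * p) / Kc))) by (field; lra).
  apply abs_RInt_le_const; [lra | |].
  - apply (ex_RInt_minus (V := R_NormedModule)); [apply ex_RInt_circle|].
    apply (ex_RInt_scal (V := R_NormedModule)), ex_RInt_main_integrand.
  - intros y Hy; assert (Hy' : Rabs y <= 3 * t) by (apply Rabs_le; lra).
    specialize (HN1 N y ltac:(lia) Hy'); rewrite zeta2_t in HN1.
    assert (HV : eta_main (t, y) <> 0).
      apply Cmod_gt_0; rewrite Cmod_eta_main by exact Ht; fold Kc.
      apply Rmult_lt_0_compat; [|apply exp_pos]; apply Rdiv_lt_0_compat; [exact HK|].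
      apply sqrt_lt_R0, Cmod_gt_0, vertical_neq0, Ht.
    assert (G := Cinv_close (euler_prod (Cexp (- (t, y))) 0 N) (eta_main (t, y)) (4 * exp (- (4 / 5 * p))) HV ltac:(lra) ltac:(lra)).
    replace (_ - _) with
      (Re (Cexp (IZR (Z.of_nat n) * (t, y)) * (/ euler_prod (nome t y) 0 N - / eta_main (t, y)))).
    2: { rewrite <- re_scal_l, RtoC_inv by lra.
         replace (/ Kc * main_integrand x t y)%C with (main_integrand x t y / Kc)%C by (unfold Cdiv; ring).
         rewrite <- circle_integrand_eq; unfold circle_fun, Cdiv.
         rewrite <- (Ropp_involutive (Re (_ * / eta_main _))), <- re_opp.
         unfold Rminus; rewrite Ropp_involutive, <- re_plus; f_equal; ring. }
    eapply Rle_trans; [apply re_le_Cmod|]; rewrite Cmod_mult.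
    fold (nome t y) in G.
    apply Rle_trans with (Cmod (Cexp (IZR (Z.of_nat n) * (t, y))) * (2 * (4 * exp (- (4 / 5 * p))) / Cmod (eta_main (t, y)))).
      apply Rmult_le_compat_l; [apply Cmod_ge_0 | exact G].
    replace (_ * _)
      with (2 * (4 * exp (- (4 / 5 * p))) * Cmod (Cexp (IZR (Z.of_nat n) * (t, y)) / eta_main (t, y)))
      by (rewrite Cmod_div by exact HV; unfold Rdiv; ring).
    rewrite circle_integrand_eq, Cmod_div, Cmod_R, (Rabs_pos_eq Kc) by (lra || (intros E'; injection E'; lra)).
    apply Rmult_le_compat_l; [lra|].
    apply Rmult_le_compat_r; [apply Rlt_le, Rinv_0_lt_compat; lra | apply Cmod_main_integrand, Hy'].
replace (I1 + (I2 + I3) - J / Kc) with ((I2 - J / Kc) + I1 + I3) by ring.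
eapply Rle_trans; [apply Rabs_triang|]; eapply Rle_trans; [apply Rplus_le_compat_r, Rabs_triang|].
lra.
Qed.

Lemma sqrt_x_t : sqrt x * t = sqrt zeta2.
Proof.
rewrite <- Hxt, sqrt_mult, sqrt_square by nra; reflexivity.
Qed.

Lemma x_u : x = zeta2 * (u * u).
Proof. rewrite <- Hxt; unfold u; field; lra. Qed.

Lemma asymp_numeric_bounds :
  sqrt t <= 17 / 100 /\ sqrt p <= p / 7 /\ / (2 * sqrt x) <= 2 / 100 /\ 1400 / 1500 <= Kc /\
  exp (- (17 / 20 * u)) <= / (300 * u ^ 6) /\ x * (x * x) <= 4453 / 1000 * u ^ 6.
Proof.
assert (Hp := p_ge); destruct t_small as [_ Hts]; destruct zeta2_bounds as [Z1 Z2]; fold u in Hu.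
repeat split.
- rewrite <- (sqrt_square (17 / 100)) by lra; apply sqrt_le_1_alt; lra.
- rewrite <- (sqrt_square (p / 7)) by lra; apply sqrt_le_1_alt; nra.
- replace (2 / 100) with (/ 50) by field; apply Rinv_le_contravar; [lra|].
  assert (25 <= sqrt x); [|lra].
  rewrite <- (sqrt_square 25) by lra; apply sqrt_le_1_alt; rewrite x_u; nra.
- unfold Kc; generalize kappa_gt sqrt2_bounds; nra.
- rewrite exp_Ropp; apply Rinv_le_contravar; [|apply exp_lower, Hu].
  apply Rmult_lt_0_compat; [lra | apply pow_lt; lra].
- rewrite x_u; replace (_ * _) with (zeta2 * (zeta2 * zeta2) * u ^ 6) by ring.
  apply Rmult_le_compat_r; [apply pow_le; lra|].
  apply Rle_trans with (16451 / 10000 * (16451 / 10000 * (16451 / 10000))); [|lra].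
  apply Rmult_le_compat; nra.
Qed.

(** Everything is measured in the unit W e with W = exp(2 p) and e = exp(-17/20 u). The ends of the
    main integral cost 0.18, the approximation on the segment 0.51 and the outer range 3.3, in total
    less than 4, which [exp_lower] converts into 1/(10 x^2) of the main term. *)
Lemma gen_coef_asymp_circle : exists N0, forall N, (N0 <= N)%nat ->
  Rabs (2 * PI * gen_coef t N (Z.of_nat n) - rademacher_main x / sqrt 2)
  <= / (10 * (x * x)) * (rademacher_main x / sqrt 2).
Proof.
destruct circle_split as [N0 HN]; exists N0; intros N H; specialize (HN N H); clear H N0.
destruct asymp_numeric_bounds as [B1 [B2 [B3 [B4 [B5 B6]]]]].
assert (Hp := p_ge); destruct t_small as [_ Hts]; destruct zeta2_bounds as [Z1 Z2]; fold u in Hu.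
destruct sqrt_zeta2_bounds as [S1 S2].
assert (Hk := kappa_gt); assert (Hs2 := sqrt2_bounds).
assert (Hsx := sqrtx_pos x Hx); assert (Hix : 0 < / (2 * sqrt x)) by (apply Rinv_0_lt_compat; lra).
assert (HI := main_integral_bound x t Hx Ht Hxt ltac:(fold p; lra)); fold p in HI.
rewrite sqrt_x_t in HI.
set (b := sqrt zeta2) in *.
set (J := RInt _ _ _) in *.
set (I := 2 * PI * gen_coef t N (Z.of_nat n)) in *.
assert (E2p : exp (2 * b * sqrt x) = exp (2 * p)).
  f_equal; unfold b; rewrite <- sqrt_x_t; replace (_ * _) with (2 * (sqrt x * sqrt x * t)) by ring.
  rewrite sqrt_sqrt by lra; reflexivity.
assert (Hmain : rademacher_main x / sqrt 2 = (2 / x * (kappa * (b - / (2 * sqrt x)) * exp (2 * p))) / Kc).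
  unfold rademacher_main, Kc; fold b; rewrite E2p; field; repeat split; lra.
set (W := exp (2 * p)) in *; assert (HW : 0 < W) by apply exp_pos.
set (e := exp (- (17 / 20 * u))) in *; assert (He : 0 < e) by apply exp_pos.
assert (T0 : 2 / x * (exp (11 / 10 * p) * (2 * sqrt t + b * (6 * sqrt p + 1) + (b + / (2 * sqrt x)) * (9 * sqrt p))) / Kc
   <= 18 / 100 * (W * e)).
  assert (G1 : exp (11 / 10 * p) <= W * e).
    unfold W, e; rewrite <- exp_plus; apply exp_le; rewrite p_u; nra.
  assert (Hsp := sqrt_pos p); assert (Hst := sqrt_pos t).
  assert (G2 : 2 * sqrt t + b * (6 * sqrt p + 1) + (b + / (2 * sqrt x)) * (9 * sqrt p) <= 282 / 100 * p).
    assert (b * (6 * sqrt p + 1) <= 1283 / 1000 * (6 * sqrt p + 1)) by (apply Rmult_le_compat_r; lra).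
    assert ((b + / (2 * sqrt x)) * (9 * sqrt p) <= 1303 / 1000 * (9 * sqrt p)) by (apply Rmult_le_compat_r; lra).
    lra.
  assert (G3 : exp (11 / 10 * p) * (2 * sqrt t + b * (6 * sqrt p + 1) + (b + / (2 * sqrt x)) * (9 * sqrt p)) <= W * e * (282 / 100 * p)).
    apply Rmult_le_compat; [apply Rlt_le, exp_pos | | exact G1 | exact G2].
    assert (0 <= b * (6 * sqrt p + 1)) by (apply Rmult_le_pos; lra).
    assert (0 <= (b + / (2 * sqrt x)) * (9 * sqrt p)) by (apply Rmult_le_pos; lra).
    lra.
  apply (Rmult_le_reg_r Kc); [lra|]; unfold Rdiv at 1; rewrite Rmult_assoc, Rinv_l, Rmult_1_r by lra.
  apply (Rmult_le_reg_r (x / 2)); [lra|].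
  replace (_ * _)
    with (exp (11 / 10 * p) * (2 * sqrt t + b * (6 * sqrt p + 1) + (b + / (2 * sqrt x)) * (9 * sqrt p))) by (field; lra).
  eapply Rle_trans; [exact G3|].
  replace (18 / 100 * (W * e) * Kc * (x / 2)) with (W * e * (9 / 100 * Kc * x)) by field.
  apply Rmult_le_compat_l; [apply Rlt_le, Rmult_lt_0_compat; assumption|].
  replace x with (p * u) by (rewrite x_u, p_u; ring).
  assert (32 <= Kc * u) by nra.
  replace (9 / 100 * Kc * (p * u)) with (9 / 100 * (Kc * u) * p) by ring; nra.
assert (T1 : 96 * t * sqrt t * exp (- (4 / 5 * p)) * W / Kc <= 51 / 100 * (W * e)).
  assert (G1 : exp (- (4 / 5 * p)) <= e) by (unfold e; apply exp_le; rewrite p_u; nra).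
  assert (Hst := sqrt_pos t).
  apply (Rmult_le_reg_r Kc); [lra|]; unfold Rdiv at 1; rewrite Rmult_assoc, Rinv_l, Rmult_1_r by lra.
  replace (51 / 100 * (W * e) * Kc) with (51 / 100 * Kc * e * W) by ring.
  apply Rmult_le_compat_r; [lra|].
  apply Rmult_le_compat; [nra | apply Rlt_le, exp_pos | | exact G1].
  assert (t * sqrt t <= 10 / 348 * (17 / 100)) by (apply Rmult_le_compat; lra).
  lra.
assert (T2 : 2 * PI * (exp (INR n * t) * (sqrt t / kappa * exp (zeta2 / t - 17 / 20 / t))) <= 33 / 10 * (W * e)).
  assert (G1 : exp (INR n * t) * exp (zeta2 / t - 17 / 20 / t) = W * e * exp (t / 24)).
    unfold W, e; rewrite <- !exp_plus; f_equal; rewrite zeta2_t, Hn; unfold p, u, Rdiv; field; lra.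
  replace (exp (INR n * t) * (sqrt t / kappa * exp (zeta2 / t - 17 / 20 / t)))
    with (sqrt t / kappa * (exp (INR n * t) * exp (zeta2 / t - 17 / 20 / t))) by ring.
  rewrite G1.
  assert (G2 : exp (t / 24) <= 101 / 100).
    assert (Hq := exp_pos (t / 24)); assert (Hq2 := exp_ineq1_le (- (t / 24))); rewrite exp_Ropp in Hq2.
    apply (Rmult_le_compat_r (exp (t / 24))) in Hq2; [|lra]; rewrite Rinv_l in Hq2 by lra; nra.
  assert (G3 : sqrt t / kappa <= 51 / 100).
    apply (Rmult_le_reg_r kappa); [lra|]; unfold Rdiv at 1; rewrite Rmult_assoc, Rinv_l by lra; lra.
  assert (G4 : 0 <= sqrt t / kappa).
    apply Rmult_le_pos; [apply sqrt_pos | apply Rlt_le, Rinv_0_lt_compat; lra].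
  destruct PI_bounds as [P1 P2].
  assert (HWe : 0 < W * e) by (apply Rmult_lt_0_compat; assumption).
  assert (G5 : sqrt t / kappa * (W * e * exp (t / 24)) <= 51 / 100 * (W * e * (101 / 100))).
    apply Rmult_le_compat; [exact G4 | | exact G3 |].
    - apply Rmult_le_pos; [lra | apply Rlt_le, exp_pos].
    - apply Rmult_le_compat_l; lra.
  assert (0 <= sqrt t / kappa * (W * e * exp (t / 24))).
    apply Rmult_le_pos; [exact G4|]; apply Rmult_le_pos; [lra | apply Rlt_le, exp_pos].
  apply Rle_trans with (2 * (31416 / 10000) * (51 / 100 * (W * e * (101 / 100)))); [|lra].
  apply Rmult_le_compat; lra.
assert (Tm : 4 * (W * e) <= / (10 * (x * x)) * (rademacher_main x / sqrt 2)).
  unfold rademacher_main; fold b; rewrite E2p; fold W.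
  assert (Hx3 : 0 < x * (x * x)) by (repeat apply Rmult_lt_0_compat; exact Hx).
  apply Rle_trans with (W * (4 * / (300 * u ^ 6))).
    replace (4 * (W * e)) with (W * (4 * e)) by ring; apply Rmult_le_compat_l; lra.
  assert (Hs2u : sqrt 2 <= 15 / 10).
    rewrite <- (sqrt_square (15 / 10)) by lra; apply sqrt_le_1_alt; lra.
  replace (/ (10 * (x * x)) * ((b - / (2 * sqrt x)) / x * W / sqrt 2))
    with (W * ((b - / (2 * sqrt x)) * / (10 * sqrt 2 * (x * (x * x))))) by (field; repeat split; lra).
  apply Rmult_le_compat_l; [lra|].
  apply Rle_trans with (126 / 100 * / (67 * u ^ 6)).
    rewrite !Rinv_mult; assert (0 < / u ^ 6) by (apply Rinv_0_lt_compat; lra); lra.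
  apply Rmult_le_compat; [lra | apply Rlt_le, Rinv_0_lt_compat; lra | lra |].
  apply Rinv_le_contravar; [repeat apply Rmult_lt_0_compat; lra|].
  apply Rle_trans with (15 * (x * (x * x))); [apply Rmult_le_compat_r; lra | lra].
rewrite Hmain in *.
set (m0 := 2 / x * (kappa * (b - / (2 * sqrt x)) * W)) in *.
assert (HI' : Rabs (J / Kc - m0 / Kc) <= 18 / 100 * (W * e)).
  eapply Rle_trans; [|exact T0].
  replace (J / Kc - m0 / Kc) with ((J - m0) / Kc) by (unfold Rdiv; ring).
  unfold Rdiv at 1; rewrite Rabs_mult, (Rabs_pos_eq (/ Kc)) by (apply Rlt_le, Rinv_0_lt_compat; lra).
  apply Rmult_le_compat_r; [apply Rlt_le, Rinv_0_lt_compat; lra | exact HI].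
assert (HWe : 0 < W * e) by (apply Rmult_lt_0_compat; assumption).
replace (I - m0 / Kc) with ((I - J / Kc) + (J / Kc - m0 / Kc)) by ring.
eapply Rle_trans; [apply Rabs_triang|]; lra.
Qed.
End Asymptotics.

Definition saddle_point (x : R) : R := sqrt (zeta2 / x).

Lemma gen_coef_asymp n : (1999 <= n)%nat ->
  let x := INR n - 1 / 24 in
  0 < saddle_point x /\
  exists N0, forall N, (N0 <= N)%nat ->
  Rabs (2 * PI * gen_coef (saddle_point x) N (Z.of_nat n) - rademacher_main x / sqrt 2)
  <= / (10 * (x * x)) * (rademacher_main x / sqrt 2).
Proof.
intros Hn x; assert (Hx : 1998 <= x).
  apply le_INR in Hn; rewrite INR_IZR_INZ in Hn; simpl in Hn; unfold x; lra.
destruct zeta2_bounds as [Z1 Z2].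
assert (Hzx : 0 < zeta2 / x) by (apply Rdiv_lt_0_compat; lra).
assert (Ht : 0 < saddle_point x) by (apply sqrt_lt_R0, Hzx).
assert (Hxt : x * (saddle_point x * saddle_point x) = zeta2).
  unfold saddle_point; rewrite sqrt_sqrt by lra; field; lra.
split; [exact Ht|].
apply gen_coef_asymp_circle; [unfold x; lra | lra | exact Ht | exact Hxt |].
(* The constant 348/10 is a lower bound for sqrt(x / zeta2) at x = 1998. *)
assert (saddle_point x <= 10 / 348).
  unfold saddle_point; rewrite <- (sqrt_square (10 / 348)) by lra; apply sqrt_le_1_alt.
  apply (Rmult_le_reg_r x); [lra|]; unfold Rdiv at 1; rewrite Rmult_assoc, Rinv_l by lra; lra.
replace (348 / 10) with (/ (10 / 348)) by field; apply Rinv_le_contravar; lra.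
Qed.

(** * The second difference of the main term *)

Section SecondDifference.
Variable x : R.
Hypothesis Hx : 1998 <= x.

Let s := sqrt x.
Let sm := sqrt (x - 1).
Let sp := sqrt (x + 1).

Lemma sqrt_shift_bounds :
  s * s = x /\ sm * sm = x - 1 /\ sp * sp = x + 1 /\ 44 <= s /\ s <= sp /\ s * (1 - / x) <= sm /\ 0 < sm /\ sm <= s.
Proof.
assert (E : s * s = x) by (apply sqrt_sqrt; lra).
assert (Em : sm * sm = x - 1) by (apply sqrt_sqrt; lra).
assert (Ep : sp * sp = x + 1) by (apply sqrt_sqrt; lra).
assert (H44 : 44 <= s) by (unfold s; rewrite <- (sqrt_square 44) by lra; apply sqrt_le_1_alt; lra).
assert (Hm : 0 < sm) by (apply sqrt_lt_R0; lra).
repeat split; auto.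
- apply sqrt_le_1_alt; lra.
- assert (Hi : 0 < / x) by (apply Rinv_0_lt_compat; lra).
  assert (Hxi : x * / x = 1) by (apply Rinv_r; lra).
  apply Rsqr_incr_0; [|nra|lra]; unfold Rsqr; rewrite Em.
  replace (_ * _) with (s * s * (1 - / x) * (1 - / x)) by ring.
  rewrite E; replace (x * (1 - / x)) with (x - 1) by (rewrite Rmult_minus_distr_l, Hxi; ring).
  nra.
- apply sqrt_le_1_alt; lra.
Qed.

Lemma inv_x_bounds : 0 < / x <= 1 / 1998 /\ x * / x = 1.
Proof.
split; [split|].
- apply Rinv_0_lt_compat; lra.
- replace (1 / 1998) with (/ 1998) by field; apply Rinv_le_contravar; lra.
- apply Rinv_r; lra.
Qed.

(** Rationalising twice gives 2 / ((s + sm)(s + sp)(sp + sm)), which is about 1/(4 x^(3/2)). The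
    lower bound sm >= s (1 - 1/x) costs a factor (1 - 1/(2x))^(-2) <= 1 + (11/10) / x. *)
Lemma sqrt_second_difference : 2 * s - sm - sp <= / (4 * (x * s)) * (1 + 11 / 10 * / x).
Proof.
destruct sqrt_shift_bounds as [E [Em [Ep [H44 [Hp [Hm [Hm0 Hms]]]]]]]; destruct inv_x_bounds as [[Hz0 Hz] Hxz].
set (z := / x) in *.
assert (E1 : 2 * s - sm - sp = 2 / ((s + sm) * (s + sp) * (sp + sm))).
  apply (Rmult_eq_reg_r ((s + sm) * (s + sp) * (sp + sm))).
  2: { apply Rgt_not_eq; repeat apply Rmult_lt_0_compat; lra. }
  replace (2 / ((s + sm) * (s + sp) * (sp + sm)) * ((s + sm) * (s + sp) * (sp + sm))) with 2
    by (field; repeat split; lra).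
  replace (_ * _)
    with (((s * s - sm * sm) * (s + sp) - (sp * sp - s * s) * (s + sm)) * (sp + sm)) by ring.
  rewrite E, Em, Ep.
  replace (_ * _) with (sp * sp - sm * sm) by ring.
  rewrite Ep, Em; ring.
rewrite E1.
assert (HD : 2 * (x * s) * ((2 - z) * (2 - z)) <= (s + sm) * (s + sp) * (sp + sm)).
  replace (_ * _) with (s * (2 - z) * (2 * s) * (s * (2 - z))) by (rewrite <- E at 1; ring).
  repeat (apply Rmult_le_compat; try nra).
assert (Hxs : 0 < x * s) by (apply Rmult_lt_0_compat; lra).
assert (Hz2 : 0 < (2 - z) * (2 - z)) by nra.
apply Rle_trans with (2 * / (2 * (x * s) * ((2 - z) * (2 - z)))).
  apply Rmult_le_compat_l; [lra|]; apply Rinv_le_contravar; [|exact HD].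
  repeat apply Rmult_lt_0_compat; lra.
replace (2 * / (2 * (x * s) * ((2 - z) * (2 - z)))) with (/ (4 * (x * s)) * (4 * / ((2 - z) * (2 - z)))) by (field; repeat split; lra).
apply Rmult_le_compat_l; [apply Rlt_le, Rinv_0_lt_compat; lra|].
apply (Rmult_le_reg_r ((2 - z) * (2 - z))); [exact Hz2|].
rewrite Rmult_assoc, Rinv_l by lra; nra.
Qed.

Let b := sqrt zeta2.

(** The products of two inverse roots favour the right side ([Hprod]). What remains is b times the
    second difference of 1/(2 sqrt x), about (3/8) x^(-5/2), relative to factors of at least
    1.26. *)
Lemma rademacher_factor_bound :
  (b - / (2 * s)) * (b - / (2 * s)) <=
  (b - / (2 * sm)) * (b - / (2 * sp)) * (1 + 4 / 10 * (/ x * / x * / s)).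
Proof.
destruct sqrt_shift_bounds as [E [Em [Ep [H44 [Hp [Hm [Hm0 Hms]]]]]]]; destruct inv_x_bounds as [[Hz0 Hz] Hxz].
destruct sqrt_zeta2_bounds as [B1 B2]; fold b in B1, B2.
set (z := / x) in *.
assert (Hm43 : 43 <= sm).
  apply Rle_trans with (s * (1 - z)); [nra | exact Hm].
assert (Him : 0 < / (2 * sm) <= 2 / 100).
  split; [apply Rinv_0_lt_compat; lra|].
  replace (2 / 100) with (/ 50) by field; apply Rinv_le_contravar; lra.
assert (Hip : 0 < / (2 * sp) <= 2 / 100).
  split; [apply Rinv_0_lt_compat; lra|].
  replace (2 / 100) with (/ 50) by field; apply Rinv_le_contravar; lra.
assert (Hprod : / (2 * s) * / (2 * s) <= / (2 * sm) * / (2 * sp)).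
  rewrite <- !Rinv_mult; apply Rinv_le_contravar.
    apply Rmult_lt_0_compat; apply Rmult_lt_0_compat; lra.
  replace (2 * s * (2 * s)) with (4 * (s * s)) by ring; rewrite E.
  assert (sm * sp <= x).
    apply Rsqr_incr_0; [unfold Rsqr | nra | lra].
    replace (sm * sp * (sm * sp)) with ((sm * sm) * (sp * sp)) by ring; rewrite Em, Ep; nra.
  lra.
assert (Hsec : / (2 * sm) + / (2 * sp) - 2 * / (2 * s) <= 39 / 100 * (z * z * / s)).
  (* 1/A and 1/B are s times the two first differences of the inverse square root, so the second
     difference is (B - A) / (A B) over 2 s, with B - A close to 3. *)
  set (A := sm * (s + sm)); set (B := sp * (s + sp)).
  assert (HA : 199 / 100 * x <= A).
    unfold A; replace (sm * (s + sm)) with (sm * s + sm * sm) by ring; rewrite Em.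
    assert (s * (1 - z) * s <= sm * s) by (apply Rmult_le_compat_r; lra).
    replace (s * (1 - z) * s) with (s * s * (1 - z)) in H by ring; rewrite E in H.
    replace (x * (1 - z)) with (x - 1) in H by (rewrite Rmult_minus_distr_l, Hxz; ring); lra.
  assert (HB : 2 * x <= B).
    unfold B; replace (sp * (s + sp)) with (sp * s + sp * sp) by ring; rewrite Ep.
    assert (s * s <= sp * s) by (apply Rmult_le_compat_r; lra); lra.
  assert (HBA : B - A <= 301 / 100).
    unfold A, B; replace (_ - _) with (s * (sp - sm) + (sp * sp - sm * sm)) by ring.
    rewrite Ep, Em.
    assert (sp - sm <= 101 / 100 * / s).
      apply (Rmult_le_reg_r (s * (sp + sm))); [nra|].
      replace (_ * _) with (s * (sp * sp - sm * sm)) by ring; rewrite Ep, Em.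
      replace (101 / 100 * / s * (s * (sp + sm))) with (101 / 100 * (sp + sm)) by (field; lra).
      nra.
    assert (s * (sp - sm) <= s * (101 / 100 * / s)) by (apply Rmult_le_compat_l; lra).
    replace (s * (101 / 100 * / s)) with (101 / 100) in H0 by (field; lra); lra.
  replace (_ - _) with (/ (2 * s) * ((B - A) * / (A * B))).
  2: { assert (HA0 : A <> 0) by lra; assert (HB0 : B <> 0) by lra.
       transitivity (/ (2 * s) * (/ A - / B)); [field; repeat split; lra|].
       assert (F1 : / A = s * (/ sm - / s)).
         unfold A; apply (Rmult_eq_reg_r (sm * (s + sm))); [|unfold A in HA0; exact HA0].
         rewrite Rinv_l by exact HA0.
         replace (_ * _) with (s * s - sm * sm) by (field; lra).
         rewrite E, Em; ring.
       assert (F2 : / B = s * (/ s - / sp)).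
         unfold B; apply (Rmult_eq_reg_r (sp * (s + sp))); [|unfold B in HB0; exact HB0].
         rewrite Rinv_l by exact HB0.
         replace (_ * _) with (sp * sp - s * s) by (field; lra).
         rewrite E, Ep; ring.
       rewrite F1, F2; field; lra. }
  assert (HAB : 398 / 100 * (x * x) <= A * B).
    replace (398 / 100 * (x * x)) with (199 / 100 * x * (2 * x)) by field.
    apply Rmult_le_compat; lra.
  assert (Hxx : 0 < x * x) by nra.
  assert (Hi : / (A * B) <= 100 / 398 * (z * z)).
    replace (100 / 398 * (z * z)) with (/ (398 / 100 * (x * x))) by (unfold z; field; lra).
    apply Rinv_le_contravar; lra.
  assert (Hi0 : 0 < / (A * B)) by (apply Rinv_0_lt_compat; lra).
  assert ((B - A) * / (A * B) <= 78 / 100 * (z * z)).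
    apply Rle_trans with (301 / 100 * / (A * B)); [apply Rmult_le_compat_r; lra|].
    assert (0 < z * z) by nra; lra.
  replace (39 / 100 * (z * z * / s)) with (/ (2 * s) * (78 / 100 * (z * z))) by (field; lra).
  apply Rmult_le_compat_l; [apply Rlt_le, Rinv_0_lt_compat; lra | assumption].
assert (Hq : 0 <= z * z * / s).
  apply Rmult_le_pos; [nra | apply Rlt_le, Rinv_0_lt_compat; lra].
set (q := z * z * / s) in *; set (hm := / (2 * sm)) in *; set (hp := / (2 * sp)) in *; set (h := / (2 * s)) in *.
assert (Hbb : 126 / 100 * (126 / 100) <= (b - hm) * (b - hp)) by (apply Rmult_le_compat; lra).
assert (b * (hm + hp - 2 * h) <= 1283 / 1000 * (39 / 100 * q)).
  destruct (Rle_dec 0 (hm + hp - 2 * h)); [apply Rmult_le_compat; lra | nra].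
nra.
Qed.

Lemma rademacher_main_pos : 0 < rademacher_main x.
Proof.
destruct sqrt_shift_bounds as [_ [_ [_ [H44 _]]]].
destruct sqrt_zeta2_bounds as [B1 B2].
assert (/ (2 * sqrt x) <= / 50) by (apply Rinv_le_contravar; fold s; lra).
unfold rademacher_main; apply Rmult_lt_0_compat; [apply Rdiv_lt_0_compat; lra | apply exp_pos].
Qed.

(** Factor by factor: 1/x yields 1 - 1/x^2 <= exp(-1/x^2), the bracket loses (4/10) x^(-5/2) in the
    exponent, and the exponentials yield 2 b times the second difference of the square root, whose
    leading part (b/2) x^(-3/2) is pi / (sqrt 24 x^(3/2)). *)
Lemma rademacher_main_ratio :
  rademacher_main x * rademacher_main x <= rademacher_main (x - 1) * rademacher_main (x + 1) *
  exp (- (/ x * / x) + 4 / 10 * (/ x * / x * / s) + b / 2 * / (x * s) * (1 + 11 / 10 * / x)).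
Proof.
destruct sqrt_shift_bounds as [E [Em [Ep [H44 [Hp [Hm [Hm0 Hms]]]]]]]; destruct inv_x_bounds as [[Hz0 Hz] Hxz].
destruct sqrt_zeta2_bounds as [B1 B2]; fold b in B1, B2.
assert (F := rademacher_factor_bound).
assert (G := sqrt_second_difference).
unfold rademacher_main; fold b s sm sp.
set (f := b - / (2 * s)) in *; set (fm := b - / (2 * sm)) in *; set (fp := b - / (2 * sp)) in *.
set (q := / x * / x * / s) in *.
assert (Hq : 0 <= q).
  apply Rmult_le_pos; [nra | apply Rlt_le, Rinv_0_lt_compat; lra].
assert (Hf : 0 < f).
  unfold f; assert (/ (2 * s) <= / 50) by (apply Rinv_le_contravar; lra); lra.
assert (Hm43 : 43 <= sm) by (apply Rle_trans with (s * (1 - / x)); [nra | exact Hm]).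
assert (Hfm : 0 < fm).
  unfold fm; assert (/ (2 * sm) <= / 50) by (apply Rinv_le_contravar; lra); lra.
assert (Hfp : 0 < fp).
  unfold fp; assert (/ (2 * sp) <= / 50) by (apply Rinv_le_contravar; lra); lra.
assert (Hy : exp (2 * b * s) * exp (2 * b * s) <= exp (2 * b * sm) * exp (2 * b * sp) * exp (b / 2 * / (x * s) * (1 + 11 / 10 * / x))).
  rewrite <- !exp_plus; apply exp_le.
  assert (2 * b * (2 * s - sm - sp) <= 2 * b * (/ (4 * (x * s)) * (1 + 11 / 10 * / x))) by (apply Rmult_le_compat_l; lra).
  replace (b / 2 * / (x * s) * (1 + 11 / 10 * / x)) with (2 * b * (/ (4 * (x * s)) * (1 + 11 / 10 * / x))) by (field; lra).
  lra.
rewrite (exp_plus (_ + _)), (exp_plus (- _)).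
set (Y := exp (b / 2 * / (x * s) * (1 + 11 / 10 * / x))) in *.
assert (Hz2 : 1 - / x * / x <= exp (- (/ x * / x))) by (generalize (exp_ineq1_le (- (/ x * / x))); lra).
assert (Hq2 : 1 + 4 / 10 * q <= exp (4 / 10 * q)) by apply exp_ineq1_le.
assert (Hpoly : f / x * (f / x) <= fm / (x - 1) * (fp / (x + 1)) * (exp (- (/ x * / x)) * exp (4 / 10 * q))).
  assert (E1 : fm / (x - 1) * (fp / (x + 1)) = fm * fp * / ((x - 1) * (x + 1))) by (field; lra).
  assert (E2 : f / x * (f / x) = f * f * (/ x * / x)) by (field; lra).
  assert (Hx1 : 0 < (x - 1) * (x + 1)) by nra.
  assert (E3 : / x * / x = / ((x - 1) * (x + 1)) * (1 - / x * / x)) by (field; repeat split; nra).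
  rewrite E1, E2; rewrite E3 at 1.
  assert (Hi : 0 < / ((x - 1) * (x + 1))) by (apply Rinv_0_lt_compat; exact Hx1).
  apply Rle_trans with (fm * fp * (1 + 4 / 10 * q) * (/ ((x - 1) * (x + 1)) * (1 - / x * / x))).
    apply Rmult_le_compat_r; [apply Rmult_le_pos; nra | exact F].
  replace (_ * _)
    with (fm * fp * / ((x - 1) * (x + 1)) * ((1 - / x * / x) * (1 + 4 / 10 * q))) by ring.
  apply Rmult_le_compat_l; [apply Rmult_le_pos; [nra | lra]|].
  apply Rmult_le_compat; nra || lra.
replace (_ * _)
  with ((f / x * (f / x)) * (exp (2 * b * s) * exp (2 * b * s))) by ring.
replace (fm / (x - 1) * exp (2 * b * sm) * (fp / (x + 1) * exp (2 * b * sp)) * (exp (- (/ x * / x)) * exp (4 / 10 * q) * Y))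
  with ((fm / (x - 1) * (fp / (x + 1)) * (exp (- (/ x * / x)) * exp (4 / 10 * q))) * (exp (2 * b * sm) * exp (2 * b * sp) * Y)) by ring.
apply Rmult_le_compat; [ | | exact Hpoly | exact Hy].
- apply Rmult_le_pos; apply Rlt_le, Rdiv_lt_0_compat; lra.
- apply Rmult_le_pos; apply Rlt_le, exp_pos.
Qed.

(** From exp L <= 1/(1 - L) it suffices that X - L - X L > 0. Here the gain (55/100) / x^2 meets
    terms of order x^(-5/2) and X^2 of order x^(-3); 1/sqrt x <= 1/44 settles it. *)
Lemma main_term_inequality (X : R) :
  b / 2 * / (x * s) * (1 - / x / 12) <= X <= b / 2 * / (x * s) ->
  exp (- (55 / 100 * (/ x * / x)) + 4 / 10 * (/ x * / x * / s) + b / 2 * / (x * s) * (1 + 11 / 10 * / x)) < 1 + X.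
Proof.
destruct sqrt_shift_bounds as [E [_ [_ [H44 _]]]]; destruct inv_x_bounds as [[Hz0 Hz] Hxz].
destruct sqrt_zeta2_bounds as [B1 B2]; fold b in B1, B2.
assert (Hw : 0 < / s <= 1 / 44).
  split; [apply Rinv_0_lt_compat; lra|].
  replace (1 / 44) with (/ 44) by field; apply Rinv_le_contravar; lra.
assert (Hww : / s * / s = / x) by (rewrite <- Rinv_mult, E; reflexivity).
replace (/ (x * s)) with (/ x * / s) by (rewrite Rinv_mult; reflexivity).
set (z := / x) in *; set (w := / s) in *.
set (X0 := b / 2 * (z * w)); intros [HX1 HX2].
assert (Hzw : 0 < z * w) by (apply Rmult_lt_0_compat; lra).
assert (HX0 : 0 < X0 <= 6415 / 10000 * (z * w)).
  unfold X0; split; [apply Rmult_lt_0_compat; lra | apply Rmult_le_compat_r; lra].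
set (L := - (55 / 100 * (z * z)) + 4 / 10 * (z * z * w) + X0 * (1 + 11 / 10 * z)).
assert (Hzz : 0 < z * z) by nra.
assert (Hzzw : w * (z * z) <= 1 / 44 * (z * z)) by (apply Rmult_le_compat_r; lra).
assert (HX2' : X0 * X0 <= 1 / 100 * (z * z)).
  apply Rle_trans with (6415 / 10000 * (z * w) * (6415 / 10000 * (z * w))); [apply Rmult_le_compat; lra|].
  replace (_ * _) with (6415 / 10000 * (6415 / 10000) * z * (z * z)) by (rewrite <- Hww; ring).
  apply Rmult_le_compat_r; lra.
assert (HL : X - L - X * L > 0).
  assert (HL0 : L <= X0 * (1 + 11 / 10 * z)) by (unfold L; lra).
  assert (HX0p : 0 <= X) by nra.
  assert (X * L <= X0 * (X0 * (1 + 11 / 10 * z))).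
    apply Rle_trans with (X * (X0 * (1 + 11 / 10 * z))); [apply Rmult_le_compat_l; lra|].
    apply Rmult_le_compat_r; [nra | lra].
  unfold L; nra.
assert (He := exp_ineq1_le (- L)); rewrite exp_Ropp in He.
assert (Hp := exp_pos L).
apply (Rmult_le_compat_r (exp L)) in He; [|lra]; rewrite Rinv_l in He by lra.
assert (0 < 1 + X) by nra.
nra.
Qed.

(** The gain exp(-1/x^2) is divided: 45/100 of it covers the four relative errors, two of 1/10 and
    two of 101/1000 in units of 1/x^2, the latter because the neighbours are evaluated at x - 1 and
    x + 1; 55/100 goes to [main_term_inequality]. *)
Lemma square_lt_of_asymp (P0 Pm Pp X : R) :
  Rabs (P0 - rademacher_main x / sqrt 2) <= / (10 * (x * x)) * (rademacher_main x / sqrt 2) ->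
  Rabs (Pm - rademacher_main (x - 1) / sqrt 2) <= / (10 * ((x - 1) * (x - 1))) * (rademacher_main (x - 1) / sqrt 2) ->
  Rabs (Pp - rademacher_main (x + 1) / sqrt 2) <= / (10 * ((x + 1) * (x + 1))) * (rademacher_main (x + 1) / sqrt 2) ->
  0 < rademacher_main (x - 1) -> 0 < rademacher_main (x + 1) ->
  b / 2 * / (x * s) * (1 - / x / 12) <= X <= b / 2 * / (x * s) ->
  P0 * P0 < Pm * Pp * (1 + X).
Proof.
intros H0 Hm Hp Rm Rp HX.
destruct inv_x_bounds as [[Hz0 Hz] Hxz].
assert (R0 := rademacher_main_pos); assert (HR := rademacher_main_ratio).
assert (HM := main_term_inequality X HX).
assert (Hs2 : 0 < sqrt 2) by (apply sqrt_lt_R0; lra).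
set (z := / x) in *.
assert (Hzz : 0 < z * z) by nra.
set (L0 := 4 / 10 * (z * z * / s) + b / 2 * / (x * s) * (1 + 11 / 10 * z)).
assert (HR' : rademacher_main x * rademacher_main x <= rademacher_main (x - 1) * rademacher_main (x + 1) * exp (- (z * z) + L0)).
  unfold L0; rewrite <- Rplus_assoc; exact HR.
assert (HM' : exp (- (55 / 100 * (z * z)) + L0) < 1 + X) by (unfold L0; rewrite <- Rplus_assoc; exact HM).
assert (E0 : / (10 * (x * x)) = 1 / 10 * (z * z)) by (unfold z; field; lra).
assert (Em : / (10 * ((x - 1) * (x - 1))) <= 101 / 1000 * (z * z)).
  replace (101 / 1000 * (z * z)) with (/ (1000 / 101 * (x * x))) by (unfold z; field; lra).
  apply Rinv_le_contravar; nra.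
assert (Ep : / (10 * ((x + 1) * (x + 1))) <= 101 / 1000 * (z * z)).
  replace (101 / 1000 * (z * z)) with (/ (1000 / 101 * (x * x))) by (unfold z; field; lra).
  apply Rinv_le_contravar; nra.
rewrite E0 in H0.
set (r0 := rademacher_main x) in *; set (rm := rademacher_main (x - 1)) in *; set (rp := rademacher_main (x + 1)) in *.
assert (A0 : 0 < r0 / sqrt 2) by (apply Rdiv_lt_0_compat; lra).
assert (Am : 0 < rm / sqrt 2) by (apply Rdiv_lt_0_compat; lra).
assert (Ap : 0 < rp / sqrt 2) by (apply Rdiv_lt_0_compat; lra).
assert (ER : r0 / sqrt 2 * (r0 / sqrt 2) <= rm / sqrt 2 * (rp / sqrt 2) * exp (- (z * z) + L0)).
  replace (_ * _) with (/ (sqrt 2 * sqrt 2) * (r0 * r0)) by (field; lra).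
  replace (rm / sqrt 2 * (rp / sqrt 2) * exp (- (z * z) + L0)) with (/ (sqrt 2 * sqrt 2) * (rm * rp * exp (- (z * z) + L0))) by (field; lra).
  apply Rmult_le_compat_l; [apply Rlt_le, Rinv_0_lt_compat; nra | exact HR'].
set (a0 := r0 / sqrt 2) in *; set (am := rm / sqrt 2) in *; set (ap := rp / sqrt 2) in *.
assert (Hzs : z * z <= 1 / 1000) by nra.
assert (U0 : Rabs P0 <= a0 * (1 + 1 / 10 * (z * z))).
  replace P0 with ((P0 - a0) + a0) by ring; eapply Rle_trans; [apply Rabs_triang|].
  rewrite (Rabs_pos_eq a0); lra.
assert (Lm : am * (1 - 101 / 1000 * (z * z)) <= Pm).
  assert (/ (10 * ((x - 1) * (x - 1))) * am <= 101 / 1000 * (z * z) * am) by (apply Rmult_le_compat_r; lra).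
  apply Rabs_le_between in Hm; lra.
assert (Lp : ap * (1 - 101 / 1000 * (z * z)) <= Pp).
  assert (/ (10 * ((x + 1) * (x + 1))) * ap <= 101 / 1000 * (z * z) * ap) by (apply Rmult_le_compat_r; lra).
  apply Rabs_le_between in Hp; lra.
set (d := 1 - 101 / 1000 * (z * z)) in *; set (e := 1 + 1 / 10 * (z * z)) in *.
assert (Hd : 0 < d) by (unfold d; lra).
assert (Hde : e * e * exp (- (45 / 100 * (z * z))) <= d * d).
  assert (G : e * exp (- (225 / 1000 * (z * z))) <= d).
    assert (Hq := exp_ineq1_le (225 / 1000 * (z * z))); rewrite exp_Ropp.
    apply (Rmult_le_reg_r (exp (225 / 1000 * (z * z)))); [apply exp_pos|].
    rewrite Rmult_assoc, Rinv_l, Rmult_1_r by (apply Rgt_not_eq, exp_pos).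
    apply Rle_trans with (d * (1 + 225 / 1000 * (z * z))); [unfold d, e; nra | apply Rmult_le_compat_l; lra].
  replace (- (45 / 100 * (z * z))) with (- (225 / 1000 * (z * z)) + - (225 / 1000 * (z * z))) by field.
  rewrite exp_plus.
  replace (_ * _)
    with (e * exp (- (225 / 1000 * (z * z))) * (e * exp (- (225 / 1000 * (z * z))))) by ring.
  assert (0 <= e * exp (- (225 / 1000 * (z * z)))) by (apply Rmult_le_pos; [unfold e; lra | apply Rlt_le, exp_pos]).
  apply Rmult_le_compat; lra.
assert (Hprod : am * ap * (d * d) <= Pm * Pp).
  replace (am * ap * (d * d)) with (am * d * (ap * d)) by ring.
  apply Rmult_le_compat; try lra; apply Rmult_le_pos; lra.
assert (HX0 : 0 < 1 + X) by (generalize (exp_pos (- (55 / 100 * (z * z)) + L0)); lra).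
assert (Hamp : 0 < am * ap) by (apply Rmult_lt_0_compat; assumption).
replace (P0 * P0) with (Rabs P0 * Rabs P0) by (rewrite <- Rabs_mult, Rabs_pos_eq; nra).
apply Rle_lt_trans with (am * ap * (d * d) * exp (- (55 / 100 * (z * z)) + L0)).
- apply Rle_trans with (a0 * e * (a0 * e)).
    apply Rmult_le_compat; auto using Rabs_pos.
  replace (a0 * e * (a0 * e)) with (a0 * a0 * (e * e)) by ring.
  apply Rle_trans with (am * ap * exp (- (z * z) + L0) * (e * e)).
    apply Rmult_le_compat_r; [unfold e; nra | exact ER].
  replace (- (z * z) + L0) with (- (45 / 100 * (z * z)) + (- (55 / 100 * (z * z)) + L0)) by field.
  rewrite exp_plus.
  replace (_ * _)
    with (am * ap * (e * e * exp (- (45 / 100 * (z * z)))) * exp (- (55 / 100 * (z * z)) + L0)) by ring.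
  apply Rmult_le_compat_r; [apply Rlt_le, exp_pos|].
  apply Rmult_le_compat_l; lra.
- apply Rlt_le_trans with (am * ap * (d * d) * (1 + X)).
    apply Rmult_lt_compat_l; [|exact HM'].
    apply Rmult_lt_0_compat; [exact Hamp | apply Rmult_lt_0_compat; lra].
  apply Rmult_le_compat_r; lra.
Qed.
End SecondDifference.

Lemma Rpower_3_2 (y : R) : 0 < y -> Rpower y (3 / 2) = y * sqrt y.
Proof.
intros Hy; replace (3 / 2) with (1 + / 2) by field.
rewrite Rpower_plus, Rpower_1, Rpower_sqrt by exact Hy; reflexivity.
Qed.

(** Since sqrt zeta2 / 2 = pi / sqrt 24, only the passage from n to x = n - 1/24 is at stake:
    (n/x)^(3/2) is at most (1 + z/24)^2 with z = 1/x, and (1 - z/12)(1 + z/24)^2 <= 1. *)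
Lemma ratio_term_bounds (x n : R) : 1998 <= x -> n = x + 1 / 24 ->
  sqrt zeta2 / 2 * / (x * sqrt x) * (1 - / x / 12) <= PI / (sqrt 24 * Rpower n (3 / 2)) <= sqrt zeta2 / 2 * / (x * sqrt x).
Proof.
intros Hx Hn; assert (HPI := PI_RGT_0).
assert (H6 : 0 < sqrt 6) by (apply sqrt_lt_R0; lra).
rewrite Rpower_3_2 by lra.
assert (Hnn : 0 < sqrt n) by (apply sqrt_lt_R0; lra).
assert (Hxx : 0 < sqrt x) by (apply sqrt_lt_R0; lra).
assert (E : PI / (sqrt 24 * (n * sqrt n)) = sqrt zeta2 / 2 * / (n * sqrt n)).
  replace 24 with (2 * 2 * 6) by ring; rewrite sqrt_mult, sqrt_square by lra.
  unfold zeta2; rewrite sqrt_div, sqrt_square by nra.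
  field; repeat split; lra.
rewrite E, Rmult_assoc.
assert (Hb := sqrt_pos zeta2).
assert (Hs : sqrt x <= sqrt n) by (apply sqrt_le_1_alt; lra).
split; apply Rmult_le_compat_l; try lra.
- destruct (inv_x_bounds x Hx) as [[Hz0 Hz] Hxz]; set (z := / x) in *.
  assert (Hsn : sqrt n <= sqrt x * (1 + z / 24)).
    rewrite <- (sqrt_square (1 + z / 24)), <- sqrt_mult by nra; apply sqrt_le_1_alt.
    rewrite Hn; replace (_ * _) with (x + (x * z) / 12 + (x * z) * z / 576) by field.
    rewrite Hxz; lra.
  assert (Hnx : n = x * (1 + z / 24)).
    rewrite Hn; replace (x * (1 + z / 24)) with (x + (x * z) / 24) by field; rewrite Hxz; reflexivity.
  assert (Hns : n * sqrt n <= x * sqrt x * ((1 + z / 24) * (1 + z / 24))).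
    rewrite Hnx at 1; replace (x * sqrt x * ((1 + z / 24) * (1 + z / 24))) with (x * (1 + z / 24) * (sqrt x * (1 + z / 24))) by ring.
    apply Rmult_le_compat_l; [nra | exact Hsn].
  assert (Hp : 0 < n * sqrt n) by (apply Rmult_lt_0_compat; lra).
  assert (Hq : 0 < x * sqrt x) by (apply Rmult_lt_0_compat; lra).
  apply (Rmult_le_reg_r (n * sqrt n)); [exact Hp|]; rewrite Rinv_l by lra.
  apply (Rmult_le_reg_l (x * sqrt x)); [exact Hq|].
  replace (_ * _) with ((1 - z / 12) * (n * sqrt n)) by (field; lra).
  apply Rle_trans with ((1 - z / 12) * (x * sqrt x * ((1 + z / 24) * (1 + z / 24)))); [apply Rmult_le_compat_l; lra|].
  replace (_ * _) with (x * sqrt x * ((1 - z / 12) * ((1 + z / 24) * (1 + z / 24)))) by ring.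
  apply Rmult_le_compat_l; [lra | nra].
- apply Rinv_le_contravar; [apply Rmult_lt_0_compat; lra|].
  apply Rmult_le_compat; lra.
Qed.

(** * Small cases by Euler's recurrence, and large cases *)

(** Euler's recurrence on the list p(n-1), p(n-2), ... in one walk: from m (3m-1)/2 to m (3m+1)/2 is
    a step of m, and from there to the next pentagonal number a step of 2 m + 1. Subtracting the
    recursive call alternates the signs. *)
Fixpoint pent_list (fuel m : nat) (l : list Z) : Z :=
  match fuel with
  | O => 0%Z
  | S f =>
    match l with
    | nil => 0%Z
    | a :: _ =>
      match skipn m l with
      | nil => a
      | (b :: _) as l' => (a + b - pent_list f (S m) (skipn (2 * m + 1) l'))%Z
      end
    end
  end.

Fixpoint partition_table (n : nat) : list Z :=
  match n with
  | O => (1 :: nil)%Z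
  | S k => let l := partition_table k in pent_list n 1 l :: l
  end.

(* The inequality for p(n-1), p(n), p(n+1) = a, b, c, tested on their leading
   bits only: the roundings all go in the safe direction. *)
Definition ratio_test (n a b c : Z) : bool :=
  let k := Z.max 0 (Z.log2 b - 60) in
  let b' := (- Z.shiftr (- b) k)%Z in
  let ac := (Z.shiftr a k * Z.shiftr c k)%Z in
  ((b' * b' - ac) * (Z.sqrt (24 * n * n * n * 1000000) + 1) <? 3141 * ac)%Z.

Fixpoint ratio_tests (k : nat) (n : Z) (l : list Z) : bool :=
  match k with
  | O => true
  | S k' =>
    match l with
    | c :: ((b :: a :: _) as l') => if ratio_test n a b c then ratio_tests k' (n - 1) l' else false
    | _ => false
    end
  end.

(** The 1956 tests run from n = 2000 down to n = 45, and the table goes up to 2001 to provide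
    p(n+1). A list that is too short makes [ratio_tests] fail, so success covers the whole range. *)
Lemma ratio_tests_2000 : ratio_tests 1956 2000 (partition_table 2001) = true.
Proof. vm_compute; reflexivity. Qed.

Lemma shiftr_bounds a k : (0 <= k)%Z -> (Z.shiftr a k * 2 ^ k <= a < (Z.shiftr a k + 1) * 2 ^ k)%Z.
Proof.
intros Hk; rewrite Z.shiftr_div_pow2 by exact Hk.
assert (H : (0 < 2 ^ k)%Z) by (apply Z.pow_pos_nonneg; lia).
generalize (Z.div_mod a (2 ^ k) ltac:(lia)) (Z.mod_pos_bound a (2 ^ k) H); nia.
Qed.

(** With e = 2^k, b' e rounds b up while a' e and c' e round a and c down. S is at least 1000
    sqrt(24 n^3) and 3141/1000 is below pi, so the integer inequality is the stronger one. *)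
Lemma ratio_test_correct n a b c : (0 < n)%Z -> (0 < a)%Z -> (0 < b)%Z -> (0 < c)%Z ->
  ratio_test n a b c = true ->
  IZR b * IZR b < IZR a * IZR c * (1 + PI / (sqrt 24 * (IZR n * sqrt (IZR n)))).
Proof.
intros Hn Ha Hb Hc; unfold ratio_test.
set (k := Z.max 0 (Z.log2 b - 60)); assert (Hk : (0 <= k)%Z) by lia.
set (S := (Z.sqrt (24 * n * n * n * 1000000) + 1)%Z).
destruct (shiftr_bounds a k Hk) as [A1 A2]; destruct (shiftr_bounds (- b) k Hk) as [B1 B2];
  destruct (shiftr_bounds c k Hk) as [C1 C2].
assert (C0 : (0 <= Z.shiftr c k)%Z) by (apply Z.shiftr_nonneg; lia).
set (a' := Z.shiftr a k) in *; set (b' := (- Z.shiftr (- b) k)%Z) in *; set (c' := Z.shiftr c k) in *.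
set (e := (2 ^ k)%Z) in *.
intros H; apply Z.ltb_lt in H.
assert (HS0 : (0 < S)%Z) by (unfold S; generalize (Z.sqrt_nonneg (24 * n * n * n * 1000000)); lia).
assert (HSsq : (24 * n * n * n * 1000000 <= S * S)%Z).
  unfold S; generalize (Z.sqrt_spec (24 * n * n * n * 1000000) ltac:(nia)); unfold Z.succ; lia.
assert (HZ : ((b * b - a * c) * S < 3141 * (a * c))%Z).
  assert (E1 : (b * b <= b' * b' * (e * e))%Z).
    replace (b' * b' * (e * e))%Z with ((b' * e) * (b' * e))%Z by ring; apply Z.mul_le_mono_nonneg; lia.
  assert (E2 : (a' * c' * (e * e) <= a * c)%Z) by nia.
  assert (E3 : ((b' * b' - a' * c') * S * (e * e) < 3141 * (a' * c') * (e * e))%Z)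
    by (apply Z.mul_lt_mono_pos_r; [nia | exact H]).
  assert (E4 : ((b * b - a * c) * S <= (b' * b' * (e * e) - a' * c' * (e * e)) * S)%Z)
    by (apply Z.mul_le_mono_nonneg_r; lia).
  lia.
apply IZR_lt in HZ, Hn, Ha, Hb, Hc, HS0; apply IZR_le in HSsq.
rewrite !mult_IZR, minus_IZR, !mult_IZR in HZ; rewrite !mult_IZR in HSsq.
set (T := sqrt 24 * (IZR n * sqrt (IZR n))).
assert (Hs24 : 0 < sqrt 24) by (apply sqrt_lt_R0; lra).
assert (Hsn : 0 < sqrt (IZR n)) by (apply sqrt_lt_R0; lra).
assert (HT : 0 < T) by (unfold T; repeat apply Rmult_lt_0_compat; assumption).
assert (HTS : 1000 * T <= IZR S).
  apply Rsqr_incr_0; [|lra|lra]; unfold Rsqr, T.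
  replace (_ * _)
    with (1000000 * (sqrt 24 * sqrt 24) * IZR n * IZR n * (sqrt (IZR n) * sqrt (IZR n))) by ring.
  rewrite !sqrt_sqrt by lra; lra.
destruct PI_bounds as [HP _].
assert (Hac : 0 < IZR a * IZR c) by (apply Rmult_lt_0_compat; assumption).
assert (HX : 3141 * / IZR S <= PI / T).
  replace (3141 * / IZR S) with (3141 / 1000 * / (IZR S / 1000)) by (field; lra).
  unfold Rdiv at 3; apply Rmult_le_compat; [lra | apply Rlt_le, Rinv_0_lt_compat; lra | lra |].
  apply Rinv_le_contravar; lra.
assert (HY : IZR b * IZR b - IZR a * IZR c < IZR a * IZR c * (3141 * / IZR S)).
  apply (Rmult_lt_reg_r (IZR S)); [exact HS0|].
  replace (IZR a * IZR c * (3141 * / IZR S) * IZR S) with (3141 * (IZR a * IZR c)) by (field; lra); lra.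
assert (IZR a * IZR c * (3141 * / IZR S) <= IZR a * IZR c * (PI / T)) by (apply Rmult_le_compat_l; lra).
lra.
Qed.

(** Here [cnt N n] stands for the number of partitions of n into parts at most N. The analysis sees
    it only through its recurrence and its agreement with p(n) for N >= n, which keeps lists of
    partitions apart from the real numbers. *)
Section PartitionNumbers.
Variables (cnt : nat -> nat -> nat) (p : nat -> nat).
Hypothesis cnt00 : cnt 0 0 = 1%nat.
Hypothesis cnt0S : forall n, cnt 0 (S n) = 0%nat.
Hypothesis cntS : forall N n,
  cnt (S N) n = (cnt N n + if le_dec (S N) n then cnt (S N) (n - S N) else 0)%nat.
Hypothesis p_cnt : forall N n, (n <= N)%nat -> p n = cnt N n.

Lemma p_gen_coef t N n : 0 < t -> (n <= N)%nat -> INR (p n) = gen_coef t N (Z.of_nat n).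
Proof.
intros Ht HnN; rewrite (p_cnt N n HnN).
apply (gen_coef_unique t Ht (fun N n => INR (cnt N n))).
- rewrite cnt00; reflexivity.
- intros m; rewrite cnt0S; reflexivity.
- intros M m; rewrite cntS, plus_INR; f_equal; destruct (le_dec _ _); reflexivity.
Qed.

Lemma p_pos n : (0 < p n)%nat.
Proof.
rewrite (p_cnt (S n) n) by lia.
assert (H1 : forall m, (0 < cnt 1 m)%nat).
  induction m as [|m IH]; rewrite cntS.
    rewrite cnt00; lia.
  destruct (le_dec 1 (S m)); [|lia]; rewrite Nat.sub_succ, Nat.sub_0_r; lia.
assert (H2 : forall N, (0 < cnt (S N) n)%nat).
  induction N as [|N IH]; [apply H1|]; rewrite cntS; lia.
apply H2.
Qed.

Definition pz (k : Z) : Z := if (k <? 0)%Z then 0%Z else Z.of_nat (p (Z.to_nat k)).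

Lemma pz_gen_coef t N k : 0 < t -> (k <= Z.of_nat N)%Z -> IZR (pz k) = gen_coef t N k.
Proof.
intros Ht Hk; unfold pz; destruct (Z.ltb_spec k 0) as [H|H].
- rewrite gen_coef_neg; auto.
- rewrite <- INR_IZR_INZ, (p_gen_coef t N) by (auto || lia); f_equal; lia.
Qed.

(** The sum computed by [pent_list] with the list replaced by the function [pz]: running off the end
    of the list becomes a negative argument, where [pz] is zero. *)
Fixpoint pent_alt (f m : nat) (a : Z) : Z :=
  match f with
  | O => 0%Z
  | S f' => (pz a + pz (a - Z.of_nat m) - pent_alt f' (S m) (a - Z.of_nat (3 * m + 1)))%Z
  end.

Lemma pent_alt_neg f m a : (a < 0)%Z -> pent_alt f m a = 0%Z.
Proof.
assert (Hn : forall k, (k < 0)%Z -> pz k = 0%Z) by (intros k Hk; unfold pz; destruct (Z.ltb_spec k 0); lia).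
revert m a; induction f as [|f IH]; intros m a Ha; [reflexivity|].
simpl pent_alt; rewrite IH, !Hn by lia; reflexivity.
Qed.

Fixpoint plist (n : nat) : list Z :=
  match n with O => pz 0 :: nil | S k => pz (Z.of_nat n) :: plist k end.

Lemma skipn_plist k n : skipn k (plist n) = if le_dec k n then plist (n - k) else nil.
Proof.
revert n; induction k as [|k IH]; intros n.
- rewrite Nat.sub_0_r; destruct (le_dec 0 n); [reflexivity | lia].
- destruct n as [|n]; cbn [plist skipn].
  + rewrite skipn_nil; reflexivity.
  + rewrite IH; destruct (le_dec k n), (le_dec (S k) (S n)); try lia; reflexivity.
Qed.

Lemma plist_cons n : exists l, plist n = pz (Z.of_nat n) :: l.
Proof. destruct n as [|n]; eexists; reflexivity. Qed.

Lemma pent_list_plist f m n : (0 < m)%nat -> pent_list f m (plist n) = pent_alt f m (Z.of_nat n).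
Proof.
assert (Hn : forall k, (k < 0)%Z -> pz k = 0%Z) by (intros k Hk; unfold pz; destruct (Z.ltb_spec k 0); lia).
revert m n; induction f as [|f IH]; intros m n Hm; [reflexivity|].
cbn [pent_list pent_alt].
destruct (plist_cons n) as [l El].
transitivity (match skipn m (plist n) with
  | nil => pz (Z.of_nat n)
  | (b :: _) as l' => (pz (Z.of_nat n) + b - pent_list f (S m) (skipn (2 * m + 1) l'))%Z
  end).
  rewrite El; reflexivity.
rewrite skipn_plist; destruct (le_dec m n) as [H|H].
- destruct (plist_cons (n - m)) as [l' El'].
  transitivity (pz (Z.of_nat n) + pz (Z.of_nat (n - m)) - pent_list f (S m) (skipn (2 * m + 1) (plist (n - m))))%Z.
    rewrite El'; reflexivity.
  rewrite skipn_plist; f_equal; [do 2 f_equal; lia|].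
  destruct (le_dec (2 * m + 1) (n - m)) as [H'|H'].
  + rewrite IH by lia; f_equal; lia.
  + rewrite pent_alt_neg by lia; destruct f; reflexivity.
- rewrite (Hn (Z.of_nat n - Z.of_nat m)%Z), pent_alt_neg by lia; lia.
Qed.

(** [pent_alt] unfolds from the smallest pentagonal numbers, [pent_conv] adds the largest ones last.
    This peels the last pair off [pent_alt], so that both can be compared by one induction. *)
Lemma pent_alt_S f i a : IZR (pent_alt (S f) (S i) a) =
  IZR (pent_alt f (S i) a) + (-1) ^ f *
    (IZR (pz (a + Z.of_nat (gpent i + 2 * i) - Z.of_nat (gpent (i + f) + 2 * (i + f))))
     + IZR (pz (a + Z.of_nat (gpent i + 2 * i + 1) - Z.of_nat (gpent (S (i + f)))))).
Proof.
revert i a; induction f as [|f IH]; intros i a.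
- cbn [pent_alt]; rewrite Nat.add_0_r, Z.sub_0_r, plus_IZR, Rmult_1_l, Rplus_0_l; f_equal; do 2 f_equal;
    cbn [gpent]; lia.
- change (pent_alt (S (S f)) (S i) a)
    with (pz a + pz (a - Z.of_nat (S i)) - pent_alt (S f) (S (S i)) (a - Z.of_nat (3 * S i + 1)))%Z.
  rewrite minus_IZR, IH; cbn [pent_alt]; rewrite minus_IZR.
  replace (i + S f)%nat with (S i + f)%nat by lia.
  replace (a - Z.of_nat (3 * S i + 1) + Z.of_nat (gpent (S i) + 2 * S i))%Z
    with (a + Z.of_nat (gpent i + 2 * i))%Z by (cbn [gpent]; lia).
  replace (a - Z.of_nat (3 * S i + 1) + Z.of_nat (gpent (S i) + 2 * S i + 1))%Z
    with (a + Z.of_nat (gpent i + 2 * i + 1))%Z by (cbn [gpent]; lia).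
  simpl pow; ring.
Qed.

Lemma pent_alt_conv t N k f : 0 < t -> (k <= Z.of_nat N)%Z ->
  IZR (pent_alt f 1 (k - 1)) = gen_coef t N k - pent_conv t N k f.
Proof.
intros Ht Hk; induction f as [|f IH].
- cbn [pent_alt pent_conv]; ring.
- rewrite pent_alt_S, IH; cbn [pent_conv]; change (0 + f)%nat with f.
  rewrite !(pz_gen_coef t N) by (auto || (cbn [gpent]; lia)).
  replace (_ - _)%Z
    with (k - Z.of_nat (gpent f + 2 * f + 1))%Z by (cbn [gpent]; lia).
  replace (k - 1 + Z.of_nat (gpent 0 + 2 * 0 + 1) - Z.of_nat (gpent (S f)))%Z
    with (k - Z.of_nat (gpent (S f)))%Z by (cbn [gpent]; lia).
  simpl pow; ring.
Qed.

Lemma partition_table_plist n : partition_table n = plist n.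
Proof.
induction n as [|n IH].
- cbn [partition_table plist]; unfold pz; simpl; rewrite (p_cnt 0 0), cnt00 by lia; reflexivity.
- cbn [partition_table plist]; rewrite IH; f_equal.
  rewrite pent_list_plist by lia; apply eq_IZR.
  replace (Z.of_nat n) with (Z.of_nat (S n) - 1)%Z by lia.
  (* The coefficients are the same on every circle; t = 1 is chosen for definiteness. *)
  rewrite (pent_alt_conv 1 (S n)) by (lra || lia).
  rewrite pentagonal_recurrence by (lra || lia).
  rewrite (pz_gen_coef 1 (S n)) by (lra || lia); ring.
Qed.

Lemma ratio_tests_correct k n : (k <= n)%nat -> ratio_tests k (Z.of_nat n) (plist (S n)) = true ->
  forall m, (n < m + k)%nat -> (m <= n)%nat ->
  ratio_test (Z.of_nat m) (pz (Z.of_nat (m - 1))) (pz (Z.of_nat m)) (pz (Z.of_nat (S m))) = true.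
Proof.
revert n; induction k as [|k IH]; intros n Hk H m H1 H2; [lia|].
destruct n as [|n]; [lia|].
destruct (plist_cons n) as [l El].
change (plist (S (S n))) with (pz (Z.of_nat (S (S n))) :: pz (Z.of_nat (S n)) :: plist n) in H.
cbn [ratio_tests] in H; rewrite El in H.
destruct (ratio_test _ _ _ _) eqn:HT in H; [|discriminate].
destruct (Nat.eq_dec m (S n)) as [->|Hm].
- rewrite Nat.sub_succ, Nat.sub_0_r; exact HT.
- apply (IH n); try lia.
  rewrite <- El in H; replace (Z.of_nat (S n) - 1)%Z with (Z.of_nat n) in H by lia; exact H.
Qed.

(** * The two ranges of n and the final inequality *)

Lemma pz_nat n : pz (Z.of_nat n) = Z.of_nat (p n).
Proof. unfold pz; destruct (Z.ltb_spec (Z.of_nat n) 0); [lia|]; rewrite Nat2Z.id; reflexivity. Qed.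

Lemma small_case n : (45 <= n <= 2000)%nat ->
  INR (p n) * INR (p n) < INR (p (n - 1)) * INR (p (S n)) * (1 + PI / (sqrt 24 * (INR n * sqrt (INR n)))).
Proof.
intros Hn.
assert (H := ratio_tests_correct 1956 2000 ltac:(lia)).
rewrite <- partition_table_plist in H.
specialize (H ratio_tests_2000 n ltac:(lia) ltac:(lia)).
rewrite !pz_nat in H; rewrite !INR_IZR_INZ.
apply ratio_test_correct; auto; generalize (p_pos n) (p_pos (n - 1)) (p_pos (S n)); lia.
Qed.

Lemma p_asymp n : (1999 <= n)%nat ->
  let x := INR n - 1 / 24 in
  Rabs (2 * PI * INR (p n) - rademacher_main x / sqrt 2) <= / (10 * (x * x)) * (rademacher_main x / sqrt 2).
Proof.
intros Hn x; destruct (gen_coef_asymp n Hn) as [Ht [N0 HN0]].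
(* The number of factors exceeds both n, which makes the coefficient equal to p(n), and the
   threshold of the asymptotic estimate. *)
rewrite (p_gen_coef (saddle_point x) (Nat.max N0 n) n Ht) by lia.
apply HN0; lia.
Qed.

Lemma large_case n : (2000 <= n)%nat ->
  INR (p n) * INR (p n) < INR (p (n - 1)) * INR (p (S n)) * (1 + PI / (sqrt 24 * Rpower (INR n) (3 / 2))).
Proof.
intros Hn; assert (Hn' := le_INR _ _ Hn); rewrite (INR_IZR_INZ 2000) in Hn'; simpl in Hn'.
set (x := INR n - 1 / 24).
assert (Hx : 1998 <= x) by (unfold x; lra).
assert (Ex : INR (n - 1) - 1 / 24 = x - 1) by (rewrite minus_INR by lia; unfold x; simpl; ring).
assert (Ey : INR (S n) - 1 / 24 = x + 1) by (rewrite S_INR; unfold x; ring).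
assert (A0 := p_asymp n ltac:(lia)); assert (Am := p_asymp (n - 1) ltac:(lia)); assert (Ap := p_asymp (S n) ltac:(lia)).
cbv zeta in A0, Am, Ap; rewrite Ex in Am; rewrite Ey in Ap; fold x in A0.
assert (Rm : 0 < rademacher_main (x - 1)) by (apply rademacher_main_pos; unfold x; lra).
assert (Rp : 0 < rademacher_main (x + 1)) by (apply rademacher_main_pos; lra).
assert (HX := ratio_term_bounds x (INR n) Hx ltac:(unfold x; ring)).
assert (G := square_lt_of_asymp x Hx _ _ _ _ A0 Am Ap Rm Rp HX).
assert (HPI := PI_RGT_0).
apply (Rmult_lt_reg_l (2 * PI * (2 * PI))); [nra|]; lra.
Qed.

Lemma partition_ratio_inequality n : (45 <= n)%nat ->
  INR (p (n - 1)) / INR (p n) * (1 + PI / (sqrt 24 * Rpower (INR n) (3 / 2))) > INR (p n) / INR (p (n + 1)).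
Proof.
intros Hn; assert (Hn' := le_INR _ _ Hn); rewrite (INR_IZR_INZ 45) in Hn'; simpl in Hn'.
assert (H : INR (p n) * INR (p n) < INR (p (n - 1)) * INR (p (S n)) * (1 + PI / (sqrt 24 * Rpower (INR n) (3 / 2)))).
  destruct (le_dec n 2000).
  - rewrite Rpower_3_2 by lra; apply small_case; lia.
  - apply large_case; lia.
rewrite Nat.add_1_r.
assert (P1 := lt_0_INR _ (p_pos n)); assert (P2 := lt_0_INR _ (p_pos (S n))).
apply (Rmult_lt_reg_r (INR (p n) * INR (p (S n)))); [nra|].
replace (_ * _) with (INR (p n) * INR (p n)) by (field; lra).
replace (INR (p (n - 1)) / INR (p n) * (1 + PI / (sqrt 24 * Rpower (INR n) (3 / 2))) * (INR (p n) * INR (p (S n))))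
  with (INR (p (n - 1)) * INR (p (S n)) * (1 + PI / (sqrt 24 * Rpower (INR n) (3 / 2)))).
  exact H.
set (Y := PI / _); field; lra.
Qed.
End PartitionNumbers.

From mathcomp Require Import all_boot.

Local Close Scope R_scope.

(** * Listing partitions *)

(* Partitions of n into parts at most N; go recurses on the same N, with a fuel
   f that suffices when it is at least m. *)
Fixpoint partitions (N : nat) : nat -> seq (seq nat) :=
  match N with
  | 0 => fun n => if n == 0 then [:: [::]] else [::]
  | N'.+1 => fun n =>
    (fix go f m := match f with
      | 0 => partitions N' m
      | f'.+1 => partitions N' m ++
                 (if N' < m then map (cons N'.+1) (go f' (m - N'.+1)) else [::])
      end) n n
  end.

Lemma partitions_S N n : partitions N.+1 n = partitions N n ++
  (if N < n then map (cons N.+1) (partitions N.+1 (n - N.+1)) else [::]).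
Proof.
rewrite /=; set go := (fix go f m := match f with 0 => _ | _.+1 => _ end).
have goE f m : m <= f -> go f m = go m m.
  elim/ltn_ind: m f => m IH [|f]; first by rewrite leqn0 => /eqP->.
  case: m IH => [|m] IH le_mf; first by rewrite /= cats0.
  rewrite /=; congr (_ ++ _); case: ltnP => // ltNm.
  by rewrite IH ?(IH _ _ m) // ?subSS ?ltnS ?leq_subr // (leq_trans (leq_subr _ _)).
case: n => [|n]; first by rewrite /= !cats0.
rewrite [LHS]/=; congr (_ ++ _); case: ltnP => // ltNn.
by rewrite goE // subSS leq_subr.
Qed.

(** As the parts are nonincreasing, a partition into parts at most N + 1 either has all parts at
    most N or begins with N + 1, and these are the two lists joined in [partitions_S]. *)
Lemma mem_partitions N n s :
  (s \in partitions N n) = is_partition n s && all (fun x => x <= N) s.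
Proof.
elim: N n s => [|N IHN] n s.
  rewrite /is_partition; case: s => [|[|x] s] /=; last 2 first.
  - by rewrite andbF; case: eqP.
  - by rewrite andbF; case: eqP.
  by rewrite andbT eq_sym; case: eqP.
elim/ltn_ind: n s => n IHn s; rewrite partitions_S mem_cat IHN.
have -> : (s \in (if N < n then map (cons N.+1) (partitions N.+1 (n - N.+1)) else [::])) =
  [&& is_partition n s, all (fun x => x <= N.+1) s & head 0 s == N.+1].
  case: ltnP => [ltNn | leNn]; last first.
    rewrite in_nil; apply/esym/negbTE/negP => /and3P[/and3P[_ _ /eqP sn] _ /eqP].
    case: s sn => [|x s] //= sn xN.
    by move: leNn; rewrite -sn xN leqNgt ltnS leq_addr.
  apply/mapP/idP => [[s' s'in ->] | ].
    move: s'in; rewrite IHn ?ltn_subrL ?(leq_ltn_trans _ ltNn) // => /andP[/and3P[srt pos /eqP sm] ub].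
    rewrite /is_partition /= eqxx andbT leqnn ub pos sm subnKC // eqxx !andbT /=.
    by rewrite path_sortedE; [rewrite ub | move=> x y z; exact: (rev_trans leq_trans)].
  case: s => [|x s]; first by rewrite /= andbF.
  move=> /and3P[part ub /eqP xN]; rewrite /= in ub xN; case/andP: ub => _ ub.
  case/and3P: part => /= srt pos /eqP sm; case/andP: pos => _ pos.
  exists s; last by rewrite xN.
  rewrite IHn ?ltn_subrL ?(leq_ltn_trans _ ltNn) // ub andbT /is_partition pos -sm xN addKn eqxx andbT.
  by rewrite andbT (path_sorted srt).
case: s => [|x s] /=; first by rewrite !andbF !andbT orbF.
rewrite -andb_orr; apply: andb_id2l => /and3P[/= srt _ _].
rewrite [x <= N.+1]leq_eqVlt ltnS; case: eqP => [-> | _] /=; rewrite ?ltnn ?andbF ?andbT //=.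
rewrite orbF; case: leqP => //= lexN; symmetry.
move: srt; rewrite path_sortedE; last by move=> u v w; exact: (rev_trans leq_trans).
case/andP => /allP le_x _.
have allN : all (leq^~ N) s by apply/allP => y /le_x yx; apply: leq_trans lexN.
by rewrite allN; apply/allP => y /(allP allN) /leqW.
Qed.

Lemma uniq_partitions N n : uniq (partitions N n).
Proof.
elim: N n => [|N IHN] n; first by rewrite /=; case: eqP.
elim/ltn_ind: n => n IHn; rewrite partitions_S cat_uniq IHN /=.
case: ltnP => // ltNn.
rewrite map_inj_uniq ?IHn ?ltn_subrL ?(leq_ltn_trans _ ltNn) //; last by move=> ? ? [].
rewrite andbT; apply/hasPn => _ /mapP[s _ ->].
by rewrite mem_partitions /= ltnn !andbF.
Qed.

Lemma partition_number_size N n : n <= N -> partition_number n = size (partitions N n).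
Proof.
move=> le_nN; apply/esym/partition_number_unique; first exact: uniq_partitions.
move=> s; rewrite mem_partitions; apply: andb_idr => /partition_bounds[_].
by apply: sub_all => x; rewrite ltnS => /leq_trans->.
Qed.

Lemma size_partitions_S N n : size (partitions N.+1 n) =
  size (partitions N n) + (if N < n then size (partitions N.+1 (n - N.+1)) else 0).
Proof. by rewrite partitions_S size_cat; case: ifP => //; rewrite size_map. Qed.

Local Open Scope R_scope.

Theorem mainTheorem1 (n : nat) (hn : (45 <= n)%N) :
  INR (partition_number (n - 1)%N) / INR (partition_number n)
    * (1 + PI / (sqrt 24 * Rpower (INR n) (3 / 2)))
  > INR (partition_number n) / INR (partition_number (n + 1)%N).
Proof.
apply: (partition_ratio_inequality (fun N n => size (partitions N n)) partition_number) => //.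
- move=> N m; rewrite size_partitions_S.
  by case: (le_dec N.+1 m) => [/leP-> | /leP/negbTE->].
- by move=> N m /leP/partition_number_size.
- exact/leP.
Qed.
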